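(* Let $G$ be a connected Lie group with Lie algebra $\mathfrak g$, let $|\cdot|$ be any $\mathrm{Ad}$-invariant Finsler norm on $\mathfrak g$, and let $d$ be the induced bi-invariant distance on $G$. Then for all $x,y\in\mathfrak g$, $$S(x,y)=6|y-x|\lim_{r\to0^+}\frac{d(e^{r^2x},e^{r^2y})-r\,d(e^{rx},e^{ry})}{r^4}=-\frac{|y-x|}{4}\max_{\varphi\in N_{y-x}}\varphi([x,[x,y-x]])\ge 0 .$$
   Context: A Finsler norm on a finite-dimensional real vector space $\mathfrak g$ is a map $|\cdot|:\mathfrak g\to[0,\infty)$ with $|x+y|\le|x|+|y|$, $|\lambda x|=\lambda|x|$ for $\lambda\ge0$, and $|x|=0\iff x=0$ (possibly $|-x|\ne|x|$). It is $\mathrm{Ad}$-invariant if $|\mathrm{Ad}_g x|=|x|$ for all $g\in G$, $x\in\mathfrak g$. Write $e^x=\exp(x)$. The induced (possibly non-reversible) distance is $d(g,h)=\inf\int_a^b|L_{\alpha(t)}^{-1}\alpha'(t)|\,dt$ over all rectifiable (absolutely continuous, with integrable speed) paths $\alpha:[a,b]\to G$ with $\alpha(a)=g$, $\alpha(b)=h$, where $L_g$ is the differential of left multiplication by $g$. The dual Finsler norm is $\|\varphi\|=\max\{\varphi(x):|x|\le1\}$ for $\varphi\in\mathfrak g'$ (real dual). $N_v=\{\varphi\in\mathfrak g':\|\varphi\|=1,\ \varphi(v)=|v|\}$ is the set of functionals norming $v$. For $x\neq y$ in $\mathfrak g$, $$S(x,y)=6|y-x|^2\lim_{r\to0^+}\frac{r|y-x|-d(e^{rx},e^{ry})}{r^2\,d(e^{rx},e^{ry})},$$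 and $S(x,x)=0$. *)

(* Defs.v *)
From HB Require Import structures.
From mathcomp Require Import all_boot all_order all_algebra.
From mathcomp Require Import all_classical all_reals all_analysis.

Set Implicit Arguments.
Unset Strict Implicit.
Unset Printing Implicit Defensive.

Import Order.TTheory GRing.Theory Num.Theory.
Import numFieldNormedType.Exports.

Local Open Scope classical_set_scope.
Local Open Scope ring_scope.

(* C^k on an open set U: the Fréchet derivative exists at every point of U and
   all its directional components x |-> 'd f x v are C^(k-1). In finite
   dimension this is continuity of the derivatives up to order k. *)
Fixpoint Ck_on (R : realType) (V W : normedModType R) (k : nat)
    (U : set V) (f : V -> W) : Prop :=
  if k is k'.+1 then
    (forall x, U x -> differentiable f x) /\
    (forall v, Ck_on k' U (fun x => 'd f x v))
  else forall x, U x -> {for x, continuous f}.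

Definition smooth_on (R : realType) (V W : normedModType R)
    (U : set V) (f : V -> W) : Prop := forall k, Ck_on k U f.

(* Homeomorphism between an open subset of M and an open subset of R^n; the
   total functions chart_fun and chart_inv are meaningless outside of them. *)
Record chart (R : realType) (n : nat) (M : topologicalType) := Chart {
  chart_dom : set M ;
  chart_fun :> M -> 'rV[R]_n ;
  chart_inv : 'rV[R]_n -> M ;
  chart_dom_open : open chart_dom ;
  chart_cod_open : open (chart_fun @` chart_dom) ;
  chart_funK : forall p, chart_dom p -> chart_inv (chart_fun p) = p ;
  chart_continuous : forall p, chart_dom p -> {for p, continuous chart_fun} ;
  chart_inv_continuous : forall u, (chart_fun @` chart_dom) u ->
    {for u, continuous chart_inv} }.

Definition chart_cod (R : realType) (n : nat) (M : topologicalType)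
  (c : chart R n M) : set 'rV[R]_n := c @` chart_dom c.

HB.mixin Record isSmoothManifold (R : realType) (n : nat) M
    of Topological M := {
  manifold_hausdorff : hausdorff_space M ;
  manifold_second_countable : @second_countable M ;
  (* The atlas is the range of chart_at. *)
  chart_at : M -> chart R n M ;
  chart_at_dom : forall p, chart_dom (chart_at p) p ;
  chart_at_compat : forall p q,
    smooth_on (chart_at p @` (chart_dom (chart_at p) `&` chart_dom (chart_at q)))
              (chart_at q \o chart_inv (chart_at p)) }.

#[short(type="smoothManifoldType")]
HB.structure Definition SmoothManifold (R : realType) (n : nat) :=
  {M of isSmoothManifold R n M & Topological M}.

#[short(type="smoothPreGroupType")]
HB.structure Definition SmoothPreGroup (R : realType) (n : nat) :=
  {G of SmoothManifold R n G & Group G}.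

HB.mixin Record SmoothPreGroup_isLieGroup (R : realType) (n : nat) G
    of SmoothPreGroup R n G := {
  lie_mul_continuous : continuous (fun p : G * G => (p.1 * p.2)%g) ;
  lie_inv_continuous : continuous (fun g : G => g^-1%g) ;
  lie_mul_smooth : forall g h : G,
    let c1 : chart R n G := chart_at g in
    let c2 : chart R n G := chart_at h in
    let c : chart R n G := chart_at (g * h)%g in
    smooth_on
      [set w : 'rV[R]_n * 'rV[R]_n | [/\ chart_cod c1 w.1, chart_cod c2 w.2 &
        chart_dom c (chart_inv c1 w.1 * chart_inv c2 w.2)%g]]
      (fun w => c (chart_inv c1 w.1 * chart_inv c2 w.2)%g) ;
  lie_inv_smooth : forall g : G,
    let c1 : chart R n G := chart_at g in
    let c : chart R n G := chart_at g^-1%g in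
    smooth_on [set u | chart_cod c1 u /\ chart_dom c (chart_inv c1 u)^-1%g]
              (fun u => c (chart_inv c1 u)^-1%g) }.

#[short(type="lieGroupType")]
HB.structure Definition LieGroup (R : realType) (n : nat) :=
  {G of SmoothPreGroup_isLieGroup R n G & SmoothPreGroup R n G}.

(* The Lie algebra, i.e. the tangent space at 1, is 'rV[R]_n: a tangent vector
   is represented by its coordinates in the chart chart_at 1. *)
Section LieAlgebra.
Variables (R : realType) (n : nat) (G : lieGroupType R n).
Implicit Types (g : G) (x y v w u : 'rV[R]_n).

Definition chart1 : chart R n G := chart_at (1%g : G).

Definition Ad g x : 'rV[R]_n :=
  'd (fun u => chart1 (g * chart_inv chart1 u * g^-1)%g) (chart1 1%g) x.

(* Left-invariant vector field with value x at 1, read in the chart at 1. *)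
Definition left_field x u : 'rV[R]_n :=
  'd (fun w => chart1 (chart_inv chart1 u * chart_inv chart1 w)%g)
     (chart1 1%g) x.

(* Coordinates at 1 of the bracket of the two left-invariant vector fields:
   [X, Y]^i = \sum_j (X^j d_j Y^i - Y^j d_j X^i). *)
Definition lie_bracket x y : 'rV[R]_n :=
  'd (left_field y) (chart1 1%g) x - 'd (left_field x) (chart1 1%g) y.

Definition one_param_subgroup (c : R -> G) x : Prop :=
  [/\ forall s t : R, c (s + t) = (c s * c t)%g,
      continuous c &
      is_derive (0 : R) (1 : R) (chart1 \o c) x].

(* There is exactly one such c for each x, so the default value is not used. *)
Definition lie_exp x : G :=
  xget (fun=> 1%g) [set c : R -> G | one_param_subgroup c x] 1.

End LieAlgebra.

Section FinslerNorm.
Variables (R : realType) (V : lmodType R).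

Definition finsler_norm (N : V -> R) : Prop :=
  [/\ forall x, 0 <= N x,
      forall x y, N (x + y) <= N x + N y,
      forall (a : R) x, 0 <= a -> N (a *: x) = a * N x &
      forall x, N x = 0 <-> x = 0].

(* The supremum is attained when V has finite dimension. *)
Definition dual_norm (N : V -> R) (phi : {scalar V}) : R :=
  sup [set phi x | x in [set x | N x <= 1]].

Definition norming (N : V -> R) (v : V) : set {scalar V} :=
  [set phi | dual_norm N phi = 1 /\ phi v = N v].

End FinslerNorm.

Definition is_max (R : realType) (A : set R) (m : R) : Prop :=
  A m /\ ubound A m.

Definition abs_continuous (R : realType) (V : normedModType R) (a b : R)
    (f : R -> V) : Prop :=
  forall e : R, 0 < e -> exists2 d : R, 0 < d &
    forall (k : nat) (s t : 'I_k -> R),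
      (forall i, [/\ a <= s i, s i <= t i & t i <= b]) ->
      trivIset [set: 'I_k] (fun i => `]s i, t i[%classic) ->
      \sum_(i < k) (t i - s i) < d ->
      \sum_(i < k) `|f (t i) - f (s i)| < e.

Section LieDistance.
Variables (R : realType) (n : nat) (G : lieGroupType R n).
Variable N : 'rV[R]_n -> R.

Definition Ad_invariant : Prop := forall (g : G) x, N (Ad g x) = N x.

(* L_{alpha(t)}^{-1} alpha'(t) is the velocity at s = t of the curve
   s |-> alpha(t)^-1 * alpha(s), which passes through 1. *)
Definition speed (alpha : R -> G) (t : R) : R :=
  N (derive1 (fun s => chart1 G ((alpha t)^-1 * alpha s)%g) t).

Definition abs_continuous_path (a b : R) (alpha : R -> G) : Prop :=
  {within `[a, b], continuous alpha} /\
  forall t, t \in `[a, b] -> exists2 e : R, 0 < e &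
    let a' := Num.max a (t - e) in
    let b' := Num.min b (t + e) in
    let c : chart R n G := chart_at (alpha t) in
    (forall s, s \in `[a', b'] -> chart_dom c (alpha s)) /\
    abs_continuous a' b' (c \o alpha).

Definition rectifiable (a b : R) (alpha : R -> G) : Prop :=
  abs_continuous_path a b alpha /\
  (@lebesgue_measure R).-integrable `[a, b] (EFin \o speed alpha).

Definition path_length (a b : R) (alpha : R -> G) : R :=
  \int[@lebesgue_measure R]_(t in `[a, b]) speed alpha t.

Definition finsler_dist (g h : G) : R :=
  inf [set L | exists a b (alpha : R -> G),
    [/\ a < b, rectifiable a b alpha, alpha a = g, alpha b = h &
        L = path_length a b alpha]].

Definition exp_dist (x y : 'rV[R]_n) : R :=
  finsler_dist (lie_exp G x) (lie_exp G y).

Definition S_quotient (x y : 'rV[R]_n) (r : R) : R :=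
  (r * N (y - x) - exp_dist (r *: x) (r *: y)) /
  (r ^+ 2 * exp_dist (r *: x) (r *: y)).

Definition S_curv (x y : 'rV[R]_n) : R :=
  if x == y then 0
  else 6 * N (y - x) ^+ 2 * lim (S_quotient x y r @[r --> 0^'+]).

End LieDistance.

(* Main.v *)
(* Write v = y - x, X = [x, [x, v]], and let q be the one-sided derivative of the
   norm N at v in the direction X; by Hahn-Banach q is the maximum of phi X over
   the functionals phi norming v.

   Near 1 the distance is read off in logarithmic coordinates:
   d(g, g e^z) = N z for small z. The path g e^(tz) has length N z. Conversely, a
   functional phi norming p satisfies phi [w, p] = 0, since N is Ad-invariant, so
   phi is invariant under Ad e^(tp); doubling s in log (e^(-sz) e^(sp)) then gives
   N p <= N z + N (log (e^(-z) e^p)) + O(|p - z|^2). Hence the norm of the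
   logarithm grows along an absolutely continuous path at most at the rate of its
   speed.

   It remains to expand N (log (e^(-rx) e^(ry))), which equals N Z for
   Z = log (e^(-rx/2) e^(ry) e^(-rx/2)), a conjugate. The relation between Z at r
   and at 2r yields Z = r v + r^3 (X/24 + [v, [x, v]]/12) + O(r^4), and the second
   cubic term is removed by a further conjugation. Thus
   d(e^(rx), e^(ry)) = r N v + r^3 q/24 + o(r^3), and both limits follow. Finally
   q <= 0, because N (Ad e^(tx) v) = N v while phi [x, v] = 0 for phi norming v.

   The coordinates are those of the linearization of the squaring map at 1 (Koenigs),
   which turns out to be the exponential map; all error estimates are obtained by
   comparing a quantity at s and at 2s. *)
Require Import Defs.
From HB Require Import structures.
From mathcomp Require Import all_boot all_order all_algebra.
From mathcomp Require Import all_classical all_reals all_analysis measurable_realfun.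
From mathcomp Require Import ring lra.

Set Implicit Arguments.
Unset Strict Implicit.
Unset Printing Implicit Defensive.

Import Order.TTheory GRing.Theory Num.Theory.
Import numFieldNormedType.Exports.

Local Open Scope classical_set_scope.
Local Open Scope ring_scope.

(** * Absolutely continuous functions *)

(** The group law is given in charts only, so neither smoothness of [lie_exp] nor a
    Baker-Campbell-Hausdorff series is at hand. A single device replaces them ([halving_bound]): a
    function f with f s = o(s) whose defect f (2 s) - 2 f s is O(s^m), m >= 2, is itself O(s^m), and
    it vanishes if the defect does. As the coordinates turn squaring into doubling exactly, each
    expansion reduces to an algebraic identity between group elements at s and 2 s, with one crude
    estimate. Second derivatives of the multiplication are all that is differentiated. The answer
    sits in the r^3 term, so the distance must be known exactly near 1; a bound N z (1 + O(|z|^2))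
    would be too weak. Hence the error in the triangle inequality for logarithms has to be quadratic
    in the increment p - z, however large p is in comparison: it then disappears from the derivative
    along a path and nothing accumulates. Competing paths are merely absolutely continuous, so this
    derivative exists almost everywhere only, and the norm of the logarithm is recovered from it
    through a fundamental theorem of calculus built on the Radon-Nikodym theorem. *)

Section AbsoluteContinuity.
Variable R : realType.
Implicit Types (a b s t : R).
Local Notation TV := (@total_variation R).

(** Arbitrary finite index types are needed for the gluing below, where an index is a pair of an
    interval and one of its pieces. Only nondegenerate intervals have to be ordered, since an empty
    open interval is disjoint from every other. *)
Lemma abs_continuous_fin (V : normedModType R) a b (f : R -> V) :
  abs_continuous a b f -> forall e : R, 0 < e -> exists2 d : R, 0 < d &
    forall (I : finType) (s t : I -> R),
      (forall i, [/\ a <= s i, s i <= t i & t i <= b]) ->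
      (forall i j, i != j -> s i < t i -> s j < t j ->
        t i <= s j \/ t j <= s i) ->
      \sum_i (t i - s i) < d -> \sum_i `|f (t i) - f (s i)| < e.
Proof.
move=> acf e /acf [d d0 H]; exists d => // I s t st dis.
rewrite (reindex _ (onW_bij _ (@enum_val_bij I))) => sd.
rewrite (reindex _ (onW_bij _ (@enum_val_bij I))).
apply: (H _ (fun i => s (enum_val i)) (fun i => t (enum_val i))) => //.
move=> i j _ _ [x /= []]; rewrite !in_itv/= => /andP[si ti] /andP[sj tj].
apply/eqP/negPn/negP => ij.
have /dis : enum_val i != enum_val j by apply: contra ij => /eqP/enum_val_inj ->.
by move=> /(_ (lt_trans si ti) (lt_trans sj tj)) [] h; move: si ti sj tj h; lra.
Qed.

Lemma abs_continuousS (V : normedModType R) a b a' b' (f : R -> V) :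
  a <= a' -> b' <= b -> abs_continuous a b f -> abs_continuous a' b' f.
Proof.
move=> aa bb acf e /acf [d d0 H]; exists d => // k s t st; apply: H => i.
by have [? ? ?] := st i; split; lra.
Qed.

Lemma itv_partition_nth a b (l : seq R) : itv_partition a b l ->
  forall i j : nat, (i <= j)%N -> (j <= size l)%N ->
  nth b (a :: l) i <= nth b (a :: l) j.
Proof.
move=> [/= pl lb] i j ij jl.
have := @sorted_leq_nth _ <=%R le_trans le_refl b (a :: l).
rewrite /=; apply; rewrite ?inE //=.
- by apply: sub_path pl => u v /ltW.
- by rewrite ltnS (leq_trans ij).
Qed.

(* Near-optimal partitions of all the intervals of a short family are glued
   into a single short family. *)
Lemma abs_continuous_sum_TV a b (f : R -> R) : abs_continuous a b f ->
  forall e : R, 0 < e -> exists2 d : R, 0 < d &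
    forall (I : finType) (s t : I -> R),
      (forall i, [/\ a <= s i, s i <= t i & t i <= b]) ->
      (forall i j, i != j -> s i < t i -> s j < t j ->
        t i <= s j \/ t j <= s i) ->
      \sum_i (t i - s i) < d -> (\sum_i TV (s i) (t i) f <= e%:E)%E.
Proof.
move=> acf e /(abs_continuous_fin acf) [d d0 H]; exists d => // I s t st dis sd.
have key (l : I -> seq R) : (forall i, itv_partition (s i) (t i) (l i)) ->
    \sum_i variation (s i) (t i) f (l i) < e.
  move=> pl; rewrite /variation.
  under eq_bigr do rewrite big_mkord.
  pose P i := nth (t i) (s i :: l i).
  rewrite (sig_big_dep xpredT (fun _ => xpredT)
     (fun i (j : 'I_(size (l i))) => `|f (P i j.+1) - f (P i j)|)) /=.
  pose J : finType := {i : I & 'I_(size (l i))}%type.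
  apply: (H J (fun p => P (tag p) (tagged p)) (fun p => P (tag p) (tagged p).+1)).
  - move=> [i j] /=; have [h1 h2 h3] := st i; split.
    + apply: (le_trans h1); apply: itv_partition_nth_ge (pl i).
      by rewrite ltnS ltnW.
    + by apply: itv_partition_nth.
    + by apply: le_trans h3; apply: itv_partition_nth_le (pl i); rewrite ltnS.
  - move=> [i j] [i' j'] /=; have [ii'|nii'] := eqVneq i i'.
      subst i' => jj'.
      have : (j : nat) != j' by apply: contra jj' => /eqP/val_inj ->.
      by rewrite neq_ltn => /orP[] h _ _; [left|right];
        apply: (itv_partition_nth (pl i) h); exact/ltnW/ltn_ord.
    move=> _ ltj ltj'.
    have lo k : s i <= P i k /\ P i k <= t i \/ (size (l i) < k)%N.
      have [h|] := leqP k (size (l i)); last by right.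
      left; split; first by apply: itv_partition_nth_ge (pl i); rewrite ltnS.
      by apply: itv_partition_nth_le (pl i); rewrite ltnS.
    have lo' k : s i' <= P i' k /\ P i' k <= t i' \/ (size (l i') < k)%N.
      have [h|] := leqP k (size (l i')); last by right.
      left; split; first by apply: itv_partition_nth_ge (pl i'); rewrite ltnS.
      by apply: itv_partition_nth_le (pl i'); rewrite ltnS.
    have jl := ltn_ord j; have jl' := ltn_ord j'.
    have [[? ?]|] := lo j; last by rewrite ltnNge ltnW.
    have [[? ?]|] := lo j.+1; last by rewrite ltnNge jl.
    have [[? ?]|] := lo' j'; last by rewrite ltnNge ltnW.
    have [[? ?]|] := lo' j'.+1; last by rewrite ltnNge jl'.
    have sti : s i < t i by lra.
    have sti' : s i' < t i' by lra.
    by have [h|h] := dis _ _ nii' sti sti'; [left|right]; lra.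
  - rewrite (le_lt_trans _ sd)//.
    rewrite -(sig_big_dep xpredT (fun _ => xpredT)
     (fun i (j : 'I_(size (l i))) => P i j.+1 - P i j)) /=.
    apply: ler_sum => i _.
    rewrite -(big_mkord xpredT (fun j => P i j.+1 - P i j)) telescope_sumr//.
    by rewrite /P (itv_partition_nth_size _ (pl i)).
(* To bound the variation on one interval, an arbitrary partition [l] is used at the index [i] and a
   trivial one elsewhere; the other terms are nonnegative. *)
have fin i : TV (s i) (t i) f \is a fin_num.
  have [h1 h2 h3] := st i.
  apply/bounded_variationP => //; exists e => _ [l pl <-].
  have [l0 pl0] : exists l0, forall i, itv_partition (s i) (t i) (l0 i).
    exists (fun j => if s j < t j then [:: t j] else [::]) => j.
    have [_ h _] := st j; case: ifPn => [|/negP h'].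
      exact: itv_partition1.
    have -> : s j = t j by apply/eqP; rewrite eq_le h leNgt; apply/negP.
    by split => /=.
  have /key : forall j, itv_partition (s j) (t j) (if j == i then l else l0 j).
    by move=> j; case: eqP => [->|_].
  rewrite (bigD1 i)//= eqxx => /ltW; apply: le_trans; rewrite lerDl sumr_ge0// => j _.
  by rewrite /variation sumr_ge0.
apply/lee_addgt0Pr => eta eta0.
pose eta' := eta / (#|I|%:R + 1).
have eta'0 : 0 < eta' by rewrite divr_gt0// ltr_wpDl.
have /choice [l pl] : forall i, exists l, itv_partition (s i) (t i) l /\
    (TV (s i) (t i) f <= (variation (s i) (t i) f l + eta')%:E)%E.
  move=> i; have [_ [_ [l pl <-] <-] /ltW h] := ub_ereal_sup_adherent eta'0 (fin i).
  exists l; split => //.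
  by move: h; rewrite leeBlDr//.
apply: (@le_trans _ _ (\sum_i (variation (s i) (t i) f (l i) + eta')%:E)%E).
  by apply: lee_sum => i _; exact: (pl i).2.
rewrite sumEFin lee_fin big_split/=; apply: lerD.
  by apply/ltW/key => i; exact: (pl i).1.
rewrite sumr_const cardT -cardE -mulr_natl /eta' mulrCA ger_pMr//.
by rewrite ler_pdivrMr ?mul1r ?lerDl// ltr_wpDl.
Qed.

(** An interval shorter than the [d] that belongs to the tolerance 1 has variation at most 1; longer
    ones are cut into steps of length [d / 2] by additivity. *)
Lemma abs_continuous_TV_fin a b (f : R -> R) : abs_continuous a b f ->
  forall s t, a <= s -> s <= t -> t <= b -> TV s t f \is a fin_num.
Proof.
move=> /abs_continuous_sum_TV - /(_ 1 ltr01) [d d0 H].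
have small s t : a <= s -> s <= t -> t <= b -> t - s < d -> TV s t f \is a fin_num.
  move=> sa st tb ts.
  have := H 'I_1 (fun=> s) (fun=> t).
  rewrite !big_ord1 => h.
  have {}h : (TV s t f <= 1%:E)%E.
    by apply: h => // i j; rewrite !ord1 eqxx.
  rewrite ge0_fin_numE; last exact: total_variation_ge0.
  exact: le_lt_trans h (ltry _).
have main m s t : a <= s -> s <= t -> t <= b -> t - s < m%:R * (d / 2) ->
    TV s t f \is a fin_num.
  elim: m s t => [|m IH] s t sa st tb h.
    by move: h; rewrite mul0r; lra.
  have [h'|h'] := ltP (t - s) d; first exact: small.
  rewrite (@total_variationD _ s t (s + d / 2)); [|lra|lra].
  rewrite fin_numD (small s)//; [|lra|lra|lra].
  apply: IH; [lra|lra|lra|].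
  by move: h; rewrite -natr1 mulrDl mul1r; lra.
move=> s t sa st tb.
apply: (main (Num.truncn ((t - s) / (d / 2))).+1) => //.
have d2 : 0 < d / 2 by lra.
by rewrite -ltr_pdivrMr// truncnS_gt.
Qed.

End AbsoluteContinuity.


(** * Densities of nondecreasing functions by the Radon-Nikodym theorem *)

Section NondecreasingDensity.
Variable R : realType.
Local Notation mu := (@lebesgue_measure R).
Variables (a b : R) (F : R -> R).
Hypotheses (ab : a < b) (ndF : {in `[a, b] &, nondecreasing_fun F}).
Hypothesis acF : abs_continuous a b F.

(** Extending [F] by constants beyond [a, b] gives a cumulative function on the whole line, which
    has a Lebesgue-Stieltjes measure. *)
Let clamp (x : R) := if x <= a then a else if b <= x then b else x.

Let clampP x : a <= clamp x <= b.
Proof.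
by move: ab; rewrite /clamp; case: (leP x a) => ?; case: (leP b x) => ? ?; lra.
Qed.

Let clamp_id x : a <= x <= b -> clamp x = x.
Proof.
by move: ab; rewrite /clamp; case: (leP x a) => ?; case: (leP b x) => ? ?; lra.
Qed.

Let clamp_nd x y : x <= y -> clamp x <= clamp y.
Proof.
move: ab; rewrite /clamp; case: (leP x a) => ?; case: (leP b x) => ?;
by case: (leP y a) => ?; case: (leP b y) => ? ?; lra.
Qed.

Let clamp_lip x y : x <= y -> clamp y - clamp x <= y - x.
Proof.
move: ab; rewrite /clamp; case: (leP x a) => ?; case: (leP b x) => ?;
by case: (leP y a) => ?; case: (leP b y) => ? ?; lra.
Qed.

Let clamp_sub x y z : clamp x < z -> z < clamp y -> x < z /\ z < y.
Proof.
move: ab; rewrite /clamp; case: (leP x a) => ?; case: (leP b x) => ?;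
by case: (leP y a) => ?; case: (leP b y) => ? ? ?; split; lra.
Qed.

Let Fc x := F (clamp x).

Let Fc_nd : nondecreasing Fc.
Proof.
move=> x y xy; apply: ndF; rewrite ?in_itv /= ?clampP//.
exact: clamp_nd.
Qed.

Let Fc_cont : right_continuous Fc.
Proof.
apply: right_continuousW => x; apply/cvgrPdist_lt => e /acF [d d0 H].
near=> y.
suff main u v : u <= v -> v - u < d -> `|Fc v - Fc u| < e.
  have xyd : `|x - y| < d by near: y; exact: (nbhsx_ballx x d d0).
  have [xy|/ltW xy] := leP x y.
    by rewrite distrC main// (le_lt_trans _ xyd)// distrC ler_norm.
  by rewrite main// (le_lt_trans _ xyd)// ler_norm.
move=> uv dd; have := H 1%N (fun=> clamp u) (fun=> clamp v).
rewrite !big_ord1; apply.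
- move=> _; have /andP[? ?] := clampP u; have /andP[? ?] := clampP v.
  by split => //; exact: clamp_nd.
- by move=> i j _ _ _; rewrite !ord1.
- by rewrite (le_lt_trans _ dd)// clamp_lip.
Unshelve. all: by end_near. Qed.

Let cF : cumulative R R := HB.pack Fc (isCumulative.Build _ _ _ _ Fc_nd Fc_cont).
Let nu0 : {measure set (measurableTypeR R) -> \bar R} :=
  lebesgue_stieltjes_measure cF.

Let nu0_itv s t : s <= t -> nu0 (`]s, t]%classic) = (Fc t - Fc s)%:E.
Proof.
move=> st; change (lebesgue_stieltjes_measure cF (`]s, t]%classic) = (Fc t - Fc s)%:E).
rewrite /lebesgue_stieltjes_measure /measure_extension.
by rewrite measurable_mu_extE/= ?wlength_itv_bnd//; exact: is_ocitv.
Qed.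

(** A component of an open set may stick out of [a, b]. Clamping its endpoints shortens it without
    losing Stieltjes mass, and the result is an interval to which [acF] applies. Finite length rules
    out the unbounded cases. *)
Let open_itv_nu (I : set R) : open I -> is_interval I -> (mu I < +oo)%E ->
  exists st : R * R, [/\ a <= st.1, st.1 <= st.2, st.2 <= b,
    `]st.1, st.2[ `<=` I & ((st.2 - st.1)%:E <= mu I)%E /\
     (nu0 I <= (F st.2 - F st.1)%:E)%E].
Proof.
move=> oI iI muI; have [->|/set0P [z Iz]] := eqVneq I set0.
  exists (a, a); split => //=; first exact: ltW.
  - by move=> x /=; rewrite in_itv/= => /andP[h1 h2]; have := lt_trans h1 h2; rewrite ltxx.
  - split; first by rewrite subrr measure0.
    by rewrite subrr measure0.
move/is_intervalP: iI => iE; move/interior_id: oI => oE.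
move: iE muI oE Iz; case: (Rhull I) => [] [b1 s0|b1] [b2 t0|b2] -> muI oE Iz.
- rewrite interior_itv_bnd in oE; rewrite -oE /= in_itv/= in Iz *.
  move/andP: Iz => [sz zt]; have st : s0 < t0 by lra.
  exists (clamp s0, clamp t0) => /=.
  have /andP[? ?] := clampP s0; have /andP[? ?] := clampP t0.
  split => //; first exact/clamp_nd/ltW.
  - by move=> x /=; rewrite !in_itv/= => /andP[h1 h2]; have [-> ->] := clamp_sub h1 h2.
  split.
    by rewrite lebesgue_measure_itv/= lte_fin st -EFinB lee_fin; exact/clamp_lip/ltW.
  rewrite -/(Fc _) -/(Fc _) -nu0_itv ?(ltW st)//; rewrite -/nu0.
  apply: le_measure; rewrite ?inE; [exact: measurable_itv|exact: measurable_itv|].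
  by apply: subset_itvl; rewrite bnd_simp.
- by move: muI Iz; rewrite lebesgue_measure_itv/=; case: b2 {oE} => //=; rewrite ?ltNyr ?ltry // in_itv /= andbF.
- by move: muI Iz; rewrite lebesgue_measure_itv/=; case: b1 {oE} => //=; rewrite ?ltNyr ?ltry // in_itv /=.
- by move: muI Iz; rewrite lebesgue_measure_itv/=; case: b1 {oE}; case: b2 => //=; rewrite in_itv.
Qed.

(** The components of U are disjoint intervals, so any finitely many of them form an admissible
    family for [acF]; countable additivity gives the bound for U. *)
Let nu0_small (e : R) : 0 < e -> exists2 d : R, 0 < d &
  forall U, open U -> (mu U < d%:E)%E -> (nu0 U <= e%:E)%E.
Proof.
move=> /acF [d d0 H]; exists d => // U oU Ud.
set I := open_disjoint_itv oU.
have mI q : measurable (I q).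
  by apply: open_measurable; exact: open_disjoint_itv_open.
have tI : trivIset setT I by exact: open_disjoint_itv_trivIset.
have UI : U = \bigcup_q I q by exact: open_disjoint_itv_bigcup.
have IU q : (mu (I q) <= mu U)%E.
  apply: le_measure; rewrite ?inE; [exact: mI|exact: open_measurable|].
  by rewrite UI; exact: bigcup_sup.
have /choice [st P] : forall q, exists st : R * R,
    [/\ a <= st.1, st.1 <= st.2, st.2 <= b,
    `]st.1, st.2[ `<=` I q & ((st.2 - st.1)%:E <= mu (I q))%E /\
     (nu0 (I q) <= (F st.2 - F st.1)%:E)%E].
  move=> q; apply: open_itv_nu; first exact: open_disjoint_itv_open.
    exact: open_disjoint_itv_is_interval.
  by rewrite (le_lt_trans (IU q))// (lt_trans Ud) ?ltry.
have mUI : measurable (\bigcup_q I q) by apply: bigcup_measurable.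
have cv : (fun n => \sum_(0 <= i < n) nu0 (I i))%E @ \oo --> nu0 U.
  by rewrite UI; apply: measure_semi_sigma_additive.
rewrite -(cvg_lim _ cv)//; apply: lime_le; first by apply/cvg_ex; exists (nu0 U).
near=> k.
apply: (@le_trans _ _ (\sum_(i < k) (`|F (st i).2 - F (st i).1|)%:E)%E).
  rewrite big_mkord; apply: lee_sum => i _.
  have [_ _ _ _ [_ /le_trans]] := P i; apply; rewrite lee_fin; exact: ler_norm.
rewrite sumEFin lee_fin; apply/ltW/(H k (fun i => (st i).1) (fun i => (st i).2)).
- by move=> i; have [] := P i.
- move=> i j _ _ [x [xi xj]]; apply: val_inj; apply: tI => //.
  have [_ _ _ si _] := P i; have [_ _ _ sj _] := P j.
  by exists x; split; [exact: si|exact: sj].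
- rewrite -lte_fin -sumEFin; apply: le_lt_trans Ud.
  apply: (@le_trans _ _ (\sum_(i < k) mu (I i))%E).
    by apply: lee_sum => i _; have [_ _ _ _ []] := P i.
  have <- : mu (\big[setU/set0]_(i < k) I i) = (\sum_(i < k) mu (I i))%E.
    by rewrite measure_bigsetU.
  apply: le_measure; rewrite ?inE.
  - by apply: bigsetU_measurable => q _; exact: mI.
  - exact: open_measurable.
  by rewrite UI; exact: bigsetU_bigcup.
Unshelve. all: by end_near. Qed.

(** A Lebesgue null set lies in open sets of arbitrarily small length, hence of small [nu0]-mass. So
    the Stieltjes measure restricted to ]a, b] is dominated by [mu], and g is its Radon-Nikodym
    density. *)
Lemma nondecreasing_density : exists g : R -> R,
  mu.-integrable setT (EFin \o g) /\
  forall t, a <= t <= b -> F t - F a = \int[mu]_(x in `[a, t]) g x.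
Proof.
have mab : measurable (`]a, b]%classic : set (measurableTypeR R)) by exact: measurable_itv.
have fab : (nu0 (`]a, b]%classic) < +oo)%E by rewrite nu0_itv ?ltry// ltW.
pose nu : {finite_measure set (measurableTypeR R) -> \bar R} := mfrestr mab fab.
have numu : nu `<< mu.
  apply/null_content_dominatesP => A mA muA.
  apply/eqP; rewrite eq_le measure_ge0 andbT.
  apply/lee_addgt0Pr => e e0; rewrite add0e.
  have [d d0 H] := nu0_small e0.
  have [|U [oU AU UA]] := lebesgue_regularity_outer mA _ d0.
    by rewrite [X in (X < _)%E]muA ltry.
  have mU := open_measurable oU.
  apply: (@le_trans _ _ (nu0 U)).
    rewrite /nu/= /mfrestr /mrestr; apply: le_measure; rewrite ?inE.
    - exact: measurableI.
    - exact: mU.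
    - by move=> x [/AU].
  apply: H => //; rewrite -(setDUK AU) measureU ?setDIK//; last exact: measurableD.
  by rewrite [X in (X + _)%E]muA add0e.
have [h [h0 hf hi hE]] := radon_nikodym_sigma_finite numu.
exists (fine \o h).
have -> : EFin \o (fine \o h) = h by apply/funext => x /=; rewrite fineK.
split => // t /andP[at_ tb].
have : nu (`]a, t]%classic) = (F t - F a)%:E.
  rewrite /nu/= /mfrestr /mrestr setIidl ?nu0_itv//.
    by rewrite /Fc !clamp_id ?lexx ?at_ ?(ltW ab).
  by apply: subset_itvl; rewrite bnd_simp.
rewrite hE; last exact: measurable_itv.
rewrite /Rintegral integral_itv_obnd_cbnd; last first.
  by apply: measurable_funS (measurable_int _ hi) => //; exact: measurableT.
by under eq_integral do rewrite /= fineK//; move=> ->.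
Qed.

End NondecreasingDensity.


(** * The fundamental theorem of calculus for absolutely continuous functions *)

Section AbsoluteContinuityFTC.
Variable R : realType.
Local Notation mu := (@lebesgue_measure R).
Implicit Types (a b s t : R) (f g h : R -> R).

(** Jordan decomposition: with V the variation from a, the inequality [|f t - f s| <= V t - V s]
    makes V and V - f nondecreasing. Both are absolutely continuous, and their densities are
    subtracted. *)
Lemma abs_continuous_density a b f : a < b -> abs_continuous a b f ->
  exists g, mu.-integrable setT (EFin \o g) /\
    forall t, a <= t <= b -> f t - f a = \int[mu]_(x in `[a, t]) g x.
Proof.
move=> ab acf.
have TVfin := abs_continuous_TV_fin acf.
pose V t := fine (total_variation a t f).
have VD s t : a <= s -> s <= t -> t <= b ->
    V t - V s = fine (total_variation s t f).
  move=> sa st tb; rewrite /V (@total_variationD _ a t s)// fineD ?TVfin//; [|lra].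
  by rewrite addrC addKr.
have VE s t : a <= s -> s <= t -> t <= b -> `|f t - f s| <= V t - V s.
  move=> sa st tb; rewrite VD// -lee_fin fineK ?TVfin//.
  exact: total_variation_ge.
have acV : abs_continuous a b V.
  move=> e e0; have e20 : 0 < e / 2 by lra.
  have [d d0 H] := abs_continuous_sum_TV acf e20.
  exists d => // k s t st dis sd.
  have ord i j : i != j -> s i < t i -> s j < t j -> t i <= s j \/ t j <= s i.
    move=> ij si' sj'; have [h1|h1] := leP (t i) (s j); first by left.
    have [h2|h2] := leP (t j) (s i); first by right.
    exfalso; move/eqP: ij; apply; apply: dis => //.
    (* Two overlapping open intervals share the midpoint of their intersection ]m, M[, against
       disjointness. *)
    pose m := Num.max (s i) (s j); pose M := Num.min (t i) (t j).
    have mM : m < M by rewrite /m /M gt_max !lt_min si' sj' h1 h2.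
    have [m1 m2] : s i <= m /\ s j <= m by rewrite /m !le_max !lexx orbT.
    have [M1 M2] : M <= t i /\ M <= t j by rewrite /M !ge_min !lexx orbT.
    by exists ((m + M) / 2); split; rewrite /= in_itv/=; apply/andP; split; lra.
  have := H 'I_k s t st ord sd.
  have -> : (\sum_(i < k) total_variation (s i) (t i) f)%R =
            (\sum_(i < k) (V (t i) - V (s i))%:E)%E.
    apply: eq_bigr => i _; have [? ? ?] := st i.
    by rewrite VD// fineK// TVfin.
  rewrite sumEFin lee_fin => h; rewrite (@le_lt_trans _ _ (e / 2))//; last lra.
  apply: le_trans h; apply: ler_sum => i _; have [? ? ?] := st i.
  by rewrite ger0_norm// (le_trans _ (VE _ _ _ _ _)).
have acW : abs_continuous a b (fun t => V t - f t).
  move=> e e0; have e20 : 0 < e / 2 by lra.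
  have [d1 d10 H1] := acV _ e20; have [d2 d20 H2] := acf _ e20.
  exists (Num.min d1 d2); first by rewrite lt_min d10.
  move=> k s t st dis; rewrite lt_min => /andP[s1 s2].
  have h1 := H1 k s t st dis s1; have h2 := H2 k s t st dis s2.
  apply: (@le_lt_trans _ _ (\sum_(i < k) `|V (t i) - V (s i)| +
      \sum_(i < k) `|f (t i) - f (s i)|)); last lra.
  rewrite -big_split/=; apply: ler_sum => i _.
  rewrite (_ : _ - _ - _ = (V (t i) - V (s i)) - (f (t i) - f (s i))); last ring.
  exact: ler_normB.
have [|g1 [ig1 E1]] := nondecreasing_density ab _ acV.
  move=> s t; rewrite !in_itv/= => /andP[as_ sb] /andP[at_ tb] st.
  by rewrite -subr_ge0 (le_trans _ (VE _ _ _ _ _)).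
have [|g2 [ig2 E2]] := nondecreasing_density ab _ acW.
  move=> s t; rewrite !in_itv/= => /andP[as_ sb] /andP[at_ tb] st.
  have := VE _ _ as_ st tb; have := ler_norm (f t - f s); lra.
exists (fun x => g1 x - g2 x); split.
  rewrite (_ : EFin \o _ = (EFin \o g1) \- (EFin \o g2))%E//.
  exact: integrableB.
move=> t tab; rewrite RintegralB//; last 2 first.
- exact: integrableS ig1.
- exact: integrableS ig2.
by rewrite -E1// -E2//; ring.
Qed.

(** Near an interior point f differs by a constant from the indefinite integral of its density, so
    Lebesgue differentiation of that integral applies. *)
Lemma abs_continuous_ftc a b f : a < b -> abs_continuous a b f ->
  exists g, [/\ mu.-integrable setT (EFin \o g),
    f b - f a = \int[mu]_(x in `[a, b]) g x &
    {ae mu, forall t, a < t < b -> derivable f t 1 /\ derive1 f t = g t}].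
Proof.
move=> ab /(abs_continuous_density ab) [g [ig E]].
exists g; split => //; first by apply: E; rewrite lexx ltW.
have ig' y : mu.-integrable `[a, y] (EFin \o g) by exact: integrableS ig.
have lg : locally_integrable [set: R] g.
  by have := integrable_locally measurableT ig; rewrite patch_setT.
have := FTC1 (a := BLeft a) ig' lg.
apply: filterS; first exact: (ae_filter_ringOfSetsType mu).
move=> t /= + /andP[at_ tb].
case; first by rewrite lte_fin.
move=> dF F'.
pose Ig x := \int[mu]_(y in `[a, x]) g y.
have fF : \forall x \near t, (Ig \+ cst (f a)) x = f x.
  near=> x; rewrite /= /Ig -E ?subrK//; apply/andP; split.
    by apply/ltW; near: x; exact: lt_nbhsr.
  by apply/ltW; near: x; exact: lt_nbhsl.
have dc : derivable (cst (f a) : R -> R) t 1 by exact: derivable_cst.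
have dF' : derivable (Ig \+ cst (f a)) t 1 by exact: (derivableD dF dc).
split; first exact: near_eq_derivable fF dF'.
rewrite derive1E -(near_eq_derive _ fF) ?oner_eq0//.
by rewrite (deriveD dF dc) derive_cst addr0 -derive1E.
Unshelve. all: by end_near. Qed.

Lemma abs_continuous_derivable a b f : a < b -> abs_continuous a b f ->
  {ae mu, forall t, a < t < b -> derivable f t 1}.
Proof.
move=> ab /(abs_continuous_ftc ab) [g [_ _]].
apply: filterS; first exact: (ae_filter_ringOfSetsType mu).
by move=> t /= + tab => /(_ tab) [].
Qed.

Lemma abs_continuous_le_integral a b f h : a <= b -> abs_continuous a b f ->
  mu.-integrable `[a, b] (EFin \o h) ->
  {ae mu, forall t, a < t < b -> derivable f t 1 -> derive1 f t <= h t} ->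
  f b - f a <= \int[mu]_(x in `[a, b]) h x.
Proof.
rewrite le_eqVlt => /predU1P[<- _ _ _|ab].
  by rewrite subrr set_itv1 Rintegral_set1.
move=> /(abs_continuous_ftc ab) [g [ig -> Hg]] ih Hh.
have ig' : mu.-integrable `[a, b] (EFin \o g) by exact: integrableS ig.
rewrite -subr_ge0 -RintegralB//.
have i0 : mu.-integrable `]a, b[ (EFin \o (fun x => h x - g x)).
  apply: (@integrableS _ _ _ mu `[a, b]) => //.
    by apply: subset_itv; rewrite bnd_simp.
  rewrite (_ : EFin \o _ = (EFin \o h) \- (EFin \o g))%E//.
  exact: integrableB.
rewrite -Rintegral_itv_obnd_cbnd; last first.
  apply: (@integrableS _ _ _ mu `[a, b]) => //.
    by apply: subset_itv; rewrite bnd_simp.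
  rewrite (_ : EFin \o _ = (EFin \o h) \- (EFin \o g))%E//.
  exact: integrableB.
rewrite -Rintegral_itv_bndo_bndc// /Rintegral.
(* The integrand h - g is nonnegative only almost everywhere; it is exchanged for its positive
   part. *)
rewrite (@ae_eq_integral _ _ _ mu `]a, b[ (fun x => (Num.max (h x - g x) 0)%:E))//.
- apply: fine_ge0; apply: integral_ge0 => x _.
  by rewrite lee_fin le_max lexx orbT.
- exact: measurable_int i0.
- apply/measurable_EFinP; apply: measurable_maxr => //.
  by apply/measurable_EFinP; exact: measurable_int i0.
- move: Hg; apply: filterS2 Hh; first exact: (ae_filter_ringOfSetsType mu).
  move=> t /= H1 H2; rewrite in_itv/= => tab.
  have [dt gt] := H2 tab; have := H1 tab dt; rewrite gt -subr_ge0 => ge0.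
  by rewrite max_l.
Qed.

End AbsoluteContinuityFTC.

(** * Finsler norms and norming functionals *)

Section RowVectorNorm.
Variables (R : realType) (n : nat).
Local Notation V := 'rV[R]_n.

Lemma coord_le_norm (x : V) i : `|x 0 i| <= `|x|.
Proof.
rewrite [leRHS](_ : _ = mx_norm x)// mx_normrE.
exact: (le_bigmax _ (fun ij : 'I_1 * 'I_n => `|x ij.1 ij.2|) (0, i)).
Qed.

Lemma row_norm_le (x : V) (c : R) : 0 <= c -> (forall i, `|x 0 i| <= c) -> `|x| <= c.
Proof.
move=> c0 H; rewrite [leLHS](_ : _ = mx_norm x)// mx_normrE.
by apply: bigmax_le => // -[i j] _ /=; rewrite ord1.
Qed.

End RowVectorNorm.

(** * Sublinear functions and the Hahn-Banach theorem *)

Section Sublinear.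
Variables (R : realType) (V : lmodType R).
Implicit Types (p q : V -> R) (x y u w : V).

Definition sublinear p : Prop :=
  (forall x y, p (x + y) <= p x + p y) /\
  (forall (a : R) x, 0 <= a -> p (a *: x) = a * p x).

Lemma sublinear0 p : sublinear p -> p 0 = 0.
Proof. by move=> [_ pZ]; rewrite -(scale0r (0 : V)) pZ// mul0r. Qed.

Lemma sublinear_opp p x : sublinear p -> 0 <= p x + p (- x).
Proof. by move=> sp; have := sp.1 x (- x); rewrite subrr sublinear0. Qed.

(* The largest sublinear minorant of [p] with [q (- u) = - p u]. *)
Definition straighten p u x : R :=
  inf [set p (x + t *: u) - t * p u | t in [set t : R | 0 <= t]].

(** Subadditivity bounds the infimum below by [- p (- x)]. Sublinearity survives the infimum by
    adding or rescaling the parameters t, and the last inequality is the competitor t = 1. *)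
Lemma straightenP p u : sublinear p -> [/\ sublinear (straighten p u),
  (forall x, straighten p u x <= p x) & straighten p u (- u) <= - p u].
Proof.
move=> sp; have [pD pZ] := sp.
pose S x := [set p (x + t *: u) - t * p u | t in [set t : R | 0 <= t]].
have S0 x : S x !=set0 by exists (p (x + 0 *: u) - 0 * p u); exists 0 => /=.
have Sb x : has_lbound (S x).
  exists (- p (- x)) => _ [t /= t0 <-].
  by have := pD (x + t *: u) (- x); rewrite addrAC subrr add0r pZ//; lra.
have le x t : 0 <= t -> straighten p u x <= p (x + t *: u) - t * p u.
  by move=> t0; apply: (ge_inf (Sb x)); exists t.
have ge x c : (forall t, 0 <= t -> c <= p (x + t *: u) - t * p u) ->
    c <= straighten p u x.
  by move=> H; apply: (lb_le_inf (S0 x)) => _ [t /= /H ? <-].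
split.
- split=> [x y|a x].
    suff H s t : 0 <= s -> 0 <= t -> straighten p u (x + y) <=
        (p (x + s *: u) - s * p u) + (p (y + t *: u) - t * p u).
      have H' s : 0 <= s ->
          straighten p u (x + y) - (p (x + s *: u) - s * p u) <= straighten p u y.
        by move=> s0; apply: ge => t t0; have := H _ _ s0 t0; lra.
      suff : straighten p u (x + y) - straighten p u y <= straighten p u x by lra.
      by apply: ge => s s0; have := H' _ s0; lra.
    move=> s0 t0; apply: (le_trans (le _ (s + t) _)); first exact: addr_ge0.
    rewrite scalerDl addrACA; have := pD (x + s *: u) (y + t *: u); lra.
  rewrite le_eqVlt => /predU1P[<-|a0].
    rewrite scale0r mul0r; apply/eqP; rewrite eq_le; apply/andP; split.
      by have := le 0 0 (lexx _); rewrite scale0r addr0 mul0r subr0 (sublinear0 sp).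
    by apply: ge => t t0; rewrite add0r pZ// subrr.
  apply/eqP; rewrite eq_le; apply/andP; split.
    rewrite mulrC -ler_pdivrMr// ; apply: ge => t t0.
    rewrite ler_pdivrMr// mulrBl.
    have := le (a *: x) (a * t) (mulr_ge0 (ltW a0) t0).
    rewrite -(scalerA a t u) -scalerDr pZ; last exact: ltW.
    by rewrite [p (_ + _) * a]mulrC [t * p u * a]mulrC mulrA.
  apply: ge => t t0; rewrite -ler_pdivlMl//.
  have ai0 : 0 <= a^-1 by rewrite invr_ge0 ltW.
  apply: le_trans (le x _ (mulr_ge0 ai0 t0)) _.
  rewrite (_ : x + _ *: u = a^-1 *: (a *: x + t *: u)); last first.
    by rewrite scalerDr !scalerA mulVf ?scale1r ?gt_eqF.
  by rewrite pZ// mulrBr mulrA.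
- by move=> x; have := le x 0 (lexx _); rewrite scale0r addr0 mul0r subr0.
- by have := le (- u) 1 ler01; rewrite scale1r addNr mul1r (sublinear0 sp) sub0r.
Qed.

(** A direction w once straightened stays so for every smaller sublinear r: from r w <= q w, r (- w)
    <= - q w and 0 <= r w + r (- w) all are equalities. Hence the directions can be treated one at a
    time. *)
Lemma sublinear_straight p (s : seq V) : sublinear p -> exists q,
  [/\ sublinear q, (forall x, q x <= p x) &
      forall u, u \in s -> q (- u) = - q u].
Proof.
move=> sp; elim: s => [|u s [q [sq qp qs]]]; first by exists p.
have [sr rq ru] := straightenP u sq.
exists (straighten q u); split => // [x|w]; first exact: le_trans (rq _) (qp _).
rewrite inE => /predU1P[->|ws].
  have := rq u; have := sublinear_opp u sr; lra.
have := qs _ ws; have := rq w; have := rq (- w); have := sublinear_opp w sr; lra.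
Qed.

(** Straightening along u first pins the value at u: a sublinear q <= p with q (- u) <= - p u has q
    u >= p u. *)
Lemma sublinear_straight_at p (s : seq V) u : sublinear p -> exists q,
  [/\ sublinear q, (forall x, q x <= p x), q u = p u &
      forall w, w \in s -> q (- w) = - q w].
Proof.
move=> sp; have [sr rp ru] := straightenP u sp.
have [q [sq qr qs]] := sublinear_straight s sr.
exists q; split => // [x|]; first exact: le_trans (qr _) (rp _).
have := rp u; have := qr u; have := qr (- u); have := sublinear_opp u sq; lra.
Qed.

End Sublinear.

Section HahnBanach.
Variables (R : realType) (n : nat).
Local Notation V := 'rV[R]_n.

Definition coord_form (c : 'I_n -> R) (x : V) : R := \sum_i x 0 i * c i.

Lemma coord_form_is_linear c : linear (coord_form c).
Proof.
move=> a x y; rewrite /coord_form scaler_sumr -big_split/=.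
by apply: eq_bigr => i _; rewrite !mxE mulrDl -mulrA.
Qed.

HB.instance Definition _ c :=
  GRing.isLinear.Build R V R *%R (coord_form c) (coord_form_is_linear c).

(** Finite dimension makes finitely many straightenings enough. If q is odd on the basis vectors,
    subadditivity puts it below the linear form phi with the same values there, and q (- x) <= phi
    (- x) gives phi <= q. *)
Lemma hahn_banach (p : V -> R) u : sublinear p ->
  exists phi : {scalar V}, (forall x, phi x <= p x) /\ phi u = p u.
Proof.
move=> sp.
have [q [sq qp qu qs]] :=
  sublinear_straight_at [seq delta_mx (0 : 'I_1) i | i <- enum 'I_n] u sp.
have qe i : q (- delta_mx 0 i) = - q (delta_mx 0 i).
  by apply/qs/mapP; exists i; rewrite ?mem_enum.
pose phi : {scalar V} := coord_form (fun i => q (delta_mx 0 i)).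
have qphi x : q x <= phi x.
  rewrite {1}(row_sum_delta x) /phi /= /coord_form.
  elim/big_ind2: _ => [|a b c d ab cd|i _]; first by rewrite (sublinear0 sq).
    exact: le_trans (sq.1 _ _) (lerD ab cd).
  have [x0|/ltW x0] := leP 0 (x 0 i); first by rewrite sq.2.
  rewrite -[x 0 i *: _]opprK -scaleNr -scalerN sq.2 ?oppr_ge0//.
  by rewrite qe mulrNN.
have phiq x : phi x <= q x.
  have := qphi (- x); rewrite linearN; have := sublinear_opp x sq; lra.
exists phi; split => [x|]; first exact: le_trans (phiq _) (qp _).
by apply/eqP; rewrite -qu eq_le phiq qphi.
Qed.

End HahnBanach.


Lemma nearN (R : realType) (W : normedModType R) (x : W) (P : set W) :
  (\forall y \near x, P y) <-> exists2 e : R, 0 < e & forall y, `|y - x| < e -> P y.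
Proof.
split=> [/nbhs_ballP [e /= e0 H]|[e e0 H]].
  by exists e => // y yx; apply: H; rewrite -ball_normE/= distrC.
apply/nbhs_ballP; exists e => // y; rewrite -ball_normE/= distrC; exact: H.
Qed.

Lemma continuousN (R : realType) (W W' : normedModType R) (f : W -> W') (x : W) :
  {for x, continuous f} <-> forall e : R, 0 < e ->
    exists2 d : R, 0 < d & forall y, `|y - x| < d -> `|f y - f x| < e.
Proof.
split=> [/cvgrPdist_lt H e /H /nearN [d d0 Hd]|H].
  by exists d => // y /Hd; rewrite distrC.
apply/cvgrPdist_lt => e /H [d d0 Hd]; apply/nearN; exists d => // y /Hd.
by rewrite distrC.
Qed.

Ltac rowlin := apply/rowP => ?; rewrite !mxE; lra.
Ltac rowring := apply/rowP => ?; rewrite !mxE; ring.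

(** * Finsler norms in finite dimension and their one-sided derivatives *)

Section FinslerNorms.
Variables (R : realType) (n : nat) (N : 'rV[R]_n -> R).
Local Notation V := 'rV[R]_n.
Implicit Types (u v w x y z : V).
Hypothesis finsler_N : finsler_norm N.

Lemma finsler_ge0 x : 0 <= N x. Proof. by case: finsler_N. Qed.

Lemma finslerD x y : N (x + y) <= N x + N y. Proof. by case: finsler_N. Qed.

Lemma finslerZ (a : R) x : 0 <= a -> N (a *: x) = a * N x.
Proof. by case: finsler_N => _ _ H _; exact: H. Qed.

Lemma finsler0 : N 0 = 0. Proof. by case: finsler_N => _ _ _ H; apply/H. Qed.

Lemma finsler_eq0 x : N x = 0 -> x = 0.
Proof. by case: finsler_N => _ _ _ H /H. Qed.

Lemma finsler_gt0 x : x != 0 -> 0 < N x.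
Proof. by move=> x0; rewrite lt_def finsler_ge0 andbT; apply: contra_neq x0 => /finsler_eq0. Qed.

Lemma finsler_upper : exists2 c : R, 0 < c & forall x, N x <= c * `|x|.
Proof.
(* Both signs of each basis vector enter because N need not be symmetric. *)
pose c := \sum_(i < n) (N (delta_mx 0 i) + N (- delta_mx 0 i)).
have c0 : 0 <= c by apply: sumr_ge0 => i _; rewrite addr_ge0 ?finsler_ge0.
exists (c + 1) => [|x]; first lra.
apply: (@le_trans _ _ (c * `|x|)); last by rewrite ler_wpM2r// lerDl.
rewrite {1}(row_sum_delta x) /c mulr_suml.
elim/big_ind2: _ => [|a b a' b' ab ab'|i _]; first by rewrite finsler0.
  exact: le_trans (finslerD _ _) (lerD ab ab').
have h := coord_le_norm x i.
have n1 := finsler_ge0 (delta_mx 0 i); have n2 := finsler_ge0 (- delta_mx 0 i).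
have [x0|/ltW x0] := leP 0 (x 0 i).
  rewrite finslerZ// mulrC; rewrite ger0_norm// in h.
  by apply: ler_pM => //; rewrite lerDl.
rewrite -[x 0 i *: _]opprK -scaleNr -scalerN finslerZ ?oppr_ge0// mulrC.
rewrite ler0_norm// in h.
by apply: ler_pM => //; rewrite ?oppr_ge0// lerDr.
Qed.

Lemma finsler_lipschitz : exists2 c : R, 0 < c & forall x y, `|N x - N y| <= c * `|x - y|.
Proof.
have [c c0 Nc] := finsler_upper; exists c => // x y.
have h1 := finslerD y (x - y); have h2 := finslerD x (y - x).
have h3 := Nc (x - y); have h4 := Nc (y - x).
rewrite distrC in h4; rewrite !subrKC in h1 h2.
by rewrite ler_norml; apply/andP; split; lra.
Qed.

Lemma finsler_continuous : continuous N.
Proof.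
have [c c0 Nc] := finsler_upper.
move=> x; apply/continuousN => e e0.
exists (e / c) => [|y]; first by rewrite divr_gt0.
rewrite ltr_pdivlMr// mulrC => xy.
have h1 := finslerD (x - y) y; have h2 := finslerD (y - x) x.
have := Nc (x - y); have := Nc (y - x); rewrite (distrC x) => h3 h4.
rewrite !subrK in h1 h2.
by rewrite (le_lt_trans _ xy)// ler_norml; apply/andP; split; lra.
Qed.

(** N has a positive minimum on the compact unit sphere. The zero space is set apart because its
    unit sphere is empty. *)
Lemma finsler_lower : exists2 c : R, 0 < c & forall x, `|x| <= c * N x.
Proof.
have [H|[x0 x00]] : (forall x : V, x = 0) \/ exists x : V, x != 0.
- have [H|/existsNP [x /eqP x0]] := pselect (forall x : V, x = 0); first by left.
  by right; exists x.
- by exists 1 => // x; rewrite (H x) normr0 finsler0 mulr0.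
pose S := [set x : V | `|x| = 1].
have cS : compact S.
  apply: bounded_closed_compact.
    exists 1; split; first exact: num_real.
    by move=> M M1 x; rewrite /S/= => ->; exact: ltW.
  rewrite (_ : S = (fun x : V => `|x|) @^-1` [set 1])//.
  apply: closed_comp; last exact: closed_eq.
  by move=> x _; exact: norm_continuous.
have [||z] := compact_EVT_min (f := N) _ cS.
- exists (`|x0|^-1 *: x0); rewrite /S/= normrZ ger0_norm ?invr_ge0//.
  by rewrite mulVf// normr_eq0.
- by apply: continuous_subspaceT; exact: finsler_continuous.
rewrite inE /S/= => z1 zmin.
have z0 : z != 0 by rewrite -normr_eq0 z1 oner_eq0.
exists (N z)^-1 => [|x]; first by rewrite invr_gt0 finsler_gt0.
have [->|xn0] := eqVneq x 0; first by rewrite normr0 finsler0 mulr0.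
rewrite -ler_pdivrMl ?invr_gt0 ?finsler_gt0// invrK.
rewrite -ler_pdivlMr ?normr_gt0// mulrC -finslerZ ?invr_ge0//.
apply: zmin; rewrite inE /S/= normrZ ger0_norm ?invr_ge0//.
by rewrite mulVf// normr_eq0.
Qed.

Definition dir_quot v w (t : R) := t^-1 * (N (v + t *: w) - N v).
(** The one-sided directional derivative. By convexity the quotients are nondecreasing in t, so
    their infimum is the limit at 0+; as an infimum it gives a lower bound valid for every t > 0. *)
Definition dir_deriv v w : R := inf [set dir_quot v w t | t in [set t : R | 0 < t]].

Let dir_lb v w (t : R) : 0 < t -> - N (- w) <= dir_quot v w t.
Proof.
move=> t0; rewrite /dir_quot -ler_pdivrMl ?invr_gt0// invrK.
have := finslerD (v + t *: w) (t *: - w); rewrite (finslerZ _ (ltW t0)).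
by rewrite scalerN addrK; lra.
Qed.

Let dir_has_inf v w : has_inf [set dir_quot v w t | t in [set t : R | 0 < t]].
Proof.
split; first by exists (dir_quot v w 1); exists 1 => //=; exact: ltr01.
by exists (- N (- w)) => _ [t /= t0 <-]; exact: dir_lb.
Qed.

Lemma dir_deriv_le v w t : 0 < t -> N v + t * dir_deriv v w <= N (v + t *: w).
Proof.
move=> t0; have : dir_deriv v w <= dir_quot v w t.
  by apply: (ge_inf (dir_has_inf v w).2); exists t.
by rewrite /dir_quot ler_pdivlMl//; lra.
Qed.

(** The point v + s w is the convex combination of v + t w and v with weights s / t and 1 - s /
    t. *)
Lemma dir_quot_mono v w s t : 0 < s -> s <= t -> dir_quot v w s <= dir_quot v w t.
Proof.
move=> s0 st; have t0 : 0 < t by lra.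
have tn0 : t != 0 by rewrite gt_eqF.
have h : N (v + s *: w) <= (s / t) * N (v + t *: w) + (1 - s / t) * N v.
  rewrite -!finslerZ; last 2 first.
  - by rewrite subr_ge0 ler_pdivrMr ?mul1r.
  - by rewrite divr_ge0 ?ltW.
  apply: le_trans (finslerD _ _); rewrite le_eqVlt; apply/orP; left; apply/eqP.
  by congr N; rewrite scalerDr scalerA divfK//; rowring.
have h' : N (v + s *: w) - N v <= s * (t^-1 * (N (v + t *: w) - N v)).
  by rewrite mulrA mulrBr; lra.
by rewrite /dir_quot ler_pdivrMl.
Qed.

Lemma dir_deriv_adherent v w (e : R) : 0 < e -> exists2 d : R, 0 < d &
  forall t, 0 < t -> t <= d -> N (v + t *: w) <= N v + t * (dir_deriv v w + e).
Proof.
move=> e0; have [_ [d /= d0 <-] h] := inf_adherent e0 (dir_has_inf v w).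
exists d => // t t0 td; have := le_lt_trans (dir_quot_mono v w t0 td) h.
by rewrite {1}/dir_quot ltr_pdivrMl//; rewrite -/(dir_deriv v w); lra.
Qed.

(** Subadditivity comes from convexity: v + (t / 2) (x + y) is the midpoint of v + t x and v + t
    y. *)
Lemma dir_deriv_sublinear v : sublinear (dir_deriv v).
Proof.
split=> [x y|a x].
  apply/ler_addgt0Pr => e e0; have e20 : 0 < e / 2 by lra.
  have [d1 d10 H1] := dir_deriv_adherent v x e20.
  have [d2 d20 H2] := dir_deriv_adherent v y e20.
  pose t := Num.min d1 d2; have t0 : 0 < t by rewrite lt_min d10.
  have h1 : N (v + t *: x) <= N v + t * (dir_deriv v x + e / 2).
    by apply: H1 => //; rewrite ge_min lexx.
  have h2 : N (v + t *: y) <= N v + t * (dir_deriv v y + e / 2).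
    by apply: H2 => //; rewrite ge_min lexx orbT.
  have t20 : 0 < t / 2 by lra.
  have h3 := dir_deriv_le v (x + y) t20.
  have : N (v + (t / 2) *: (x + y)) <=
      2^-1 * N (v + t *: x) + 2^-1 * N (v + t *: y).
    rewrite -!finslerZ ?invr_ge0//; apply: le_trans (finslerD _ _).
    by rewrite le_eqVlt; apply/orP; left; apply/eqP; congr N; rowlin.
  move=> h4; rewrite -(ler_pM2l t20); move: h3 h1 h2 h4; lra.
rewrite le_eqVlt => /predU1P[<-|a0].
  rewrite scale0r mul0r; apply/eqP; rewrite eq_le; apply/andP; split.
    have := dir_deriv_le v 0 ltr01; rewrite scaler0 addr0; lra.
  apply: lb_le_inf (dir_has_inf v 0).1 _ => _ [t /= t0 <-].
  by rewrite /dir_quot scaler0 addr0 subrr mulr0.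
apply/eqP; rewrite eq_le; apply/andP; split.
  rewrite mulrC -ler_pdivrMr//.
  apply: lb_le_inf (dir_has_inf v x).1 _ => _ [t /= t0 <-].
  rewrite ler_pdivrMr// /dir_quot -mulrA [_ * a]mulrC mulrA -ler_pdivrMl; last first.
    by rewrite mulr_gt0// invr_gt0.
  have := dir_deriv_le v (a *: x) (divr_gt0 t0 a0).
  by rewrite scalerA divfK ?gt_eqF// invfM invrK; lra.
apply: lb_le_inf (dir_has_inf v _).1 _ => _ [t /= t0 <-].
rewrite /dir_quot -ler_pdivrMl ?invr_gt0// invrK.
have := dir_deriv_le v x (mulr_gt0 t0 a0); rewrite scalerA mulrA; lra.
Qed.

Lemma dir_deriv_le_norm v w : dir_deriv v w <= N w.
Proof.
by have := dir_deriv_le v w ltr01; rewrite scale1r mul1r; have := finslerD v w; lra.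
Qed.

Lemma dir_deriv_self v : dir_deriv v (- v) <= - N v.
Proof.
have h20 : 0 < 2^-1 :> R by rewrite invr_gt0.
have := dir_deriv_le v (- v) h20.
rewrite (_ : v + _ = 2^-1 *: v); last first.
  by rewrite scalerN -{1}[v]scale1r -scalerBl; congr (_ *: _); lra.
by rewrite (finslerZ _ (ltW h20)); lra.
Qed.

(** Hahn-Banach is applied to [dir_deriv N v] rather than to N. A functional below it is below N,
    and [dir_deriv_self] forces it to norm v, so only the value at w remains to be prescribed. *)
Lemma subgradient v w : exists phi : {scalar V},
  [/\ forall x, phi x <= N x, phi v = N v & phi w = dir_deriv v w].
Proof.
have [phi [le pw]] := hahn_banach w (dir_deriv_sublinear v).
have phiN x : phi x <= N x := le_trans (le x) (dir_deriv_le_norm v x).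
exists phi; split => //; apply/eqP; rewrite eq_le phiN/=.
by have := le_trans (le (- v)) (dir_deriv_self v); rewrite linearN; lra.
Qed.

Lemma dual_norm_has_sup (phi : {scalar V}) :
  has_sup [set phi x | x in [set x | N x <= 1]].
Proof.
split; first by exists (phi 0); exists 0 => //=; rewrite finsler0.
have [c c0 lo] := finsler_lower.
exists (\sum_i c * `|phi (delta_mx 0 i)|) => _ [x /= x1 <-].
rewrite {1}(row_sum_delta x) linear_sum; apply: ler_sum => i _ /=.
rewrite linearZ /= (le_trans (ler_norm _))// normrM ler_wpM2r//.
rewrite (le_trans (coord_le_norm _ _))// (le_trans (lo x))//.
by rewrite ger_pMr.
Qed.

Lemma norming_le v (phi : {scalar V}) : norming N v phi -> forall x, phi x <= N x.
Proof.
move=> [d1 _] x; have [->|x0] := eqVneq x 0; first by rewrite linear0 finsler0.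
have Nx := finsler_gt0 x0.
have : phi ((N x)^-1 *: x) <= 1.
  rewrite -d1; apply: ub_le_sup; first exact: (dual_norm_has_sup phi).2.
  exists ((N x)^-1 *: x) => //=.
  by rewrite finslerZ ?invr_ge0 ?finsler_ge0// mulVf// gt_eqF.
by rewrite linearZ /= ler_pdivrMl// mulr1.
Qed.

(** Being below N bounds the dual norm by 1; for v nonzero the value 1 is reached at v / N v. *)
Lemma normingP v (phi : {scalar V}) : v != 0 ->
  norming N v phi <-> (forall x, phi x <= N x) /\ phi v = N v.
Proof.
move=> v0; split=> [np|[le pv]].
  by split; [exact: norming_le np|case: np].
split => //; apply/eqP; rewrite eq_le; apply/andP; split.
  apply: sup_le_ub; first exact: (dual_norm_has_sup phi).1.
  by move=> _ [x /= x1 <-]; exact: le_trans (le _) x1.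
have Nv := finsler_gt0 v0.
apply: (ub_le_sup (dual_norm_has_sup phi).2); exists ((N v)^-1 *: v) => /=.
  by rewrite finslerZ ?invr_ge0 ?finsler_ge0// mulVf// gt_eqF.
by rewrite linearZ /= pv mulVf// gt_eqF.
Qed.

(** Each difference quotient bounds phi w from above when phi norms v, and [subgradient] attains the
    infimum of these bounds. *)
Lemma norming_max v w : v != 0 ->
  is_max [set phi w | phi in norming N v] (dir_deriv v w).
Proof.
move=> v0; split.
  have [phi [le pv pw]] := subgradient v w.
  by exists phi => //; apply/normingP.
move=> _ [phi /(normingP _ v0) [le pv] <-].
apply: lb_le_inf (dir_has_inf v w).1 _ => _ [t /= t0 <-].
rewrite /dir_quot ler_pdivlMl//.
by have := le (v + t *: w); rewrite linearD linearZ /= pv; lra.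
Qed.

(** At the zero vector every functional of dual norm 1 is norming; a nonzero vector is needed to
    produce one. *)
Lemma norming0 : (0 < n)%N -> norming N 0 !=set0.
Proof.
move=> n0; pose u : V := delta_mx 0 (Ordinal n0).
have u0 : u != 0.
  apply/eqP => /rowP /(_ (Ordinal n0)); rewrite !mxE !eqxx /=.
  by move/eqP; rewrite oner_eq0.
have [phi [le pu _]] := subgradient u u.
exists phi; split; last by rewrite linear0 finsler0.
by have [] := (normingP phi u0).2 (conj le pu).
Qed.

End FinslerNorms.

Lemma is_max_sup (R : realType) (A : set R) m : is_max A m -> sup A = m.
Proof.
move=> [Am ubm]; apply/eqP; rewrite eq_le; apply/andP; split.
  by apply: sup_le_ub => //; exists m.
by apply: ub_le_sup => //; exists m.
Qed.

(** * Strict differentiability and linearization *)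

Section HasDiff.
Variable R : realType.
Implicit Types (U W X : normedModType R).

(** The Frechet expansion with a bare function L: linearity and continuity are not built in, so that
    curves, partial derivatives and compositions need no bundled linear maps. *)
Definition has_diff U W (f : U -> W) (x : U) (L : U -> W) : Prop :=
  forall e : R, 0 < e -> exists2 d : R, 0 < d &
    forall h, `|h| < d -> `|f (x + h) - f x - L h| <= e * `|h|.

Lemma differentiable_has_diff U W (f : U -> W) x :
  differentiable f x -> has_diff f x ('d f x).
Proof.
move=> /diff_locallyP [_ /eqaddoP H] e /H /nearN [d d0 Hd].
exists d => // h hd; have := Hd h; rewrite subr0 => /(_ hd).
by rewrite !fctE /= [h + x]addrC opprD addrA.
Qed.

Lemma has_diff_differentiable U W (f : U -> W) x (L : {linear U -> W}) :
  continuous L -> has_diff f x L -> differentiable f x /\ 'd f x = L :> (U -> W).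
Proof.
move=> cL H.
have E : f \o shift x = cst (f x) + L +o_ 0 id.
  apply/eqaddoP => e /H [d d0 Hd]; apply/nearN; exists d => // h.
  by rewrite subr0 => /Hd; rewrite !fctE /= [h + x]addrC opprD addrA.
have dE := diff_unique cL E.
by split => //; apply/diff_locallyP; rewrite dE.
Qed.

Lemma is_derive_has_diff W (f : R -> W) (t : R) v :
  is_derive t (1 : R) f v <-> has_diff f t (fun s => s *: v).
Proof.
split=> [[df dv]|H].
  have /cvgrPdist_lt H : h^-1 *: ((f \o shift t) (h *: (1 : R)) - f t) @[h --> 0^'] --> v.
    by rewrite -dv; exact: df.
  move=> e /H; rewrite near_withinE => /nearN [d d0 Hd].
  exists d => // h hd; have [->|h0] := eqVneq h 0.
    by rewrite addr0 subrr scale0r subr0 !normr0 mulr0.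
  have := Hd h; rewrite subr0 => /(_ hd h0) /ltW.
  rewrite -(ler_pM2l (x := `|h|)) ?normr_gt0// -normrZ scalerBr scalerA mulfV// scale1r.
  by rewrite /= [h *: (1 : R)]mulr1 [h + t]addrC distrC mulrC.
have C : h^-1 *: ((f \o shift t) (h *: (1 : R)) - f t) @[h --> 0^'] --> v.
  apply/cvgrPdist_le => e /H [d d0 Hd].
  suff : \forall h \near (0 : R), h != 0 ->
      `|v - h^-1 *: ((f \o shift t) (h *: (1 : R)) - f t)| <= e.
    by rewrite near_withinE.
  apply/nearN; exists d => // h; rewrite subr0 => /Hd h1 h0.
  rewrite -(ler_pM2l (x := `|h|)) ?normr_gt0// -normrZ scalerBr scalerA mulfV// scale1r.
  by move: h1; rewrite /= [h *: (1 : R)]mulr1 [h + t]addrC distrC mulrC.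
split; last exact: cvg_lim C.
by apply/cvg_ex; exists v.
Qed.

Lemma has_diff_near U W (f g : U -> W) x L :
  (\forall y \near x, f y = g y) -> has_diff f x L -> has_diff g x L.
Proof.
move=> /nearN [r r0 fg] H e /H [d d0 Hd]; exists (Num.min d r).
  by rewrite lt_min d0.
move=> h; rewrite lt_min => /andP[hd hr]; rewrite -!fg; first exact: Hd.
  by rewrite subrr normr0.
by rewrite addrAC subrr add0r.
Qed.

Lemma has_diff_comp U W X (f : W -> X) (g : U -> W) x L M (K K' : R) :
  has_diff f (g x) L -> has_diff g x M ->
  (forall a b, `|L a - L b| <= K * `|a - b|) -> (forall h, `|M h| <= K' * `|h|) ->
  has_diff (f \o g) x (L \o M).
Proof.
move=> Hf Hg LK MK e e0.
pose k := `|K| + 1; pose k' := `|K'| + 2.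
have k0 : 0 < k by rewrite ltr_wpDl.
have k'0 : 0 < k' by rewrite ltr_wpDl.
have e1 : 0 < e / (2 * k') by rewrite divr_gt0// mulr_gt0.
have e2 : 0 < Num.min 1 (e / (2 * k)) by rewrite lt_min ltr01 divr_gt0// mulr_gt0.
have [d1 d10 H1] := Hf _ e1; have [d2 d20 H2] := Hg _ e2.
exists (Num.min d2 (d1 / k')); first by rewrite lt_min d20 divr_gt0.
move=> h; rewrite lt_min ltr_pdivlMr// => /andP[hd2 hd1].
have := H2 h hd2; set r := g (x + h) - g x - M h => rh.
have rh1 : `|r| <= `|h|.
  by rewrite (le_trans rh)// ler_piMl// ge_min lexx.
have rh2 : `|r| <= e / (2 * k) * `|h|.
  by rewrite (le_trans rh)// ler_wpM2r// ge_min lexx orbT.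
pose a := g (x + h) - g x.
have aE : a = M h + r by rewrite /r addrC subrK.
have ah : `|a| <= k' * `|h|.
  rewrite aE (le_trans (ler_normD _ _))//.
  have := MK h; have := ler_norm K'; rewrite /k'.
  have := normr_ge0 h; move: rh1; nra.
have ad1 : `|a| < d1 by rewrite (le_lt_trans ah)// mulrC.
have gxa : g x + a = g (x + h) by rewrite /a addrC subrK.
have := H1 a ad1; rewrite gxa => h1.
have : `|L a - L (M h)| <= e / 2 * `|h|.
  rewrite (le_trans (LK _ _))// aE addrC addKr.
  apply: (@le_trans _ _ (k * `|r|)).
    by rewrite ler_wpM2r// /k; have := ler_norm K; lra.
  apply: (@le_trans _ _ (k * (e / (2 * k) * `|h|))); first by rewrite ler_pM2l.
  rewrite le_eqVlt; apply/orP; left; apply/eqP; field.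
  by rewrite gt_eqF.
have : e / (2 * k') * `|a| <= e / 2 * `|h|.
  apply: (@le_trans _ _ (e / (2 * k') * (k' * `|h|))); first by rewrite ler_pM2l.
  rewrite le_eqVlt; apply/orP; left; apply/eqP; field.
  by rewrite gt_eqF.
move=> h2 h3.
rewrite /= (_ : _ - _ - _ = (f (g (x + h)) - f (g x) - L a) + (L a - L (M h))).
  rewrite (le_trans (ler_normD _ _))//.
  have -> : e * `|h| = e / 2 * `|h| + e / 2 * `|h| by field.
  by apply: lerD => //; exact: le_trans h1 h2.
by rewrite addrA subrK.
Qed.

End HasDiff.

Section MeanValue.
Variables (R : realType) (n : nat).
Local Notation V := 'rV[R]_n.

Lemma has_diff_coord (g : R -> V) (t : R) v i :
  has_diff g t (fun s => s *: v) -> has_diff (fun s => g s 0 i) t (fun s => s *: v 0 i).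
Proof.
move=> H e /H [d d0 Hd]; exists d => // h /Hd; apply: le_trans.
by apply: le_trans (coord_le_norm _ i); rewrite !mxE.
Qed.

(** The norm is the maximum of the coordinates, so the scalar mean value theorem in each coordinate
    loses no constant. *)
Lemma mean_value_ineq (g : R -> V) (v : R -> V) (K : R) :
  (forall t, 0 <= t <= 1 -> has_diff g t (fun s => s *: v t)) ->
  (forall t, 0 <= t <= 1 -> `|v t| <= K) -> `|g 1 - g 0| <= K.
Proof.
move=> H vK.
have K0 : 0 <= K by apply: le_trans (vK 0 _); rewrite ?lexx ?ler01.
apply: row_norm_le => // i.
have D (t : R) : 0 <= t <= 1 -> is_derive t (1 : R) (fun s => g s 0 i) (v t 0 i).
  by move=> /H /has_diff_coord - /(_ i) /is_derive_has_diff.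
have [||c c01] := @MVT R (fun s => g s 0 i) (fun s => v s 0 i) 0 1 ltr01.
- by move=> t; rewrite in_itv/= => /andP[t0 t1]; apply: D; rewrite !ltW.
- apply: derivable_within_continuous => t; rewrite in_itv/= => t01.
  by have [] := D t t01.
rewrite subr0 mulr1 => E; rewrite !mxE E (le_trans (coord_le_norm _ _))// vK//.
by move: c01; rewrite in_itv/= => /andP[? ?]; rewrite !ltW.
Qed.

End MeanValue.

Section Frames.
Variable R : realType.
Implicit Types (U W : normedModType R).

(** A finite spanning family whose coordinates are bounded by the norm. It covers row vectors and
    their products alike and makes linear maps bounded. *)
Definition framed U : Prop := exists (I : finType) (e : I -> U) (c : I -> U -> R),
  (forall h, h = \sum_i c i h *: e i) /\ forall i h, `|c i h| <= `|h|.

Lemma framed_row n : framed 'rV[R]_n.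
Proof.
exists 'I_n, (delta_mx 0), (fun i (h : 'rV[R]_n) => h 0 i); split=> [h|i h].
  exact: row_sum_delta.
exact: coord_le_norm.
Qed.

Lemma framed_prod U W : framed U -> framed W -> framed (U * W)%type.
Proof.
move=> [I [e [c [E B]]]] [I' [e' [c' [E' B']]]].
exists (I + I')%type, (fun i => match i with inl i => (e i, 0) | inr i => (0, e' i) end),
  (fun i h => match i with inl i => c i h.1 | inr i => c' i h.2 end); split.
  move=> [h h']; rewrite big_sumType /=.
  have -> : \sum_i c i h *: (e i, 0 : W) = (h, 0).
    rewrite [in RHS](E h); elim/big_rec2: _ => // i y1 y2 _ ->.
    by apply: injective_projections => /=; rewrite ?scaler0 ?addr0.
  have -> : \sum_i c' i h' *: (0 : U, e' i) = (0, h').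
    rewrite [in RHS](E' h'); elim/big_rec2: _ => // i y1 y2 _ ->.
    by apply: injective_projections => /=; rewrite ?scaler0 ?addr0.
  by apply: injective_projections => /=; rewrite ?addr0 ?add0r.
move=> [i|i] [h h'] /=; rewrite [leRHS]prod_normE/=.
  by rewrite le_max B.
by rewrite le_max B' orbT.
Qed.

Lemma framed_bounded U W (L : {linear U -> W}) : framed U ->
  exists2 K : R, 0 < K & forall h, `|L h| <= K * `|h|.
Proof.
move=> [I [e [c [E B]]]]; exists (1 + \sum_i `|L (e i)|).
  by rewrite ltr_wpDr// sumr_ge0.
move=> h; rewrite {1}(E h) linear_sum (le_trans (ler_norm_sum _ _ _))//.
apply: (@le_trans _ _ ((\sum_i `|L (e i)|) * `|h|)).
  rewrite mulr_suml; apply: ler_sum => i _.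
  by rewrite linearZ normrZ mulrC ler_wpM2l.
by rewrite ler_wpM2r// lerDr.
Qed.

(** Differentiability of the derivative at the single point x0 bounds ['d F x - 'd F x0] by a
    multiple of |x - x0| on each frame vector, hence on all vectors. The mean value inequality on
    the segment from y to x, applied to F minus its linear part, concludes. *)
Lemma strict_estimate U n (F : U -> 'rV[R]_n) (x0 : U) : framed U ->
  (\forall x \near x0, differentiable F x) ->
  (forall h, differentiable (fun x => 'd F x h) x0) ->
  exists r C : R, [/\ 0 < r, 0 < C & forall x y, `|x - x0| < r -> `|y - x0| < r ->
    `|F x - F y - 'd F x0 (x - y)| <= C * Num.max `|x - x0| `|y - x0| * `|x - y|].
Proof.
move=> frU /nearN [r0 r00 dF] ddF.
have [I [e [c [E B]]]] := frU.
have /choice [p P] : forall i, exists p : R * R, [/\ 0 < p.1, 0 < p.2 &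
    forall x, `|x - x0| < p.1 -> `|'d F x (e i) - 'd F x0 (e i)| <= p.2 * `|x - x0|].
  move=> i; have [K K0 HK] := framed_bounded ('d (fun x => 'd F x (e i)) x0) frU.
  have [d d0 Hd] := differentiable_has_diff (ddF (e i)) ltr01.
  exists (d, K + 1); split => //=; first by rewrite addr_gt0.
  move=> x /Hd; rewrite [x0 + _]addrC subrK mul1r => h1.
  rewrite mulrDl mul1r -[X in `|X|](subrK ('d (fun x => 'd F x (e i)) x0 (x - x0))).
  by rewrite (le_trans (ler_normD _ _))// addrC lerD.
pose r := \big[Num.min/r0]_i (p i).1.
pose C := 1 + \sum_i (p i).2.
have rr0 : 0 < r.
  rewrite /r; elim/big_ind: _ => // [a b a0 b0|i _]; first by rewrite lt_min a0.
  by have [] := P i.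
have C0 : 0 < C by rewrite ltr_wpDr// sumr_ge0// => i _; have [_ /ltW] := P i.
have key x h : `|x - x0| < r -> `|'d F x h - 'd F x0 h| <= C * `|x - x0| * `|h|.
  move=> xr.
  have -> : 'd F x h - 'd F x0 h = \sum_i c i h *: ('d F x (e i) - 'd F x0 (e i)).
    rewrite [in LHS](E h) (linear_sum ('d F x)) (linear_sum ('d F x0)) -sumrB; apply: eq_bigr => i _.
    by rewrite scalerBr; congr (_ - _); exact: linearZZ.
  rewrite (le_trans (ler_norm_sum _ _ _))//.
  apply: (@le_trans _ _ (\sum_i (p i).2 * `|x - x0| * `|h|)).
    apply: ler_sum => i _; rewrite normrZ mulrC.
    have [_ _ /(_ x) h1] := P i.
    apply: ler_pM => //; apply: h1; apply: lt_le_trans xr _; exact: bigmin_le_cond.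
  by rewrite -!mulr_suml -!mulrA ler_wpM2r ?mulr_ge0// lerDr.
exists r, C; split => // x y xr yr.
set m := Num.max _ _.
pose q (t : R) := y + t *: (x - y).
pose g (t : R) := F (q t) - t *: 'd F x0 (x - y).
have qm t : 0 <= t <= 1 -> `|q t - x0| <= m.
  move=> /andP[t0 t1].
  have -> : q t - x0 = t *: (x - x0) + (1 - t) *: (y - x0).
    have -> : q t - x0 = (y - x0) + t *: ((x - x0) - (y - x0)).
      by rewrite opprB addrA subrK addrAC.
    by rewrite scalerBr scalerBl scale1r addrCA.
  rewrite (le_trans (ler_normD _ _))// !normrZ (ger0_norm t0) ger0_norm ?subr_ge0//.
  have h1 : `|x - x0| <= m by rewrite le_max lexx.
  have h2 : `|y - x0| <= m by rewrite le_max lexx orbT.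
  have := normr_ge0 (x - x0); nra.
have mr : m < r by rewrite gt_max xr.
have gE : g 1 - g 0 = F x - F y - 'd F x0 (x - y).
  have q1 : q 1 = x by rewrite /q scale1r addrC subrK.
  have q0 : q 0 = y by rewrite /q scale0r addr0.
  by rewrite /g q1 q0 scale1r scale0r subr0 addrAC.
rewrite -gE; apply: (@mean_value_ineq _ _ g (fun t => 'd F (q t) (x - y) - 'd F x0 (x - y))).
- move=> t t01.
  have dq : differentiable F (q t).
    apply: dF; apply: le_lt_trans (qm t t01) _; apply: lt_le_trans mr _.
    exact: bigmin_le_id.
  move=> ee ee0.
  have n0 : 0 < `|x - y| + 1 by rewrite ltr_wpDl.
  have [d d0 Hd] := differentiable_has_diff dq (divr_gt0 ee0 n0).
  exists (d / (`|x - y| + 1)) => [|s]; first by rewrite divr_gt0.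
  rewrite ltr_pdivlMr// => sd.
  have hs : `|s *: (x - y)| < d.
    by rewrite normrZ (le_lt_trans _ sd)// ler_wpM2l// lerDl.
  have := Hd _ hs.
  rewrite -[q t + _]addrA -scalerDl -/(q (t + s)) linearZ /= => h1.
  rewrite /g (_ : _ - _ - _ = F (q (t + s)) - F (q t) - s *: 'd F (q t) (x - y)).
    rewrite (le_trans h1)// normrZ mulrCA [leRHS]mulrC ler_wpM2l//.
    rewrite -mulrA ger_pMr// mulrC ler_pdivrMr// mul1r lerDl//.
  rewrite scalerDl scalerBr; apply/rowP => j; rewrite !mxE; ring.
- move=> t t01; rewrite (le_trans (key _ _ _))//.
    exact: le_lt_trans (qm t t01) mr.
  by rewrite ler_wpM2r// ler_pM2l// qm.
Qed.

End Frames.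


(** * Geometric limits, local inversion and linearization of a map near 0 *)

Section GeometricLimits.
Variable R : realType.

(** The ratio 3/4 is the rate of convergence met in [koenigs]; faster iterations are recorded with
    the same rate. *)
Lemma le0_geometric (x c : R) : (forall k : nat, x <= c * (3 / 4) ^+ k) -> x <= 0.
Proof.
move=> H; rewrite leNgt; apply/negP => x0.
have c1 : 0 < `|c| + 1 by rewrite ltr_wpDl.
have q1 : `|3 / 4 : R| < 1 by rewrite ger0_norm; lra.
have /cvgrPdist_lt /(_ _ (divr_gt0 x0 c1)) [k _ /(_ k (leqnn k))] := cvg_expr q1.
rewrite /= sub0r normrN ger0_norm; last by rewrite exprn_ge0//; lra.
rewrite ltr_pdivlMr// => h.
have := H k; have := ler_norm c; have : 0 <= (3 / 4 : R) ^+ k by rewrite exprn_ge0//; lra.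
by move: h; nra.
Qed.

Lemma le_geometric (x y c : R) : (forall k : nat, x <= y + c * (3 / 4) ^+ k) -> x <= y.
Proof. by move=> H; rewrite -subr_le0; apply: (@le0_geometric _ c) => k; have := H k; lra. Qed.

(** The sequences u k - 4 B (3/4)^k and u k + 4 B (3/4)^k are monotone and enclose the limit; the 4
    is 1 / (1 - 3/4). *)
Lemma geometric_limit_real (u : nat -> R) (B : R) :
  (forall k, `|u k.+1 - u k| <= B * (3 / 4) ^+ k) ->
  exists l, forall k, `|u k - l| <= 4 * B * (3 / 4) ^+ k.
Proof.
move=> H; pose b k := u k - 4 * B * (3 / 4) ^+ k; pose a k := u k + 4 * B * (3 / 4) ^+ k.
have B0 : 0 <= B by have := le_trans (normr_ge0 _) (H 0%N); rewrite expr0 mulr1.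
have bS k : b k <= b k.+1.
  have := H k; rewrite /b exprS ler_norml => /andP[]; set q := _ ^+ k; lra.
have aS k : a k.+1 <= a k.
  have := H k; rewrite /a exprS ler_norml => /andP[]; set q := _ ^+ k; lra.
have ba k : b k <= a k.
  by rewrite /a /b lerD2l -subr_ge0 opprK -mulr2n mulrn_wge0// !mulr_ge0// exprn_ge0//; lra.
have bm : {homo b : i j / (i <= j)%N >-> i <= j} by apply: homo_leq => // x y z; exact: le_trans.
have am i j : (i <= j)%N -> a j <= a i.
  by elim: j => [|j IH]; [rewrite leqn0 => /eqP->|rewrite leq_eqVlt => /predU1P[->//|/IH]; exact: le_trans].
have bak i j : b i <= a j.
  have h1 := bm _ _ (leq_maxl i j); have h2 := am _ _ (leq_maxr i j).
  exact: le_trans h1 (le_trans (ba _) h2).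
exists (sup (range b)) => k; rewrite ler_norml; apply/andP; split.
  have : sup (range b) <= a k by apply: sup_le_ub; [exists (b 0%N); exists 0%N|move=> _ [i _ <-]].
  by rewrite /a; lra.
have : b k <= sup (range b).
  by apply: ub_le_sup; [exists (a 0%N) => _ [i _ <-]|exists k].
by rewrite /b; lra.
Qed.

Lemma geometric_limit n (u : nat -> 'rV[R]_n) (B : R) :
  (forall k, `|u k.+1 - u k| <= B * (3 / 4) ^+ k) ->
  exists l, forall k, `|u k - l| <= 4 * B * (3 / 4) ^+ k.
Proof.
move=> H.
have B0 : 0 <= B by have := le_trans (normr_ge0 _) (H 0%N); rewrite expr0 mulr1.
have /choice [l hl] i : exists l, forall k, `|u k 0 i - l| <= 4 * B * (3 / 4) ^+ k.
  apply: geometric_limit_real => k; apply: le_trans (H k).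
  by apply: le_trans (coord_le_norm _ i); rewrite !mxE.
exists (\row_i l i) => k; apply: row_norm_le.
  by rewrite !mulr_ge0// exprn_ge0//; lra.
by move=> i; rewrite !mxE.
Qed.

End GeometricLimits.

Section NearIdentity.
Variables (R : realType) (n : nat).
Local Notation V := 'rV[R]_n.

Lemma norm_le_sub (W : normedModType R) (x y : W) : `|x| <= `|y| + `|x - y|.
Proof. by rewrite -{1}(subrK y x) addrC ler_normD. Qed.

(** Strict differentiability at 0 with derivative a times the identity, made quantitative: on the
    ball of radius rho the remainder has Lipschitz constant C rho. *)
Definition near_linear (a C r : R) (f : V -> V) : Prop :=
  f 0 = 0 /\ forall (rho : R) x y, rho <= r -> `|x| <= rho -> `|y| <= rho ->
    `|f x - f y - a *: (x - y)| <= C * rho * `|x - y|.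

Lemma near_linear_lip a C r f (rho : R) x y : 0 <= a -> near_linear a C r f ->
  rho <= r -> `|x| <= rho -> `|y| <= rho -> `|f x - f y| <= (a + C * rho) * `|x - y|.
Proof.
move=> a0 [_ H] rr xr yr; have := H _ _ _ rr xr yr.
have := norm_le_sub (f x - f y) (a *: (x - y)).
by rewrite normrZ (ger0_norm a0); lra.
Qed.

Lemma near_linear_le a C r f (rho : R) x : 0 <= a -> near_linear a C r f ->
  rho <= r -> `|x| <= rho -> `|f x| <= (a + C * rho) * `|x|.
Proof.
move=> a0 H rr xr; have := near_linear_lip a0 H rr xr.
move=> /(_ 0); rewrite normr0 H.1 !subr0; apply.
exact: le_trans xr.
Qed.

(** The solution is the limit of the iterates from 0 of x |-> y - (f x - x), a 1/2-contraction on
    the ball of radius r; they stay within 2 |y|. *)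
Lemma near_id_inverse C r f : 0 < r -> 0 <= C -> C * r <= 1 / 2 ->
  near_linear 1 C r f ->
  forall y, `|y| <= r / 2 -> exists x, [/\ `|x| <= 2 * `|y|, `|x| <= r & f x = y].
Proof.
move=> r0 C0 Cr H y yr.
pose T x := y - (f x - x).
have Dlip x z : `|x| <= r -> `|z| <= r -> `|T x - T z| <= 1 / 2 * `|x - z|.
  move=> xr zr; have := H.2 _ _ _ (lexx r) xr zr; rewrite scale1r.
  rewrite (_ : T x - T z = - (f x - f z - (x - z))); last by rewrite /T; rowring.
  rewrite normrN => h; apply: le_trans h _; by rewrite ler_wpM2r.
pose u k := iter k T 0.
have T0 : T 0 = y by rewrite /T H.1 subrr subr0.
have ub k : `|u k| <= 2 * `|y|.
  elim: k => [|k IH]; first by rewrite /u normr0 mulr_ge0.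
  have := Dlip (u k) 0; rewrite normr0 subr0 T0 => h.
  have {}h := h ltac:(lra) (ltW r0).
  by have := norm_le_sub (u k.+1) y; rewrite /= -/(u k); lra.
have [l hl] : exists l, forall k, `|u k - l| <= 4 * `|y| * (3 / 4) ^+ k.
  apply: geometric_limit => k; elim: k => [|k IH].
    by rewrite /u /= subr0 T0 expr0 mulr1.
  apply: le_trans (Dlip _ _ _ _) _; [have := ub k.+1; rewrite /=; lra|have := ub k; lra|].
  rewrite exprS; move: IH; set q := _ ^+ k.
  have : 0 <= q by rewrite exprn_ge0//; lra.
  by have := normr_ge0 y; rewrite /=; nra.
have ly : `|l| <= 2 * `|y|.
  apply: (@le_geometric _ _ _ (4 * `|y|)) => k.
  by have := hl k; have := ub k; have := norm_le_sub l (u k); rewrite distrC; lra.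
exists l; split => //; first lra.
have Tl : T l = l.
  apply/eqP; rewrite -subr_eq0 -normr_eq0 eq_le normr_ge0 andbT.
  apply: (@le0_geometric _ _ (8 * `|y|)) => k.
  have h1 : `|T (u k) - T l| <= 1 / 2 * `|u k - l|.
    by apply: Dlip; have := ub k; lra.
  have h2 := hl k; have h3 := hl k.+1.
  have : `|T l - l| <= `|u k.+1 - l| + `|T (u k) - T l|.
    rewrite (_ : T l - l = (u k.+1 - l) - (T (u k) - T l)); last by rewrite /=; rowring.
    exact: ler_normB.
  move: h1 h2 h3; rewrite exprS; set q := _ ^+ k.
  have : 0 <= q by rewrite exprn_ge0//; lra.
  by have := normr_ge0 y; nra.
by apply/rowP => i; move/rowP: Tl => /(_ i); rewrite !mxE; lra.
Qed.

Lemma near_id_inj C r f x y : C * r <= 1 / 2 -> near_linear 1 C r f ->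
  `|x| <= r -> `|y| <= r -> `|x - y| <= 2 * `|f x - f y|.
Proof.
move=> Cr [_ H] xr yr; have := H _ _ _ (lexx r) xr yr; rewrite scale1r.
have := norm_le_sub (x - y) (f x - f y); rewrite [`|x - y - _|]distrC => h1 h2.
by have := ler_wpM2r (normr_ge0 (x - y)) Cr; lra.
Qed.

(* Koenigs' linearisation: E is the limit of the conjugates s^k (x / 2^k). *)
Lemma koenigs C r (s : V -> V) : 0 < r -> 0 <= C -> near_linear 2 C r s ->
  exists2 r', 0 < r' & exists E : V -> V, [/\ r' <= r, near_linear 1 (2 * C) r' E &
    forall x, `|x| <= r' -> `|x + x| <= r' -> E (x + x) = s (E x)].
Proof.
move=> r0 C0 H.
pose r' := Num.min r ((4 * C + 1)^-1).
have c1 : 0 < 4 * C + 1 by lra.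
have r'0 : 0 < r' by rewrite lt_min r0 invr_gt0.
have r'r : r' <= r by rewrite ge_min lexx.
have Cr' : 4 * (C * r') <= 1.
  have : r' * (4 * C + 1) <= 1.
    by rewrite -ler_pdivlMr// div1r ge_min lexx orbT.
  by move: (ltW r'0); lra.
exists r' => //.
pose h (x : V) := 2^-1 *: x.
pose E_ k := iter k (fun (E : V -> V) x => s (E (h x))) id.
have hn x : `|h x| = 2^-1 * `|x| by rewrite normrZ ger0_norm ?invr_ge0.
have hB x y : h x - h y = 2^-1 *: (x - y) by rewrite /h scalerBr.
(* The constant 2 C reproduces itself: at half the radius the error of [E_ k] contributes C rho
   after multiplication by 2, and the error of s another C rho. *)
have NE k : near_linear 1 (2 * C) r' (E_ k).
  elim: k => [|k IH].
    split=> // rho x y _ xr _; rewrite scale1r subrr normr0 !mulr_ge0//.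
    exact: le_trans xr.
  split=> [|rho x y rr xr yr]; first by rewrite /= /h scaler0 IH.1 H.1.
  have rho0 : 0 <= rho := le_trans (normr_ge0 _) xr.
  have hr z : `|z| <= rho -> `|h z| <= rho / 2 by move=> zr; rewrite hn; lra.
  have rr2 : rho / 2 <= r' by lra.
  have sm : C * rho <= 1 / 4.
    by have := ler_wpM2l C0 rr; lra.
  have b1 := near_linear_le ler01 IH rr2 (hr _ xr).
  have b2 := near_linear_le ler01 IH rr2 (hr _ yr).
  have b3 := near_linear_lip ler01 IH rr2 (hr _ xr) (hr _ yr).
  have b4 := IH.2 _ _ _ rr2 (hr _ xr) (hr _ yr).
  rewrite scale1r in b4.
  rewrite hB normrZ (ger0_norm (x := 2^-1)) ?invr_ge0// in b3 b4.
  rewrite hn in b1; rewrite hn in b2.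
  move: b1 b2 b3 b4; rewrite /=.
  set a := E_ k (h x); set b := E_ k (h y) => b1 b2 b3 b4.
  have a1 : `|a| <= rho by have := normr_ge0 x; nra.
  have a2 : `|b| <= rho by have := normr_ge0 y; nra.
  have := H.2 rho a b (le_trans rr r'r) a1 a2.
  have := normr_ge0 (x - y).
  have -> : s a - s b - 1 *: (x - y) = (s a - s b - 2 *: (a - b)) + 2 *: (a - b - 2^-1 *: (x - y)).
    by rowlin.
  move=> xy0 h1; apply: le_trans (ler_normD _ _) _.
  rewrite normrZ ger0_norm//.
  have : `|a - b| <= `|x - y| by nra.
  by move=> ab; have := ler_wpM2l (mulr_ge0 C0 rho0) ab; lra.
(* The increments scale like |x|^2. Halving the argument gives 1/4 and s is 3-Lipschitz on the ball,
   whence the ratio 3/4. *)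
have ES k x : `|x| <= r' -> `|E_ k.+1 x - E_ k x| <= C * `|x| * `|x| * (3 / 4) ^+ k.
  elim: k x => [|k IH] x xr.
    rewrite /= expr0 mulr1.
    have hx : `|h x| <= `|x| by rewrite hn; have := normr_ge0 x; lra.
    have := H.2 `|x| (h x) 0 (le_trans xr r'r) hx; rewrite normr0 H.1 !subr0.
    move=> /(_ (normr_ge0 _)).
    rewrite /h scalerA mulfV ?pnatr_eq0// scale1r normrZ ger0_norm ?invr_ge0//.
    move=> h1; apply: le_trans h1 _.
    by have := mulr_ge0 (mulr_ge0 C0 (normr_ge0 x)) (normr_ge0 x); lra.
  have hx : `|h x| <= r' by rewrite hn; lra.
  have b0 x' k' : `|x'| <= r' -> `|E_ k' x'| <= (1 + 2 * C * `|x'|) * `|x'|.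
    by move=> xr'; apply: near_linear_le (NE k') xr' (lexx _).
  have b1 := b0 (h x) k hx; have b2 := b0 (h x) k.+1 hx.
  have bb (y : V) : `|y| <= (1 + 2 * C * `|h x|) * `|h x| -> `|y| <= r'.
    move=> yh; apply: le_trans yh _; rewrite !hn; have := normr_ge0 x.
    have : C * `|x| <= 1 / 4 by have := ler_wpM2l C0 xr; lra.
    by nra.
  have := near_linear_lip (ler0n _ 2) H r'r (bb _ b2) (bb _ b1).
  have := IH _ hx; rewrite hn exprS /=; set q := (3 / 4) ^+ k.
  set A := s (E_ k (h (h x))); set B := E_ k (h x) => h1 h2.
  apply: le_trans h2 _.
  apply: (@le_trans _ _ (3 * `|A - B|)).
    by rewrite ler_wpM2r//; lra.
  by rewrite -ler_pdivlMl//; apply: le_trans h1 _; lra.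
have /choice [E hE] x : exists l, `|x| <= r' -> forall k,
    `|E_ k x - l| <= 4 * (C * `|x| * `|x|) * (3 / 4) ^+ k.
  have [xr|xr] := leP `|x| r'; last by exists 0.
  have [l hl] := geometric_limit (fun k => ES k x xr).
  by exists l.
exists E; split => //.
- have E0 : E 0 = 0.
    have := hE 0; rewrite normr0 => /(_ (ltW r'0) 0%N).
    by rewrite !mulr0 mul0r /= sub0r normrN normr_le0 => /eqP.
  split=> // rho x y rr xr yr.
  apply: (@le_geometric _ _ _ (4 * (C * `|x| * `|x|) + 4 * (C * `|y| * `|y|))) => k.
  have h1 := hE x (le_trans xr rr) k; have h2 := hE y (le_trans yr rr) k.
  have h3 := (NE k).2 _ _ _ rr xr yr.
  have -> : E x - E y - 1 *: (x - y) =
     (E_ k x - E_ k y - 1 *: (x - y)) - (E_ k x - E x) + (E_ k y - E y) by rowring.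
  apply: le_trans (ler_normD _ _) _; have := ler_normB (E_ k x - E_ k y - 1 *: (x - y)) (E_ k x - E x).
  by move: h1 h2 h3; lra.
(* This is the limit of the identity [E_ k.+1 (x + x) = s (E_ k x)]. *)
- move=> x xr xxr.
  apply/eqP; rewrite -subr_eq0 -normr_eq0 eq_le normr_ge0 andbT.
  apply: (@le0_geometric _ _ (4 * (C * `|x + x| * `|x + x|) + 3 * (4 * (C * `|x| * `|x|)))) => k.
  have hxx : h (x + x) = x by rewrite /h; rowlin.
  have h1 := hE _ xxr k.+1; rewrite /= hxx in h1.
  have h2 := hE x xr k.
  have xh : `|x + x| = 2 * `|x|.
    by rewrite (_ : x + x = 2 *: x) ?normrZ ?ger0_norm//; rowlin.
  have sm : C * `|x| <= 1 / 8.
    by rewrite xh in xxr; have := ler_wpM2l C0 xxr; lra.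
  have b1 : `|E_ k x| <= r'.
    have := near_linear_le ler01 (NE k) xr (lexx _); rewrite xh in xxr.
    by have := normr_ge0 x; nra.
  have b2 : `|E x| <= r'.
    apply: (@le_geometric _ _ _ (4 * (C * `|x| * `|x|))) => j.
    have := hE x xr j; have := norm_le_sub (E x) (E_ j x); rewrite distrC.
    have := near_linear_le ler01 (NE j) xr (lexx _); rewrite xh in xxr.
    by have := normr_ge0 x; nra.
  have h3 := near_linear_lip (ler0n _ 2) H r'r b1 b2.
  have : `|E (x + x) - s (E x)| <= `|s (E_ k x) - E (x + x)| + `|s (E_ k x) - s (E x)|.
    rewrite (_ : E _ - _ = (s (E_ k x) - s (E x)) - (s (E_ k x) - E (x + x))); last by rowring.
    by rewrite [leRHS]addrC ler_normB.
  have h4 : (2 + C * r') * `|E_ k x - E x| <= 3 * `|E_ k x - E x|.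
    by rewrite ler_wpM2r//; lra.
  have q0 : 0 <= (3 / 4 : R) ^+ k by rewrite exprn_ge0//; lra.
  have cx0 : 0 <= C * `|x + x| * `|x + x| by rewrite !mulr_ge0.
  move: h1; rewrite exprS mulrA => h1.
  have := mulr_ge0 cx0 q0.
  by move: h1 h2 h3 h4; set q := _ ^+ k; lra.
Qed.

End NearIdentity.


(** * Second-order expansion of the multiplication in a chart *)

Section LocalMultiplication.
Variables (R : realType) (n : nat).
Local Notation V := 'rV[R]_n.
Variables (F : V * V -> V) (p0 : V).
Let o : V * V := (p0, p0).
Hypothesis dF : \forall w \near o, differentiable F w.
Hypothesis ddF : forall h : V * V, differentiable (fun w => 'd F w h) o.
Hypothesis F_left : \forall u \near p0, F (u, p0) = u.
Hypothesis F_right : \forall u \near p0, F (p0, u) = u.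

Lemma norm_pair_le (a b : V) (c : R) : (`|(a, b)| <= c) = (`|a| <= c) && (`|b| <= c).
Proof. by rewrite prod_normE/= ge_max. Qed.

Lemma norm_pair_lt (a b : V) (c : R) : (`|(a, b)| < c) = (`|a| < c) && (`|b| < c).
Proof. by rewrite prod_normE/= gt_max. Qed.

Lemma has_diff_unique (U W : normedModType R) (f : U -> W) x (L M : U -> W) :
  (forall (a : R) h, L (a *: h) = a *: L h) -> (forall (a : R) h, M (a *: h) = a *: M h) ->
  has_diff f x L -> has_diff f x M -> L = M.
Proof.
move=> LZ MZ HL HM; apply/funext => h; apply/eqP; rewrite -subr_eq0 -normr_eq0 eq_le normr_ge0 andbT.
apply/ler_addgt0Pl => e e0; rewrite addr0.
have n0 : 0 < `|h| + 1 by rewrite ltr_wpDl.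
have e1 : 0 < e / 2 / (`|h| + 1) by rewrite !divr_gt0.
have [d1 d10 H1] := HL _ e1; have [d2 d20 H2] := HM _ e1.
pose t := Num.min d1 d2 / 2 / (`|h| + 1).
have t0 : 0 < t by rewrite !divr_gt0// lt_min d10.
have tm : t * (`|h| + 1) = Num.min d1 d2 / 2 by rewrite /t divfK// gt_eqF.
have th : `|t *: h| <= t * (`|h| + 1).
  by rewrite normrZ (gtr0_norm t0) ler_pM2l// lerDl.
have m0 : 0 < Num.min d1 d2 by rewrite lt_min d10.
have th1 : `|t *: h| < Num.min d1 d2 by rewrite (le_lt_trans th)// tm; lra.
move: (th1); rewrite lt_min => /andP[/H1 h1 /H2 h2].
rewrite -(ler_pM2l t0) -[X in X * _ <= _](gtr0_norm t0) -normrZ scalerBr -LZ -MZ.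
rewrite (_ : L _ - M _ = (f (x + t *: h) - f x - M (t *: h)) - (f (x + t *: h) - f x - L (t *: h))); last first.
  by rewrite opprB [RHS]addrC addrA subrK.
apply: le_trans (ler_normB _ _) _.
apply: (@le_trans _ _ (2 * (e / 2 / (`|h| + 1) * `|t *: h|))); first lra.
apply: (@le_trans _ _ (2 * (e / 2 / (`|h| + 1) * (t * (`|h| + 1))))).
  by rewrite ler_pM2l// ler_pM2l.
by rewrite le_eqVlt; apply/orP; left; apply/eqP; field; rewrite gt_eqF.
Qed.

Lemma has_diff_partial1 (u w : V) : differentiable F (u, w) ->
  has_diff (fun u => F (u, w)) u (fun h => 'd F (u, w) (h, 0)).
Proof.
move=> /differentiable_has_diff H e /H [d d0 Hd]; exists d => // h hd.
have := Hd (h, 0); rewrite !prod_normE/= normr0 (max_l (normr_ge0 h)) => /(_ hd).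
by rewrite (_ : (u, w) + (h, 0) = (u + h, w))//; apply: injective_projections => /=; rewrite ?addr0.
Qed.

Lemma has_diff_partial2 (u w : V) : differentiable F (u, w) ->
  has_diff (fun w => F (u, w)) w (fun h => 'd F (u, w) (0, h)).
Proof.
move=> /differentiable_has_diff H e /H [d d0 Hd]; exists d => // h hd.
have := Hd (0, h); rewrite !prod_normE/= normr0 (max_r (normr_ge0 h)) => /(_ hd).
by rewrite (_ : (u, w) + (0, h) = (u, w + h))//; apply: injective_projections => /=; rewrite ?addr0.
Qed.

Lemma has_diff_id (x : V) : has_diff id x id.
Proof.
by move=> e e0; exists 1 => // h _; rewrite /= [x + h]addrC addrK subrr normr0 mulr_ge0// ltW.
Qed.

Let pairZl (a : R) (h : V) : (a *: h, 0) = a *: (h, 0) :> V * V.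
Proof. by apply: injective_projections => /=; rewrite ?scaler0. Qed.
Let pairZr (a : R) (h : V) : (0, a *: h) = a *: (0, h) :> V * V.
Proof. by apply: injective_projections => /=; rewrite ?scaler0. Qed.

(** The unit laws [F_left] and [F_right] make both partial derivatives at the unit the identity. *)
Let dF0 : 'd F o = (fun h => h.1 + h.2) :> (V * V -> V).
Proof.
have dFo : differentiable F o by exact: nbhs_singleton dF.
have E1 : (fun h => 'd F o (h, 0)) = id.
  apply: (@has_diff_unique _ _ (fun u => F (u, p0)) p0) => //.
  - by move=> a h; rewrite pairZl; exact: linearZZ.
  - exact: has_diff_partial1.
  - apply: has_diff_near (has_diff_id p0).
    by move: F_left; apply: filterS => u ->.
have E2 : (fun h => 'd F o (0, h)) = id.
  apply: (@has_diff_unique _ _ (fun u => F (p0, u)) p0) => //.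
  - by move=> a h; rewrite pairZr; exact: linearZZ.
  - exact: has_diff_partial2.
  - apply: has_diff_near (has_diff_id p0).
    by move: F_right; apply: filterS => u ->.
apply/funext => -[h k] /=.
rewrite (_ : (h, k) = (h, 0) + (0, k)); last first.
  by apply: injective_projections => /=; rewrite ?addr0 ?add0r.
rewrite linearD; congr (_ + _).
- by move/(congr1 (fun f => f h)): E1.
- by move/(congr1 (fun f => f k)): E2.
Qed.

Lemma mul_strict : exists r C : R, [/\ 0 < r, 0 < C & forall (rho : R) u w u' w',
  rho < r -> `|u| <= rho -> `|w| <= rho -> `|u'| <= rho -> `|w'| <= rho ->
  `|F (p0 + u, p0 + w) - F (p0 + u', p0 + w') - (u - u') - (w - w')| <=
     C * rho * (`|u - u'| + `|w - w'|)].
Proof.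
have [r [C [r0 C0 H]]] := strict_estimate (framed_prod (framed_row R n) (framed_row R n)) dF ddF.
exists r, C; split => // rho u w u' w' rr ur wr ur' wr'.
have rho0 := le_trans (normr_ge0 _) ur.
have sh (a b : V) : (p0 + a, p0 + b) - o = (a, b).
  by apply: injective_projections => /=; rewrite addrAC subrr add0r.
have := H (p0 + u, p0 + w) (p0 + u', p0 + w').
rewrite !sh dF0.
rewrite (_ : (p0 + u, p0 + w) - (p0 + u', p0 + w') = (u - u', w - w')); last first.
  by apply: injective_projections => /=; rowring.
rewrite !norm_pair_lt !(le_lt_trans _ rr)//= => /(_ isT isT).
rewrite opprD addrA => h; apply: le_trans h _.
apply: ler_pM => //.
- by apply: mulr_ge0; [exact: ltW|rewrite le_max normr_ge0].
- by rewrite ler_pM2l// ge_max !norm_pair_le ur wr ur'.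
- by rewrite norm_pair_le lerDl lerDr !normr_ge0.
Qed.

(** The mixed second derivative of the multiplication at the unit; antisymmetrized, it is the Lie
    bracket ([lie_bracketE]). *)
Definition bilin (z w : V) : V := 'd (fun p => 'd F p (0, w)) o (z, 0).

Lemma partial_diff (w : V) :
  has_diff (fun u => 'd F (u, p0) (0, w)) p0 (fun z => bilin z w).
Proof.
move=> e e0; have [d d0 Hd] := differentiable_has_diff (ddF (0, w)) e0.
exists d => // h hd.
have := Hd (h, 0); rewrite !prod_normE/= normr0 (max_l (normr_ge0 h)) => /(_ hd).
by rewrite (_ : o + (h, 0) = (p0 + h, p0))//; apply: injective_projections => /=; rewrite ?addr0.
Qed.

(** By [F_right] the partial derivative in the second variable is constantly w at the points (p0,
    u), so the pure second derivative vanishes. *)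
Let bilin0 (h w : V) : 'd (fun p => 'd F p (0, w)) o (0, h) = 0.
Proof.
have E : (fun h => 'd (fun p => 'd F p (0, w)) o (0, h)) = (fun=> 0).
  apply: (@has_diff_unique _ _ (fun u => 'd F (p0, u) (0, w)) p0) => //.
  - by move=> a k; rewrite pairZr; exact: linearZZ.
  - by move=> a k; rewrite scaler0.
  - move=> e e0; have [d d0 Hd] := differentiable_has_diff (ddF (0, w)) e0.
    exists d => // k kd.
    have := Hd (0, k); rewrite !prod_normE/= normr0 (max_r (normr_ge0 k)) => /(_ kd).
    by rewrite (_ : o + (0, k) = (p0, p0 + k))//; apply: injective_projections => /=; rewrite ?addr0.
  have cst_w : \forall u \near p0, 'd F (p0, u) (0, w) = w.
    have /nearN [r1 r10 H1] := F_right; have /nearN [r2 r20 H2] := dF.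
    apply/nearN; exists (Num.min r1 r2); first by rewrite lt_min r10.
    move=> u; rewrite lt_min => /andP[u1 u2].
    have E : (fun h => 'd F (p0, u) (0, h)) = id.
      apply: (@has_diff_unique _ _ (fun u => F (p0, u)) u) => //.
      - by move=> a k; rewrite pairZr; exact: linearZZ.
      - apply: has_diff_partial2; apply: H2.
        rewrite (_ : (p0, u) - o = (0, u - p0)) ?norm_pair_lt ?normr0 ?r20 ?u2//.
        by apply: injective_projections => /=; rewrite ?subrr.
      - apply: has_diff_near (has_diff_id u).
        apply/nearN; exists (r1 - `|u - p0|); first by rewrite subr_gt0.
        move=> v vu; rewrite H1//.
        by have := norm_le_sub (v - p0) (u - p0); rewrite opprB addrA subrK; lra.
    by move/(congr1 (fun f => f w)): E.
  have wn := nbhs_singleton cst_w.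
  apply: (@has_diff_near _ _ _ (fun=> w)).
    by move: cst_w; apply: filterS => u ->.
  by move=> e e0; exists 1 => // k _; rewrite subrr subr0 normr0 mulr_ge0// ltW.
by move/(congr1 (fun f => f h)): E.
Qed.

Let linear_pair (L : {linear (V * V)%type -> V}) (h k : V) : L (0, k) = 0 -> L (h, k) = L (h, 0).
Proof.
move=> L0; rewrite (_ : (h, k) = (h, 0) + (0, k)) ?linearD ?L0 ?addr0//.
by apply: injective_projections => /=; rewrite ?addr0 ?add0r.
Qed.

Let bilin_pair (h k w : V) : 'd (fun p => 'd F p (0, w)) o (h, k) = bilin h w.
Proof. exact: (@linear_pair ('d (fun p => 'd F p (0, w)) o) h k (bilin0 k w)). Qed.

Let bilinZ (a : R) (h w : V) : bilin (a *: h) w = a *: bilin h w.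
Proof.
have lZ (L : {linear (V * V)%type -> V}) : L (a *: h, 0) = a *: L (h, 0).
  by rewrite pairZl; exact: linearZZ.
exact: (lZ ('d (fun p => 'd F p (0, w)) o)).
Qed.

Let dF_near (w : V) (e : R) : 0 < e -> exists2 d : R, 0 < d & forall h k : V,
  `|(h, k)| < d -> `|'d F (p0 + h, p0 + k) (0, w) - w - bilin h w| <= e * `|(h, k)|.
Proof.
move=> e0; have [d d0 Hd] := differentiable_has_diff (ddF (0, w)) e0.
exists d => // h k hk.
have E : 'd F o (0, w) = w by rewrite dF0 /= add0r.
have Ed : 'd F (p0 + h, p0 + k) (0, w) - w - bilin h w =
    'd F (o + (h, k)) (0, w) - 'd F o (0, w) - 'd (fun p => 'd F p (0, w)) o (h, k).
  by congr (_ - _ - _); [exact: esym E|exact: esym (bilin_pair _ _ _)].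
rewrite Ed; exact: Hd.
Qed.

(* Only the mixed second derivative contributes to the second order, since F
   restricts to the identity on both axes. *)
Lemma mul_taylor (z w : V) (e : R) : 0 < e -> exists2 d : R, 0 < d &
  forall h : R, `|h| < d ->
   `|F (p0 + h *: z, p0 + h *: w) - p0 - h *: z - h *: w - (h * h) *: bilin z w| <= e * (h * h).
Proof.
move=> e0.
pose m := `|z| + `|w| + 1.
have m0 : 0 < m by rewrite ltr_wpDl// addr_ge0.
have em : 0 < e / m by rewrite divr_gt0.
have [d1 d10 H1] := dF_near w em.
have /nearN [d2 d20 H2] := dF.
have /nearN [d3 d30 H3] := F_left.
pose d := Num.min d1 (Num.min d2 d3) / m.
exists d; first by rewrite divr_gt0// !lt_min d10 d20.
move=> h; rewrite ltr_pdivlMr// !lt_min => /and3P[hd1 hd2 hd3].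
have zm : `|h *: z| <= `|h| * m.
  by rewrite normrZ ler_wpM2l// /m; have := normr_ge0 w; lra.
have wm (t : R) : 0 <= t <= 1 -> `|t *: (h *: w)| <= `|h| * m.
  move=> /andP[t0 t1]; rewrite !normrZ (ger0_norm t0) mulrCA ler_wpM2l//.
  by rewrite (le_trans (ler_piMl _ t1))// /m; have := normr_ge0 z; lra.
(* Only the second factor moves, from p0 to p0 + h w; the starting value F (p0 + h z, p0) is known
   exactly from [F_left]. *)
pose q (t : R) : V * V := (p0 + h *: z, p0 + t *: (h *: w)).
have qo t : q t - o = (h *: z, t *: (h *: w)).
  by apply: injective_projections => /=; rewrite addrAC subrr add0r.
pose g (t : R) := F (q t) - t *: (h *: w) - t *: ((h * h) *: bilin z w).
have g0 : g 0 = p0 + h *: z.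
  rewrite /g /q !scale0r !subr0 addr0 H3//.
  by rewrite addrAC subrr add0r (le_lt_trans zm).
have g1 : g 1 = F (p0 + h *: z, p0 + h *: w) - h *: w - (h * h) *: bilin z w.
  by rewrite /g /q !scale1r.
rewrite (_ : _ - _ = g 1 - g 0); last by rewrite g0 g1; rowring.
pose v t := 'd F (q t) (0, h *: w) - h *: w - (h * h) *: bilin z w.
apply: (@mean_value_ineq _ _ g v).
- move=> t t01.
  have dq : differentiable F (q t).
    by apply: H2; rewrite qo norm_pair_lt !(le_lt_trans _ hd2) ?wm.
  have Hp := has_diff_partial2 dq.
  have Ht : has_diff (fun t : R => p0 + t *: (h *: w)) t (fun s => s *: (h *: w)).
    move=> ee ee0; exists 1 => // s _.
    have -> : p0 + (t + s) *: (h *: w) - (p0 + t *: (h *: w)) - s *: (h *: w) = 0.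
      by rowring.
    by rewrite normr0 mulr_ge0// ltW.
  have [K K0 HK] := framed_bounded ('d F (q t)) (framed_prod (framed_row R n) (framed_row R n)).
  have := @has_diff_comp _ _ _ _ (fun w => F (p0 + h *: z, w)) (fun t : R => p0 + t *: (h *: w)) t
     (fun h => 'd F (q t) (0, h)) (fun s => s *: (h *: w)) K (`|h *: w|) Hp Ht.
  move=> Hc ee ee0.
  have [a b|s|dd dd0 Hdd] := Hc _ _ ee ee0.
  - rewrite -linearB (_ : (0, a) - (0, b) = (0, a - b)); last first.
      by apply: injective_projections => /=; rewrite ?subrr.
    by rewrite (le_trans (HK _))// ler_pM2l// norm_pair_le normr0 normr_ge0 lexx.
  - by rewrite normrZ mulrC.
  exists dd => // s sdd.
  have lin : 'd F (q t) (0, s *: (h *: w)) = s *: 'd F (q t) (0, h *: w).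
    by rewrite pairZr; exact: linearZZ.
  have h1 : `|F (q (t + s)) - F (q t) - s *: 'd F (q t) (0, h *: w)| <= ee * `|s|.
    by rewrite -lin; exact: Hdd.
  apply: le_trans h1; rewrite le_eqVlt; apply/orP; left; apply/eqP; congr `|_|.
  by rewrite /g /v; rowring.
- move=> t t01.
  (* One factor h comes from the direction h w, the other from the displacement (h z, t h w) of the
     base point. *)
  have -> : v t = h *: ('d F (q t) (0, w) - w - h *: bilin z w).
    rewrite /v pairZr (_ : 'd F (q t) (h *: (0, w)) = h *: 'd F (q t) (0, w)).
      by rewrite !scalerBr scalerA.
    exact: linearZZ.
  rewrite normrZ.
  have nm : `|(h *: z, t *: (h *: w))| <= `|h| * m.
    by rewrite norm_pair_le zm wm.
  have := H1 _ _ (le_lt_trans nm hd1); rewrite bilinZ => h1.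
  have -> : e * (h * h) = `|h| * (e * `|h|).
    by rewrite [RHS]mulrCA -normrM ger0_norm// -expr2 sqr_ge0.
  rewrite ler_wpM2l//; apply: le_trans h1 _.
  apply: le_trans (ler_wpM2l (ltW em) nm) _.
  by rewrite [`|h| * m]mulrC mulrA divfK// gt_eqF.
Qed.

End LocalMultiplication.

(** * Logarithmic coordinates *)

Section LocalGroup.
Variables (R : realType) (n : nat) (G : lieGroupType R n).
Local Notation V := 'rV[R]_n.
Local Notation c1 := (chart1 G).
Local Notation p0 := (chart1 G 1%g).

Definition chart_psi (u : V) : G := chart_inv c1 (p0 + u).
Definition chart_phi (g : G) : V := c1 g - p0.
Definition chart_mul (w : V * V) : V := c1 (chart_inv c1 w.1 * chart_inv c1 w.2)%g.

Lemma chart1_dom1 : chart_dom c1 1%g. Proof. exact: chart_at_dom. Qed.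

Lemma chart_invK (v : V) : chart_cod c1 v -> c1 (chart_inv c1 v) = v.
Proof. by move=> [p dp <-]; rewrite chart_funK. Qed.

Lemma chart_inv_dom (v : V) : chart_cod c1 v -> chart_dom c1 (chart_inv c1 v).
Proof. by move=> [p dp <-]; rewrite chart_funK. Qed.

Lemma chart_inv1 : chart_inv c1 p0 = 1%g.
Proof. by rewrite chart_funK//; exact: chart1_dom1. Qed.

Lemma chart_cod1 : \forall u \near p0, chart_cod c1 u.
Proof.
apply: open_nbhs_nbhs; split; first exact: chart_cod_open.
by exists 1%g => //; exact: chart1_dom1.
Qed.

Lemma chart_inv_cvg1 : chart_inv c1 u @[u --> p0] --> (1%g : G).
Proof.
rewrite -[X in _ --> X]chart_inv1; apply: chart_inv_continuous.
by exists 1%g => //; exact: chart1_dom1.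
Qed.

Definition mul_dom : set (V * V) :=
  [set w | [/\ chart_cod c1 w.1, chart_cod c1 w.2 &
     chart_dom c1 (chart_inv c1 w.1 * chart_inv c1 w.2)%g]].

Lemma mul_dom_near : \forall w \near (p0, p0), mul_dom w.
Proof.
have nd : nbhs ((1 : G) * 1)%g (chart_dom c1).
  rewrite mulg1; apply: open_nbhs_nbhs; split; first exact: chart_dom_open.
  exact: chart1_dom1.
have [[A B] /= [nA nB] AB] := @lie_mul_continuous _ _ G (1%g, 1%g) _ nd.
have hA : \forall u \near p0, A (chart_inv c1 u) by exact: chart_inv_cvg1.
have hB : \forall u \near p0, B (chart_inv c1 u) by exact: chart_inv_cvg1.
exists ([set u | A (chart_inv c1 u) /\ chart_cod c1 u], [set u | B (chart_inv c1 u) /\ chart_cod c1 u]).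
  by split; apply: filterI => //; exact: chart_cod1.
move=> [u w] /= [[Au cu] [Bw cw]]; split => //.
by apply: (AB (chart_inv c1 u, chart_inv c1 w)).
Qed.

Lemma chart_mul_smooth : smooth_on mul_dom chart_mul.
Proof. by have := lie_mul_smooth (1%g : G) 1%g; rewrite /= mulg1. Qed.

Lemma chart_mul_diff w : mul_dom w -> differentiable chart_mul w.
Proof. by have [H _] := chart_mul_smooth 1; exact: H. Qed.

Lemma chart_mul_diff2 h w : mul_dom w -> differentiable (fun w => 'd chart_mul w h) w.
Proof. by have [_ H] := chart_mul_smooth 2; have [H' _] := H h; exact: H'. Qed.

Lemma chart_mul_left : \forall u \near p0, chart_mul (u, p0) = u.
Proof.
by move: chart_cod1; apply: filterS => u cu; rewrite /chart_mul /= chart_inv1 mulg1 chart_invK.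
Qed.

Lemma chart_mul_right : \forall u \near p0, chart_mul (p0, u) = u.
Proof.
by move: chart_cod1; apply: filterS => u cu; rewrite /chart_mul /= chart_inv1 mul1g chart_invK.
Qed.

Lemma local_group : exists r C : R, [/\ 0 < r, 0 < C,
  (forall u, `|u| <= r -> chart_cod c1 (p0 + u)),
  (forall u w, `|u| <= r -> `|w| <= r -> mul_dom (p0 + u, p0 + w)) &
  forall rho u w u' w',
    rho <= r -> `|u| <= rho -> `|w| <= rho -> `|u'| <= rho -> `|w'| <= rho ->
  `|chart_phi (chart_psi u * chart_psi w)%g - chart_phi (chart_psi u' * chart_psi w')%g
     - (u - u') - (w - w')| <= C * rho * (`|u - u'| + `|w - w'|)].
Proof.
have dF : \forall w \near (p0, p0), differentiable chart_mul w.
  by move: mul_dom_near; apply: filterS; exact: chart_mul_diff.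
have ddF h : differentiable (fun w => 'd chart_mul w h) (p0, p0).
  by apply: chart_mul_diff2; exact: nbhs_singleton mul_dom_near.
have [r1 [C [r10 C0 H]]] := mul_strict dF ddF chart_mul_left chart_mul_right.
have /nearN [r2 r20 H2] := chart_cod1.
have /nearN [r3 r30 H3] := mul_dom_near.
pose m := Num.min r1 (Num.min r2 r3).
have [m1 m2 m3] : [/\ m <= r1, m <= r2 & m <= r3] by rewrite !ge_min !lexx !orbT.
have m0 : 0 < m by rewrite !lt_min r10 r20.
exists (m / 2), C; split => //; first lra.
- by move=> u ur; apply: H2; rewrite addrAC subrr add0r; lra.
- move=> u w ur wr; apply: H3.
  rewrite (_ : _ - _ = (u, w)); last by apply: injective_projections => /=; rowring.
  by rewrite norm_pair_lt; apply/andP; split; lra.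
move=> rho u w u' w' rr ur wr ur' wr'.
have := H rho u w u' w'; rewrite /chart_mul /= -/(chart_psi _) -/(chart_psi _).
rewrite -/(chart_psi u') -/(chart_psi w') => h.
rewrite /chart_phi opprB addrA subrK; apply: h => //; lra.
Qed.

(* Doubling is the only group law imposed on ex: it is the linearization of the
   squaring map, and being a homomorphism on lines follows from it. *)
Record local_log (ex : V -> G) (Log : G -> V) (r C : R) : Prop := LocalLog {
  log_r_gt0 : 0 < r;
  log_C_gt0 : 0 < C;
  ex0 : ex 0 = 1%g;
  exK : forall x, `|x| <= r -> Log (ex x) = x;
  ex_double : forall x, `|x| <= r -> ex (x + x) = (ex x * ex x)%g;
  log_mulK : forall a b, `|a| <= r -> `|b| <= r ->
    ex (Log (ex a * ex b)%g) = (ex a * ex b)%g;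
  log_strict : forall rho a b a' b',
    rho <= r -> `|a| <= rho -> `|b| <= rho -> `|a'| <= rho -> `|b'| <= rho ->
    `|Log (ex a * ex b)%g - Log (ex a' * ex b')%g - (a - a') - (b - b')| <=
       C * rho * (`|a - a'| + `|b - b'|);
  log_near : forall e : R, 0 < e -> \forall g \near (1%g : G), `|Log g| < e /\ ex (Log g) = g;
  ex_dom : forall x, `|x| <= r -> chart_dom c1 (ex x);
  ex_chart : near_linear 1 C r (chart_phi \o ex) }.

(** Carries the strict estimate for the product from the chart to the coordinates. Here a, b, X
    stand for differences in the coordinates, A, B, e for the corresponding differences in the
    chart, and k for [C1 * rho]. The losses 8 k and 4 times 64 k add up to 264 k. *)
Lemma strict_transport (A B a b e X : V) (k : R) : 0 <= k -> k <= 1 / 256 ->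
  `|e - A - B| <= 2 * k * (`|A| + `|B|) ->
  `|A - a| <= 4 * k * `|a| -> `|B - b| <= 4 * k * `|b| ->
  `|e - X| <= 64 * k * `|X| ->
  `|A| <= 2 * `|a| -> `|B| <= 2 * `|b| -> `|X| <= 2 * `|e| ->
  `|X - a - b| <= 300 * k * (`|a| + `|b|).
Proof.
move=> k0 k1 h1 h2 h3 h4 h5 h6 h7.
have na := normr_ge0 a; have nb := normr_ge0 b.
have j1 : k * (`|A| + `|B|) <= k * (2 * `|a| + 2 * `|b|) by rewrite ler_wpM2l// lerD.
have k2 : `|e - a - b| <= 8 * k * (`|a| + `|b|).
  rewrite (_ : _ - _ - _ = (e - A - B) + (A - a) + (B - b)); last by rowring.
  apply: le_trans (ler_normD _ _) _.
  have := ler_normD (e - A - B) (A - a); lra.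
have k3 : `|e| <= 2 * (`|a| + `|b|).
  have := norm_le_sub e (a + b); rewrite opprD addrA; have := ler_normD a b.
  have : k * (`|a| + `|b|) <= 1 / 256 * (`|a| + `|b|) by rewrite ler_wpM2r// addr_ge0.
  lra.
rewrite (_ : _ - _ - _ = (e - a - b) - (e - X)); last by rowring.
apply: le_trans (ler_normB _ _) _.
have : k * `|X| <= k * (4 * (`|a| + `|b|)) by rewrite ler_wpM2l//; lra.
by have := mulr_ge0 k0 (addr_ge0 na nb); lra.
Qed.

Lemma exists_local_log : exists ex Log r C, local_log ex Log r C.
Proof.
have [r1 [C1 [r10 C10 Hcod Hdom Hm]]] := local_group.
pose m u w := chart_phi (chart_psi u * chart_psi w)%g.
have psi0 : chart_psi 0 = 1%g by rewrite /chart_psi addr0 chart_inv1.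
have phi1 : chart_phi 1%g = 0 by rewrite /chart_phi subrr.
have phiK u : `|u| <= r1 -> chart_phi (chart_psi u) = u.
  by move=> ur; rewrite /chart_phi /chart_psi (chart_invK (Hcod _ ur)) addrAC subrr add0r.
have psiK g : chart_dom c1 g -> chart_psi (chart_phi g) = g.
  by move=> dg; rewrite /chart_psi /chart_phi addrC subrK chart_funK.
have mK u w : `|u| <= r1 -> `|w| <= r1 -> chart_psi (m u w) = (chart_psi u * chart_psi w)%g.
  by move=> ur wr; have [_ _ dm] := Hdom _ _ ur wr; rewrite psiK.
have m0 : m 0 0 = 0 by rewrite /m psi0 mulg1 phi1.
(* The squaring map has derivative 2 at the unit, so [koenigs] yields an E that intertwines doubling
   of vectors with squaring in the group. *)
have ns : near_linear 2 (2 * C1) r1 (fun u => m u u).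
  split => // rho x y rr xr yr; have := Hm rho x x y y rr xr xr yr yr.
  rewrite -/(m x x) -/(m y y).
  rewrite (_ : _ - _ - _ = m x x - m y y - 2 *: (x - y)); last by rowlin.
  by move=> h; apply: le_trans h _; lra.
have [r2 r20 [E [r21 nE Edbl]]] := koenigs r10 (mulr_ge0 (ler0n _ 2) (ltW C10)) ns.
have [r3 [r30 r32 Cr3]] : exists r3 : R, [/\ 0 < r3, r3 <= r2 & 8 * (C1 * r3) <= 1].
  have c81 : 0 < 8 * C1 + 1 by lra.
  pose r3 := Num.min r2 (1 / (8 * C1 + 1)).
  have r30 : 0 < r3 by rewrite lt_min r20 divr_gt0.
  exists r3; split => //; first by rewrite ge_min lexx.
  have : r3 * (8 * C1 + 1) <= 1 by rewrite -ler_pdivlMr// ge_min lexx orbT.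
  by move: (ltW r30); lra.
have nE3 : near_linear 1 (4 * C1) r3 E.
  split; first exact: nE.1.
  move=> rho x y rr xr yr; have := nE.2 rho x y (le_trans rr r32) xr yr.
  by rewrite (mulrA 2) -natrM.
have Cr4 : 4 * C1 * r3 <= 1 / 2 by lra.
have C40 : 0 <= 4 * C1 by lra.
(* An inverse of E is chosen pointwise on the ball of radius r3 / 2, with default value 0
   elsewhere. *)
have /choice [Linv HL] : forall y, exists x, `|y| <= r3 / 2 ->
    [/\ `|x| <= 2 * `|y|, `|x| <= r3 & E x = y].
  move=> y; have [yr|yr] := leP `|y| (r3 / 2); last by exists 0.
  by have [x Hx] := near_id_inverse r30 C40 Cr4 nE3 yr; exists x.
have Elip x y : `|x| <= r3 -> `|y| <= r3 -> `|E x - E y| <= 2 * `|x - y|.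
  move=> xr yr; have := near_linear_lip ler01 nE3 (lexx _) xr yr.
  by move=> h; apply: le_trans h _; rewrite ler_wpM2r//; lra.
have Ele x : `|x| <= r3 -> `|E x| <= 2 * `|x|.
  move=> xr; have := Elip x 0 xr; rewrite normr0 nE3.1 !subr0; apply.
  exact: ltW.
have Einj x y : `|x| <= r3 -> `|y| <= r3 -> `|x - y| <= 2 * `|E x - E y|.
  exact: near_id_inj Cr4 nE3.
have LE x : `|x| <= r3 / 4 -> Linv (E x) = x.
  move=> xr; have xr3 : `|x| <= r3 by lra.
  have [|_ h2 h3] := HL (E x); first by have := Ele x xr3; lra.
  apply/eqP; rewrite -subr_eq0 -normr_eq0 eq_le normr_ge0 andbT.
  by rewrite (le_trans (Einj _ _ h2 xr3))// h3 subrr normr0 mulr0.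
(* The factor 32 leaves room for a product: two vectors of norm at most rho give a product of norm
   at most 8 rho in the chart and a logarithm of norm at most 16 rho. *)
have [r [rr3 r0 C1r]] : exists r : R, [/\ 32 * r = r3, 0 < r & 256 * (C1 * r) <= 1].
  by exists (r3 / 32); split; lra.
have N16 rho : rho <= r -> 16 * rho <= r3 by lra.
have N1 rho : rho <= r -> rho <= r3 by lra.
have N4 rho : rho <= r -> rho <= r3 / 4 by lra.
have Nxx x : `|x| <= r -> `|x + x| <= r2 by have := ler_normD x x; lra.
have N12 rho : rho <= r -> rho <= r2 by lra.
have C300 : 0 < 300 * C1 by lra.
have C4300 : 4 * C1 <= 300 * C1 by lra.
have N2 rho : rho <= r -> 2 * rho <= r1 by lra.
have Crho rho : rho <= r -> C1 * rho <= 1 / 256.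
  by move=> rr; have := ler_wpM2l (ltW C10) rr; lra.
have E2' rho x : rho <= r -> `|x| <= rho -> `|E x| <= 2 * rho.
  move=> rr xr; apply: le_trans (Ele _ (le_trans xr (N1 _ rr))) _.
  by rewrite ler_pM2l.
have N8 rho : rho <= r -> 8 * rho <= r3 / 2 by lra.
have Cr2 rho : rho <= r -> C1 * (2 * rho) <= 1 by move=> /Crho; lra.
pose ex x := chart_psi (E x); pose Log g := Linv (chart_phi g).
have mle rho a b : rho <= r -> `|a| <= rho -> `|b| <= rho -> `|m (E a) (E b)| <= 8 * rho.
  move=> rr ar br.
  have Ea := E2' _ _ rr ar.
  have Eb := E2' _ _ rr br.
  have rho0 := le_trans (normr_ge0 _) ar.
  have z0 : `|0 : V| <= 2 * rho by rewrite normr0; lra.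
  have := Hm (2 * rho) _ _ _ _ (N2 _ rr) Ea Eb z0 z0.
  rewrite -/(m _ _) -/(m 0 0) m0 !subr0 => h.
  have := norm_le_sub (m (E a) (E b)) (E a + E b); rewrite opprD addrA => h1.
  have h2 := ler_normD (E a) (E b).
  have : C1 * (2 * rho) * (`|E a| + `|E b|) <= 1 * (4 * rho).
    apply: ler_pM; [|exact: addr_ge0|exact: Cr2|].
      by rewrite !mulr_ge0// ltW.
    by rewrite (_ : 4 * rho = 2 * rho + 2 * rho) ?lerD// -mulrDl -natrD.
  by lra.
have Mprop rho a b : rho <= r -> `|a| <= rho -> `|b| <= rho ->
    `|Log (ex a * ex b)%g| <= 16 * rho /\ E (Log (ex a * ex b)%g) = m (E a) (E b).
  move=> rr ar br; have h := mle _ _ _ rr ar br.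
  have [|h1 h2 h3] := HL (m (E a) (E b)); first exact: le_trans h (N8 _ rr).
  split => //; rewrite /Log /ex -/(m _ _) (le_trans h1)//.
  apply: (@le_trans _ _ (2 * (8 * rho))); first by rewrite ler_pM2l.
  by rewrite mulrA -natrM.
have Er x : `|x| <= r -> `|E x| <= r1.
  by move=> xr; apply: le_trans (E2' _ _ (lexx r) xr) (N2 _ (lexx r)).
exists ex, Log, r, (300 * C1); split => //.
- by rewrite /ex nE.1 psi0.
- by move=> x xr; rewrite /Log /ex phiK ?Er// LE// N4.
- move=> x xr; rewrite /ex Edbl; [|exact: N12|exact: Nxx].
  exact: mK (Er _ xr) (Er _ xr).
- move=> a b ar br; have [_ h] := Mprop r a b (lexx r) ar br.
  by rewrite {1}/ex h mK ?Er.
- move=> rho a b a' b' rr ar br ar' br'.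
  have rho0 := le_trans (normr_ge0 _) ar.
  have [X1 X2] := Mprop _ _ _ rr ar br.
  have [X1' X2'] := Mprop _ _ _ rr ar' br'.
  have ar3 := le_trans ar (N1 _ rr); have br3 := le_trans br (N1 _ rr).
  have ar3' := le_trans ar' (N1 _ rr); have br3' := le_trans br' (N1 _ rr).
  have E2 x : `|x| <= rho -> `|x| <= r3 -> `|E x| <= 2 * rho.
    by move=> x1 x2; apply: le_trans (Ele _ x2) _; rewrite ler_pM2l.
  rewrite -(mulrA 300 C1 rho).
  have X3 := le_trans X1 (N16 _ rr); have X3' := le_trans X1' (N16 _ rr).
  have h1 := Hm (2 * rho) _ _ _ _ (N2 _ rr) (E2 _ ar ar3) (E2 _ br br3) (E2 _ ar' ar3') (E2 _ br' br3').
  have h2 := nE3.2 rho a a' (N1 _ rr) ar ar'.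
  have h3 := nE3.2 rho b b' (N1 _ rr) br br'.
  have h4 := nE3.2 (16 * rho) _ _ (N16 _ rr) X1 X1'.
  have h5 := Elip _ _ ar3 ar3'; have h6 := Elip _ _ br3 br3'.
  have h7 := Einj _ _ X3 X3'.
  have Cr := Crho _ rr.
  have Cr0 : 0 <= C1 * rho by rewrite mulr_ge0// ltW.
  rewrite !scale1r in h2 h3 h4; rewrite X2 X2' in h4 h7.
  apply: (strict_transport Cr0 Cr _ _ _ _ h5 h6 h7).
  - by rewrite (mulrCA 2 C1 rho).
  - by rewrite mulrA.
  - by rewrite mulrA.
  - by apply: le_trans h4 _; rewrite -(mulrA 4) (mulrCA C1 16) (mulrA 4) -natrM.
- move=> e e0.
  have nd : \forall g \near (1%g : G), chart_dom c1 g.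
    apply: open_nbhs_nbhs; split; [exact: chart_dom_open|exact: chart1_dom1].
  pose e' := Num.min (e / 2) (r3 / 2).
  have e'0 : 0 < e' by rewrite lt_min !divr_gt0.
  have ne : \forall g \near (1%g : G), `|c1 g - p0| < e'.
    have := chart_continuous chart1_dom1.
    move=> /cvgrPdist_lt /(_ _ e'0); apply: filterS => g /=.
    by rewrite distrC.
  move: nd ne; apply: filterS2 => g dg; rewrite -/(chart_phi g) lt_min => /andP[g1 g2].
  have [|h1 h2 h3] := HL (chart_phi g); first exact: ltW.
  split; last by rewrite /ex /Log h3 psiK.
  by rewrite /Log (le_lt_trans h1)// mulrC -ltr_pdivlMr.
- move=> x xr; rewrite /ex /chart_psi; apply: chart_inv_dom; apply: Hcod; exact: Er.
- split; first by rewrite /= /ex nE.1 psi0 phi1.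
  move=> rho x y rr xr yr; rewrite /= /ex !phiK; last 2 first.
  - by apply: Er; exact: le_trans yr rr.
  - by apply: Er; exact: le_trans xr rr.
  apply: le_trans (nE3.2 rho x y (N1 _ rr) xr yr) _.
  rewrite ler_wpM2r// ler_wpM2r//.
  exact: le_trans (normr_ge0 _) xr.
Qed.

End LocalGroup.


Section DiffLinear.
Variables (R : realType) (U W : normedModType R).

Lemma has_diff_linear (f : U -> W) x (L : U -> W) (K : R) : linear L ->
  (forall h, `|L h| <= K * `|h|) -> has_diff f x L ->
  differentiable f x /\ 'd f x = L :> (U -> W).
Proof.
move=> lL bL; pose L' : {linear U -> W} := HB.pack L (GRing.isLinear.Build _ _ _ _ L lL).
apply: (@has_diff_differentiable _ _ _ f x L').
move=> y; apply/continuousN => e e0; exists (e / (`|K| + 1)).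
  by rewrite divr_gt0// ltr_wpDl.
move=> z; rewrite ltr_pdivlMr ?ltr_wpDl// => zy.
rewrite -linearB (le_lt_trans (bL _))// (le_lt_trans _ zy)// [leRHS]mulrC.
by rewrite ler_wpM2r// (le_trans (ler_norm _))// lerDl.
Qed.

End DiffLinear.

(** * The doubling argument *)

Section Doubling.
Variable R : realType.

(** Unfold f s as 2 f (s / 2) plus an error. Since the exponent is at least 2, halving divides the
    bound by at least 4 while the number of terms doubles, so K / 4 + 2 K / 4 <= K and the same K
    persists. The unfolding stops in the range where f s <= e s holds, and e is arbitrary. *)
Lemma halving_bound (W : normedModType R) (f : R -> W) (s0 K : R) (k : nat) : 0 <= K ->
  (forall s, 0 < s -> s <= s0 / 2 -> `|f (s + s) - f s - f s| <= K * s ^+ k.+2) ->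
  (forall e, 0 < e -> exists2 d, 0 < d & forall s, 0 < s -> s < d -> `|f s| <= e * s) ->
  forall s, 0 < s -> s <= s0 -> `|f s| <= K * s ^+ k.+2.
Proof.
move=> K0 H small s s_gt0 ss0.
apply/ler_addgt0Pr => e0 e00; have e_gt0 : 0 < e0 / s by rewrite divr_gt0.
have -> : e0 = e0 / s * s by rewrite divfK// gt_eqF.
move: (e0 / s) e_gt0 => e e_gt0 {e0 e00}.
have [d d0 Hd] := small e e_gt0.
have main j : forall s, 0 < s -> s <= s0 -> s < 2 ^+ j * d ->
    `|f s| <= K * s ^+ k.+2 + e * s.
  elim: j => [|j IH] t t0 ts td.
    rewrite expr0 mul1r in td; apply: le_trans (Hd t t0 td) _.
    by rewrite lerDr mulr_ge0// exprn_ge0// ltW.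
  have t20 : 0 < t / 2 by lra.
  have t2s : t / 2 <= s0 by lra.
  have h1 : `|f (t / 2)| <= K * (t / 2) ^+ k.+2 + e * (t / 2).
    by apply: IH => //; rewrite ltr_pdivrMr// mulrAC -exprSr.
  have h2 : `|f t - f (t / 2) - f (t / 2)| <= K * (t / 2) ^+ k.+2.
    have := H (t / 2) t20; rewrite -splitr; apply; lra.
  have h3 : `|f t| <= K * (t / 2) ^+ k.+2 + 2 * `|f (t / 2)|.
    rewrite -[f t in leLHS](subrK (f (t / 2) + f (t / 2))).
    apply: le_trans (ler_normD _ _) _; rewrite opprD addrA lerD//.
    by apply: le_trans (ler_normD _ _) _; rewrite mulrDl mul1r.
  have h4 : (t / 2) ^+ k.+2 <= t ^+ k.+2 / 4.
    rewrite exprMn ler_pM2l ?exprn_gt0// exprS exprS mulrA.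
    rewrite (_ : 2^-1 * 2^-1 = 4^-1 :> R); last by rewrite -invfM -natrM.
    by rewrite ger_pMr ?invr_gt0// exprn_ile1// ?invr_ge0// invf_le1// ler1n.
  have h5 := ler_wpM2l K0 h4.
  have : 0 <= K * t ^+ k.+2 by rewrite mulr_ge0// exprn_ge0// ltW.
  lra.
have [j hj] : exists j : nat, s < 2 ^+ j * d.
  exists (Num.truncn (s / d)).+1; rewrite -ltr_pdivrMr//.
  apply: lt_le_trans (truncnS_gt _) _.
  by rewrite -natrX ler_nat; exact/ltnW/ltn_expl.
exact: main hj.
Qed.

(** The case K = 0 of [halving_bound]: a function that doubles exactly is determined by its
    derivative at 0+. *)
Lemma doubling_linear (W : normedModType R) (f : R -> W) (s0 : R) (w : W) :
  (forall s, 0 < s -> s <= s0 / 2 -> f (s + s) = f s + f s) ->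
  (forall e, 0 < e -> exists2 d, 0 < d & forall s, 0 < s -> s < d -> `|f s - s *: w| <= e * s) ->
  forall s, 0 < s -> s <= s0 -> f s = s *: w.
Proof.
move=> H small s s_gt0 ss0; apply/eqP; rewrite -subr_eq0 -normr_eq0 eq_le normr_ge0 andbT.
rewrite -[leRHS](mul0r (s ^+ 2)).
apply: (@halving_bound W (fun s => f s - s *: w) s0 0 0 (lexx 0)) => // t t0 ts.
by rewrite H// scalerDl mul0r opprD addrACA addrK subrr normr0.
Qed.

End Doubling.

Section LogCalculus.
Variables (R : realType) (n : nat) (G : lieGroupType R n).
Local Notation V := 'rV[R]_n.
Local Notation c1 := (chart1 G).
Local Notation p0 := (chart1 G 1%g).
Variables (ex : V -> G) (Log : G -> V) (r C : R).
Hypothesis L : local_log ex Log r C.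

Lemma local_log_shrink r' : 0 < r' -> r' <= r -> local_log ex Log r' C.
Proof.
move=> r'0 rr; case: L => r0 C0 e0 eK ed lm ls ln edom ec.
split => //.
- by move=> x xr; apply: eK; exact: le_trans rr.
- by move=> x xr; apply: ed; exact: le_trans rr.
- by move=> a b ar br; apply: lm; exact: le_trans rr.
- by move=> rho a b a' b' rr'; apply: ls; exact: le_trans rr.
- by move=> x xr; apply: edom; exact: le_trans rr.
- split; [exact: ec.1|move=> rho x y rr'; apply: ec.2; exact: le_trans rr].
Qed.

Hypothesis Cr : C * r <= 1 / 16.
Local Notation M a b := (Log (ex a * ex b)%g).

Let r_gt0 : 0 < r := log_r_gt0 L.
Let C_gt0 : 0 < C := log_C_gt0 L.

Lemma C_small rho : rho <= r -> C * rho <= 1 / 16.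
Proof. by move=> rr; apply: le_trans Cr; rewrite ler_pM2l. Qed.

Lemma log1 : Log 1%g = 0.
Proof. by rewrite -(ex0 L) (exK L)// normr0 ltW. Qed.

Lemma log_mul0 a : `|a| <= r -> M a 0 = a.
Proof. by move=> ar; rewrite (ex0 L) mulg1 (exK L). Qed.

Lemma ex_inj a b : `|a| <= r -> `|b| <= r -> ex a = ex b -> a = b.
Proof. by move=> ar br h; rewrite -(exK L ar) h (exK L). Qed.

Lemma log_mul_sub rho a b : rho <= r -> `|a| <= rho -> `|b| <= rho ->
  `|M a b - a - b| <= C * rho * `|b|.
Proof.
move=> rr ar br; have rho0 := le_trans (normr_ge0 _) ar.
have z0 : `|0 : V| <= rho by rewrite normr0.
have := log_strict L rr ar br ar z0; rewrite log_mul0; last exact: le_trans rr.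
by rewrite !subr0 !subrr normr0 add0r subr0.
Qed.

Lemma log_mul_lip rho a b a' b' :
  rho <= r -> `|a| <= rho -> `|b| <= rho -> `|a'| <= rho -> `|b'| <= rho ->
  `|M a b - M a' b'| <= 2 * (`|a - a'| + `|b - b'|).
Proof.
move=> rr ar br ar' br'; have := log_strict L rr ar br ar' br'.
have h1 := C_small rr.
have s0 : 0 <= `|a - a'| + `|b - b'| by rewrite addr_ge0.
have h2 := ler_wpM2r s0 h1.
have := norm_le_sub (M a b - M a' b') ((a - a') + (b - b')).
have := ler_normD (a - a') (b - b').
rewrite (_ : M a b - M a' b' - (a - a' + (b - b')) = M a b - M a' b' - (a - a') - (b - b')); last by rewrite opprD addrA.
lra.
Qed.

Lemma log_mul_le rho a b : rho <= r -> `|a| <= rho -> `|b| <= rho ->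
  `|M a b| <= 2 * (`|a| + `|b|).
Proof.
move=> rr ar br; have rho0 := le_trans (normr_ge0 _) ar.
have z0 : `|0 : V| <= rho by rewrite normr0.
have := log_mul_lip rr ar br z0 z0; rewrite log_mul0 ?subr0//.
exact: le_trans rr.
Qed.

Lemma ex_psi x : `|x| <= r -> ex x = chart_psi G (chart_phi (ex x)).
Proof.
move=> xr; rewrite /chart_psi /chart_phi addrC subrK chart_funK//.
exact: ex_dom L _ xr.
Qed.

Lemma ex_chart_le x : `|x| <= r -> `|chart_phi (ex x)| <= 2 * `|x|.
Proof.
move=> xr; have := near_linear_le ler01 (ex_chart L) (lexx r) xr.
move=> h; apply: le_trans h _; rewrite ler_wpM2r//.
by have := Cr; lra.
Qed.

Lemma ex_chart_sub x : `|x| <= r -> `|chart_phi (ex x) - x| <= C * `|x| * `|x|.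
Proof.
move=> xr; have := (ex_chart L).2 `|x| x 0 xr (lexx _).
by rewrite normr0 (ex_chart L).1 !subr0 scale1r; apply.
Qed.

Lemma ex_cvg0 : ex x @[x --> (0 : V)] --> (1%g : G).
Proof.
move=> A nA.
have /nearN [e e0 He] : \forall u \near p0, A (chart_inv c1 u) by exact: chart_inv_cvg1 nA.
suff : \forall x \near (0 : V), A (ex x) by [].
apply/nearN; exists (Num.min r (e / 2)) => [|x]; first by rewrite lt_min r_gt0 divr_gt0.
rewrite subr0 lt_min => /andP[xr xe]; rewrite ex_psi ?ltW//.
apply: He; rewrite addrAC subrr add0r (le_lt_trans (ex_chart_le (ltW xr)))//.
by rewrite mulrC -ltr_pdivlMr.
Qed.

(** Continuity of inversion and [log_near] reach the inverses near 1; that they are the values of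
    [ex] at the opposite vectors is established only in [ex_opp]. *)
Lemma ex_inv_small (e : R) : 0 < e -> exists2 d : R, 0 < d &
  forall z, `|z| < d -> exists2 z', `|z'| < e & ex z' = (ex z)^-1%g.
Proof.
move=> e0; have /= ne := log_near L e0.
have ic : (ex z)^-1%g @[z --> (0 : V)] --> (1%g : G).
  rewrite -[X in _ --> X]invg1; apply: cvg_comp ex_cvg0 _.
  exact: (@lie_inv_continuous _ _ G).
have /nearN [d d0 H] : \forall z \near (0 : V), `|Log (ex z)^-1%g| < e /\ ex (Log (ex z)^-1%g) = (ex z)^-1%g.
  exact: ic ne.
by exists d => // z zd; have [|h1 h2] := H z; [rewrite subr0|exists (Log (ex z)^-1%g)].
Qed.

Definition conj_chart (g : G) (u : V) : V := c1 (g * chart_inv c1 u * g^-1)%g.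

(** [Ad] is read off from ['d], which has a meaning only for a differentiable map. Conjugation is
    composed of the chart multiplication with a fixed left factor and with a fixed right factor,
    both close enough to the unit. *)
Lemma conj_chart_diff : exists2 d : R, 0 < d &
  forall z, `|z| <= d -> differentiable (conj_chart (ex z)) p0.
Proof.
have /nearN [r1 r10 H] := mul_dom_near G.
have [d1 d10 H1] := ex_inv_small (e := Num.min r (r1 / 2)) ltac:(by rewrite lt_min r_gt0 divr_gt0).
have [d [d0 dr dr1 dd1]] : exists d : R, [/\ 0 < d, d <= r, 2 * d < r1 & d < d1].
  exists (Num.min r (Num.min (r1 / 4) (d1 / 2))); split.
  - by rewrite !lt_min r_gt0 !divr_gt0.
  - by rewrite ge_min lexx.
  - rewrite -ltr_pdivlMl// gt_min; apply/orP; right; rewrite gt_min; apply/orP; left; lra.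
  - rewrite gt_min; apply/orP; right; rewrite gt_min; apply/orP; right; lra.
exists d => // z zd.
have [z' z'r zz'] := H1 z (le_lt_trans zd dd1).
move: z'r; rewrite lt_min => /andP[z'r z'r1].
set g := ex z; set pz := c1 g; set pz' := c1 g^-1%g.
have zr : `|z| <= r := le_trans zd dr.
have pz1 : `|pz - p0| < r1.
  by apply: le_lt_trans (ex_chart_le zr) _; apply: le_lt_trans dr1; rewrite ler_pM2l.
have pz1' : `|pz' - p0| < r1.
  rewrite /pz' -zz'; apply: le_lt_trans (ex_chart_le (ltW z'r)) _.
  by rewrite mulrC -ltr_pdivlMr.
have invpz : chart_inv c1 pz = g by rewrite chart_funK//; exact: ex_dom L _ zr.
have invpz' : chart_inv c1 pz' = g^-1%g.
  by rewrite chart_funK// -zz'; exact: ex_dom L _ (ltW z'r).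
pose F := @chart_mul _ _ G.
have near_dom (u w : V) : `|u - p0| < r1 -> `|w - p0| < r1 -> mul_dom G (u, w).
  by move=> ur wr; apply: H; rewrite norm_pair_lt ur wr.
have Fz : F (pz, p0) = pz by rewrite /F /chart_mul /= invpz chart_inv1 mulg1.
have p00 : `|p0 - p0| < r1 by rewrite subrr normr0.
pose f1 (u : V) := F (pz, u); pose f2 (v : V) := F (v, pz').
have d1' : differentiable f1 p0.
  apply: differentiable_comp; last exact/chart_mul_diff/near_dom.
  by apply: differentiable_pair.
have d2' : differentiable f2 (f1 p0).
  rewrite /f1 Fz; apply: differentiable_comp; last exact/chart_mul_diff/near_dom.
  by apply: differentiable_pair.
have dc : differentiable (f2 \o f1) p0 by exact: differentiable_comp.
have E : \forall u \near p0, (f2 \o f1) u = conj_chart g u.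
  apply/nearN; exists r1 => // u ur.
  have [_ _ dm] := near_dom _ _ pz1 ur; rewrite /= invpz in dm.
  rewrite /= /f1 /f2 /F /chart_mul /= invpz chart_funK//.
  by rewrite invpz'.
have := has_diff_near E (differentiable_has_diff dc).
have [K K0 HK] := framed_bounded ('d (f2 \o f1) p0) (framed_row R n).
by case/(has_diff_linear (linearP _) HK).
Qed.

Lemma Ad_has_diff : exists2 d : R, 0 < d & forall z, `|z| <= d ->
  has_diff (conj_chart (ex z)) p0 (Ad (ex z)).
Proof.
by have [d d0 H] := conj_chart_diff; exists d => // z /H /differentiable_has_diff.
Qed.

End LogCalculus.


Section LittleO.
Variable R : realType.
Implicit Types f g : R -> R.

(** Only s > 0 and only an upper bound: f is signed here, which the sign argument [little_o1_cst]
    exploits. Two-sided statements put a norm in f. *)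
Definition little_o (k : nat) f : Prop := forall e : R, 0 < e ->
  exists2 d : R, 0 < d & forall s, 0 < s -> s < d -> f s <= e * s ^+ k.

Lemma little_oD k f g : little_o k f -> little_o k g -> little_o k (fun s => f s + g s).
Proof.
move=> Hf Hg e e0; have e20 : 0 < e / 2 by rewrite divr_gt0.
have [d1 d10 H1] := Hf _ e20; have [d2 d20 H2] := Hg _ e20.
exists (Num.min d1 d2) => [|s s0]; first by rewrite lt_min d10.
by rewrite lt_min => /andP[/(H1 s s0) h1 /(H2 s s0) h2]; lra.
Qed.

Lemma little_oZ k f (a : R) : 0 <= a -> little_o k f -> little_o k (fun s => a * f s).
Proof.
move=> a0 Hf e e0; have a1 : 0 < a + 1 by rewrite ltr_wpDl.
have [d d0 H] := Hf _ (divr_gt0 e0 a1); exists d => // s s0 sd.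
apply: le_trans (ler_wpM2l a0 (H s s0 sd)) _.
rewrite mulrA; apply: ler_wpM2r; first by rewrite exprn_ge0// ltW.
by rewrite mulrCA ger_pMr// ler_pdivrMr// mul1r lerDl.
Qed.

Lemma little_oX k (K : R) : little_o k (fun s => K * s ^+ k.+1).
Proof.
move=> e e0; have K1 : 0 < `|K| + 1 by rewrite ltr_wpDl.
exists (e / (`|K| + 1)) => [|s s0]; first by rewrite divr_gt0.
rewrite ltr_pdivlMr// => h; rewrite exprS mulrA.
apply: ler_wpM2r; first by rewrite exprn_ge0// ltW.
apply: le_trans _ (ltW h); rewrite mulrC; apply: ler_wpM2l; first exact: ltW.
by rewrite (le_trans (ler_norm K))// lerDl.
Qed.

Lemma little_o_le k f g (s0 : R) : 0 < s0 -> (forall s, 0 < s -> s < s0 -> f s <= g s) ->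
  little_o k g -> little_o k f.
Proof.
move=> s00 fg Hg e /Hg [d d0 H]; exists (Num.min d s0); first by rewrite lt_min d0.
by move=> s sp; rewrite lt_min => /andP[sd ss]; apply: le_trans (fg _ sp ss) (H _ sp sd).
Qed.

End LittleO.

(** * The adjoint action in logarithmic coordinates *)

Section AdjointLog.
Variables (R : realType) (n : nat) (G : lieGroupType R n).
Local Notation V := 'rV[R]_n.
Local Notation c1 := (chart1 G).
Local Notation p0 := (chart1 G 1%g).
Variables (ex : V -> G) (Log : G -> V) (r C : R).
Hypothesis L : local_log ex Log r C.
Hypothesis Cr : C * r <= 1 / 16.
Local Notation M a b := (Log (ex a * ex b)%g).

Let r_gt0 : 0 < r := log_r_gt0 L.
Let C_gt0 : 0 < C := log_C_gt0 L.

Lemma norm2 (x : V) : `|x + x| = 2 * `|x|.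
Proof. by rewrite (_ : x + x = 2 *: x) ?normrZ ?ger0_norm//; rowlin. Qed.

(** Conjugation is a homomorphism, so its expression c in the coordinates commutes exactly with
    doubling. Its derivative at 0 is Ad (ex z), and [doubling_linear] identifies the two. *)
Lemma Ad_log : exists2 d : R, 0 < d /\ d <= r & forall z w, `|z| <= d -> `|w| <= d ->
  (ex z * ex w * (ex z)^-1)%g = ex (Ad (ex z) w) /\ `|Ad (ex z) w| <= 4 * `|w|.
Proof.
have [d1 d10 H1] := Ad_has_diff L Cr.
have r40 : 0 < r / 4 by rewrite divr_gt0.
have [d2 d20 H2] := ex_inv_small L Cr r40.
have [d [d0 d8 dd1 dd2]] : exists d : R, [/\ 0 < d, 8 * d <= r, d <= d1 & d < d2].
  exists (Num.min (r / 8) (Num.min d1 (d2 / 2))); split.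
  - by rewrite !lt_min d10 !divr_gt0.
  - by rewrite -ler_pdivlMl// mulrC ge_min lexx.
  - by rewrite !ge_min lexx orbT.
  - by rewrite !gt_min; apply/orP; right; apply/orP; right; lra.
have dr : d <= r by lra.
have r4r : r / 4 <= r by lra.
have d4 : 4 * d <= r by lra.
exists d => // z w zd wd.
have [z' z'r zz'] := H2 z (le_lt_trans zd dd2).
have dAd := H1 z (le_trans zd dd1).
set A := Ad (ex z) in dAd *.
have [K K0 HK] : exists2 K : R, 0 < K & forall h, `|A h| <= K * `|h|.
  exact: (framed_bounded ('d (conj_chart (ex z)) p0) (framed_row R n)).
have AZ (a : R) h : A (a *: h) = a *: A h by exact: linearZZ.
have AB h k : A (h - k) = A h - A k by exact: (linearB ('d (conj_chart (ex z)) p0)).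
pose c (w : V) := M (M z w) z'.
have z'r' : `|z'| <= r := le_trans (ltW z'r) r4r.
have zr : `|z| <= r := le_trans zd dr.
have Mzr u : `|u| <= d -> `|M z u| <= r.
  move=> ud; apply: le_trans (log_mul_le L Cr dr zd ud) _; lra.
have exc u : `|u| <= d -> ex (c u) = (ex z * ex u * (ex z)^-1)%g.
  move=> ud; rewrite /c (log_mulK L (Mzr _ ud) z'r') (log_mulK L zr (le_trans ud dr)).
  by rewrite zz'.
have c0 : c 0 = 0.
  by rewrite /c (log_mul0 L zr) zz' mulgV (log1 L).
have cle u : `|u| <= d -> `|c u| <= 4 * `|u|.
  move=> ud; rewrite -[c u]subr0 -c0 /c.
  have d00 : `|0 : V| <= d by rewrite normr0 ltW.
  have h1 := log_mul_lip L Cr dr zd ud zd d00.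
  have h2 := log_mul_lip L Cr (lexx r) (Mzr _ ud) z'r' (Mzr _ d00) z'r'.
  rewrite !subrr !normr0 subr0 in h1 h2; lra.
have cdbl u : `|u + u| <= d -> c (u + u) = c u + c u.
  move=> uud; have ud : `|u| <= d by rewrite norm2 in uud; have := normr_ge0 u; lra.
  have cur : `|c u + c u| <= r by rewrite norm2; have := cle _ ud; rewrite norm2 in uud; lra.
  have cr : `|c (u + u)| <= r by have := cle _ uud; lra.
  apply: (ex_inj L cr cur); rewrite exc//.
  rewrite (ex_double L (le_trans ud dr)) (ex_double L); last by have := cle _ ud; lra.
  rewrite exc//.
  by rewrite !mulgA; congr (_ * _)%g; rewrite -!mulgA mulKg.
suff cA : c w = A w by rewrite -cA exc//; split => //; exact: cle.
have scw (s : R) : 0 < s -> s <= 1 -> `|s *: w| <= d.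
  move=> s0 s1; rewrite normrZ gtr0_norm//; apply: le_trans wd.
  by rewrite ler_piMl.
have := @doubling_linear R _ (fun s => c (s *: w)) 1 (A w) _ _ 1 ltr01 (lexx 1).
rewrite !scale1r; apply.
  move=> s s0 s1; rewrite scalerDl cdbl// -scalerDl scw//; lra.
suff : little_o 1 (fun s => `|c (s *: w) - s *: A w|).
  by move=> H e /H [dd dd0 Hd]; exists dd => // s s0 /(Hd s s0); rewrite expr1.
have lo1 : little_o 1 (fun s => `|chart_phi (ex (c (s *: w))) - A (chart_phi (ex (s *: w)))|).
  move=> e e0; pose m := 2 * `|w| + 1.
  have m0 : 0 < m by rewrite ltr_wpDl// mulr_ge0.
  have [dd dd0 Hd] := dAd _ (divr_gt0 e0 m0).
  exists (Num.min 1 (dd / m)) => [|s s0]; first by rewrite lt_min ltr01 divr_gt0.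
  rewrite lt_min ltr_pdivlMr// => /andP[s1 sd]; rewrite expr1.
  have sw := scw s s0 (ltW s1).
  have h1 : `|chart_phi (ex (s *: w))| <= s * m.
    apply: le_trans (ex_chart_le L Cr (le_trans sw dr)) _.
    by rewrite normrZ gtr0_norm// mulrCA ler_pM2l// lerDl.
  have := Hd _ (le_lt_trans h1 sd).
  rewrite {1}/conj_chart -/(chart_psi _ _) -(ex_psi L (le_trans sw dr)) -exc//.
  rewrite {1}/conj_chart chart_inv1 mulg1 mulgV => h2; apply: le_trans h2 _.
  have em0 : 0 <= e / m by rewrite divr_ge0// ltW.
  apply: le_trans (ler_wpM2l em0 h1) _.
  by rewrite [s * m]mulrC mulrA divfK// gt_eqF.
apply: (@little_o_le _ _ _ (fun s => `|chart_phi (ex (c (s *: w))) - A (chart_phi (ex (s *: w)))|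
  + (C * (16 * `|w| * `|w|) + K * (C * `|w| * `|w|)) * s ^+ 2) 1 ltr01); last first.
  by apply: little_oD => //; exact: little_oX.
move=> s s0 s1; have sw := scw s s0 (ltW s1); have csw := cle _ sw.
have sn : `|s *: w| = s * `|w| by rewrite normrZ gtr0_norm.
have h1 := ex_chart_sub L (le_trans sw dr).
have cr : `|c (s *: w)| <= r by lra.
have h2 := ex_chart_sub L cr.
have h3 := HK (chart_phi (ex (s *: w)) - s *: w).
rewrite AB AZ in h3.
rewrite (_ : c _ - _ = (chart_phi (ex (c (s *: w))) - A (chart_phi (ex (s *: w))))
   - (chart_phi (ex (c (s *: w))) - c (s *: w)) + (A (chart_phi (ex (s *: w))) - s *: A w)); last by rowring.
apply: le_trans (ler_normD _ _) _.
have h4 := ler_normB (chart_phi (ex (c (s *: w))) - A (chart_phi (ex (s *: w)))) (chart_phi (ex (c (s *: w))) - c (s *: w)).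
have h5 : C * `|c (s *: w)| * `|c (s *: w)| <= C * (16 * `|w| * `|w|) * s ^+ 2.
  rewrite -mulrA -[leRHS]mulrA ler_pM2l//.
  apply: (@le_trans _ _ ((4 * (s * `|w|)) * (4 * (s * `|w|)))).
    by rewrite sn in csw; apply: ler_pM.
  by rewrite le_eqVlt; apply/orP; left; apply/eqP; ring.
have h6 : K * `|chart_phi (ex (s *: w)) - s *: w| <= K * (C * `|w| * `|w|) * s ^+ 2.
  rewrite -[leRHS]mulrA ler_pM2l//; apply: le_trans h1 _; rewrite sn.
  by rewrite le_eqVlt; apply/orP; left; apply/eqP; ring.
rewrite mulrDl; lra.
Qed.

Hypothesis AdL : forall z w, `|z| <= r -> `|w| <= r ->
  (ex z * ex w * (ex z)^-1)%g = ex (Ad (ex z) w) /\ `|Ad (ex z) w| <= 4 * `|w|.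

Lemma AdZ (g : G) (a : R) h : Ad g (a *: h) = a *: Ad g h.
Proof. exact: linearZZ. Qed.

Lemma Ad_conj z w : `|z| <= r -> `|w| <= r -> (ex z * ex w)%g = (ex (Ad (ex z) w) * ex z)%g.
Proof. by move=> zr wr; have [<- _] := AdL zr wr; rewrite mulgVK. Qed.

(** Serves to extend identities between linear maps from a small ball to all vectors. *)
Lemma scale_to (w : V) (rho : R) : w != 0 -> 0 < rho ->
  exists2 a : R, 0 < a & exists2 u : V, `|u| = rho & w = a *: u.
Proof.
move=> w0 rho0; have nw : 0 < `|w| by rewrite normr_gt0.
exists (`|w| / rho); first by rewrite divr_gt0.
exists ((rho / `|w|) *: w).
  by rewrite normrZ ger0_norm ?divr_ge0 ?ltW// divfK// gt_eqF.
by rewrite scalerA mulrA divfK ?divff ?scale1r// gt_eqF.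
Qed.

Lemma Ad_ex0 w : Ad (ex 0) w = w.
Proof.
have [->|w0] := eqVneq w 0; first by rewrite -(scale0r 0) AdZ !scale0r.
have r40 : 0 < r / 4 by rewrite divr_gt0.
have [a a0 [u ur ->]] := scale_to w0 r40; rewrite AdZ; congr (_ *: _).
have u1 : `|u| <= r by rewrite ur; lra.
have z1 : `|0 : V| <= r by rewrite normr0 ltW.
have [h1 h2] := AdL z1 u1; apply: (ex_inj L) => //; first by rewrite ur in h2; lra.
by rewrite -h1 (ex0 L) invg1 mulg1 mul1g.
Qed.

Lemma Ad_self z : 4 * `|z| <= r -> Ad (ex z) z = z.
Proof.
move=> z4; have zr : `|z| <= r by have := normr_ge0 z; lra.
have [h1 h2] := AdL zr zr; apply: (ex_inj L) => //; first lra.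
by rewrite -h1 mulgK.
Qed.

(** In exp z exp u = exp A exp z, with A = Ad (exp z) u, the two sides have logarithms close to z +
    u and to A + z. The error of [log_mul_sub] is not homogeneous, so w is first rescaled to a
    vector u as long as z. *)
Lemma Ad_sub z w : 4 * `|z| <= r -> `|Ad (ex z) w - w| <= 16 * C * `|z| * `|w|.
Proof.
move=> z4; have zr : `|z| <= r by have := normr_ge0 z; lra.
have [->|z0] := eqVneq z 0; first by rewrite Ad_ex0 subrr !normr0 mulr0 mul0r.
have [->|w0] := eqVneq w 0.
  by rewrite -(scale0r 0) AdZ !scale0r subrr !normr0 mulr0.
have nz : 0 < `|z| by rewrite normr_gt0.
have [a a0 [u uz ->]] := scale_to w0 nz.
rewrite AdZ -scalerBr !normrZ mulrCA ler_wpM2l// uz.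
have ur : `|u| <= r by rewrite uz.
have [_ Au] := AdL zr ur; set A := Ad (ex z) u in Au *.
have E : M z u = M A z by rewrite Ad_conj.
have r4 : 4 * `|z| <= 4 * `|z| by [].
have z1 : `|z| <= 4 * `|z| by lra.
have u1 : `|u| <= 4 * `|z| by rewrite uz.
have A1 : `|A| <= 4 * `|z| by rewrite -uz.
have h1 := log_mul_sub L z4 z1 u1; have h2 := log_mul_sub L z4 A1 z1.
rewrite E in h1; rewrite uz in h1.
rewrite (_ : A - u = (M A z - z - u) - (M A z - A - z)); last by rowring.
by apply: le_trans (ler_normB _ _) _; have := mulr_ge0 (mulr_ge0 (ltW C_gt0) (ltW nz)) (ltW nz); lra.
Qed.

Lemma ex_line_commute (z : V) (s t : R) : 4 * `|s *: z| <= r -> `|t *: z| <= r ->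
  commute (ex (s *: z)) (ex (t *: z)).
Proof.
move=> sz tz; have [->|s0] := eqVneq s 0.
  by rewrite /commute scale0r (ex0 L) mulg1 mul1g.
have szr : `|s *: z| <= r by have := normr_ge0 (s *: z); lra.
rewrite /commute Ad_conj// (_ : t *: z = (t / s) *: (s *: z)); last by rewrite scalerA divfK.
by rewrite AdZ Ad_self.
Qed.

(** Because the factors commute, u |-> log (exp (u s z) exp (u t z)) doubles exactly; its derivative
    at 0 is (s + t) z. *)
Lemma ex_line_add (z : V) (s t : R) : 8 * `|s *: z| <= r -> 8 * `|t *: z| <= r ->
  (ex (s *: z) * ex (t *: z))%g = ex ((s + t) *: z).
Proof.
move=> sz tz.
have nsz := normr_ge0 (s *: z); have ntz := normr_ge0 (t *: z).
have sr : `|s *: z| <= r by lra.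
have tr : `|t *: z| <= r by lra.
pose K (u : R) := M ((u * s) *: z) ((u * t) *: z).
have us (u : R) : 0 < u -> u <= 1 -> `|(u * s) *: z| <= u * (r / 8) /\ `|(u * t) *: z| <= u * (r / 8).
  by move=> u0 u1; rewrite -!scalerA !(normrZ u) (gtr0_norm u0) !ler_pM2l//; split; lra.
have us' (u : R) : 0 < u -> u <= 1 -> `|(u * s) *: z| <= r / 8 /\ `|(u * t) *: z| <= r / 8.
  move=> u0 u1; have [h1 h2] := us _ u0 u1.
  have : u * (r / 8) <= r / 8 by rewrite ler_piMl// divr_ge0// ltW.
  by split; lra.
have r8 : r / 8 <= r by have := r_gt0; lra.
have r80 : r / 8 <= r / 8 by [].
suff K1 : K 1 = 1 *: ((s + t) *: z).
  by move: K1; rewrite /K !mul1r scale1r => <-; rewrite (log_mulK L).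
apply: (@doubling_linear R _ K 1 ((s + t) *: z) _ _ 1) => //.
  move=> u u0 u1; have u1' : u <= 1 by lra.
  have uu0 : 0 < u + u by lra.
  have uu1 : u + u <= 1 by lra.
  have [h1 h2] := us' _ u0 u1'; have [h3 h4] := us' _ uu0 uu1.
  have kb (x y : V) : `|x| <= r / 8 -> `|y| <= r / 8 -> `|M x y| <= r / 2.
    by move=> hx hy; apply: le_trans (log_mul_le L Cr r8 hx hy) _; lra.
  apply: (ex_inj L).
  - by have := kb _ _ h3 h4; have := r_gt0; rewrite /K; lra.
  - by rewrite norm2; have := kb _ _ h1 h2; rewrite /K; lra.
  rewrite (ex_double L); last by have := kb _ _ h1 h2; have := r_gt0; rewrite /K; lra.
  rewrite /K !(log_mulK L) ?(le_trans _ r8)//.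
  rewrite !mulrDl !scalerDl !(ex_double L) ?(le_trans _ r8)//.
  have cm : commute (ex ((u * s) *: z)) (ex ((u * t) *: z)).
    by apply: ex_line_commute; lra.
  by rewrite -!mulgA; congr (_ * _)%g; rewrite !mulgA; congr (_ * _)%g.
move=> e e0.
have lo := @little_oX R 1 (C * (r / 8) * (r / 8)).
have [d d0 Hd] := lo e e0.
exists (Num.min 1 d) => [|u u0]; first by rewrite lt_min ltr01.
rewrite lt_min => /andP[u1 ud]; have := Hd u u0 ud; rewrite expr1; apply: le_trans.
have [h1 h2] := us _ u0 (ltW u1).
have ur : u * (r / 8) <= r.
  by apply: le_trans r8; rewrite ler_piMl ?(ltW u1)// divr_ge0// ltW.
have := log_mul_sub L ur h1 h2.
rewrite (_ : _ - _ - _ = K u - u *: ((s + t) *: z)); last by rewrite /K; rowring.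
move=> h; apply: le_trans h _.
apply: (@le_trans _ _ (C * (u * (r / 8)) * (u * (r / 8)))).
  by rewrite ler_wpM2l// !mulr_ge0 ?(ltW C_gt0) ?ltW.
by rewrite le_eqVlt; apply/orP; left; apply/eqP; ring.
Qed.

Lemma ex_opp (z : V) : 8 * `|z| <= r -> ex (- z) = (ex z)^-1%g.
Proof.
move=> zr; have := @ex_line_add z 1 (- 1).
rewrite scaleN1r scale1r normrN subrr scale0r (ex0 L) => /(_ zr zr) h.
by rewrite -(mulKg (ex z) (ex (- z))) h mulg1.
Qed.

End AdjointLog.


(** * One-parameter subgroups and the exponential map *)

Section OneParameterSubgroups.
Variables (R : realType) (n : nat) (G : lieGroupType R n).
Local Notation V := 'rV[R]_n.
Local Notation c1 := (chart1 G).
Local Notation p0 := (chart1 G 1%g).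
Variables (ex : V -> G) (Log : G -> V) (r C : R).
Hypothesis L : local_log ex Log r C.
Hypothesis Cr : C * r <= 1 / 16.
Hypothesis line_add : forall (z : V) (s t : R), `|s *: z| <= r -> `|t *: z| <= r ->
  (ex (s *: z) * ex (t *: z))%g = ex ((s + t) *: z).

Let r_gt0 : 0 < r := log_r_gt0 L.
Let C_gt0 : 0 < C := log_C_gt0 L.

(** The curve t |-> exp (t x) is continued by repeated squaring: [covers] says that k halvings bring
    t x into the ball, and [scaled] squares back. By [ex_double] the value does not depend on k. *)
Let covers (x : V) (k : nat) (t : R) := `|t *: x| <= 2 ^+ k * r.
Let scaled (x : V) (k : nat) (t : R) : G := (ex ((t / 2 ^+ k) *: x) ^+ (2 ^ k)%N)%g.

Lemma two_pow_unbounded (a b : R) : 0 < b -> exists k : nat, a <= 2 ^+ k * b.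
Proof.
move=> b0; exists (Num.truncn (a / b)).+1; rewrite -ler_pdivrMr//.
apply: le_trans (ltW (truncnS_gt _)) _.
by rewrite -natrX ler_nat; exact/ltnW/ltn_expl.
Qed.

Let covers_arg x k t : covers x k t -> `|(t / 2 ^+ k) *: x| <= r.
Proof.
move=> h; rewrite [_ / _]mulrC -scalerA normrZ ger0_norm ?invr_ge0 ?exprn_ge0//.
by rewrite ler_pdivrMl ?exprn_gt0.
Qed.

Let coversS x k t : covers x k t -> covers x k.+1 t.
Proof.
rewrite /covers exprS => h; apply: le_trans h _.
by rewrite -mulrA ler_peMl ?mulr_ge0 ?exprn_ge0 ?ler1n// ltW.
Qed.

Let covers_le x k j t : covers x k t -> (k <= j)%N -> covers x j t.
Proof.
move=> h; elim: j => [|j IH]; first by rewrite leqn0 => /eqP <-.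
by rewrite leq_eqVlt => /predU1P[<-//|]; rewrite ltnS => /IH; exact: coversS.
Qed.

Let scaledS x k t : covers x k t -> scaled x k.+1 t = scaled x k t.
Proof.
move=> h; rewrite /scaled expnS expgnA expg2.
have E : (t / 2 ^+ k) *: x = (t / 2 ^+ k.+1) *: x + (t / 2 ^+ k.+1) *: x.
  by rewrite -scalerDl; congr (_ *: _); rewrite exprS invfM; lra.
rewrite E (ex_double L)//; have := covers_arg h; rewrite E norm2.
by have := normr_ge0 ((t / 2 ^+ k.+1) *: x); lra.
Qed.

Let scaled_le x k j t : covers x k t -> (k <= j)%N -> scaled x j t = scaled x k t.
Proof.
move=> h; elim: j => [|j IH]; first by rewrite leqn0 => /eqP ->.
rewrite leq_eqVlt => /predU1P[<-//|]; rewrite ltnS => kj.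
by rewrite scaledS ?IH//; exact: covers_le kj.
Qed.

Let level (x : V) (t : R) : nat := xchoose (two_pow_unbounded `|t *: x| r_gt0).
Let levelP x t : covers x (level x t) t.
Proof. exact: (xchooseP (two_pow_unbounded `|t *: x| r_gt0)). Qed.

Definition one_param (x : V) (t : R) : G := scaled x (level x t) t.

Let one_paramE x k t : covers x k t -> one_param x t = scaled x k t.
Proof.
move=> h; rewrite /one_param.
have := scaled_le (levelP x t) (leq_maxl (level x t) k).
by rewrite (scaled_le h (leq_maxr _ _)).
Qed.

Lemma one_param_small x t : `|t *: x| <= r -> one_param x t = ex (t *: x).
Proof.
move=> h; rewrite (@one_paramE x 0 t); last by rewrite /covers expr0 mul1r.
by rewrite /scaled expr0 divr1 expn0 expg1.
Qed.

Lemma one_paramD x (s t : R) : one_param x (s + t) = (one_param x s * one_param x t)%g.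
Proof.
pose j := maxn (maxn (level x s) (level x t)) (level x (s + t)).
have hs : covers x j s by apply: covers_le (levelP x s) _; rewrite /j !leq_max leqnn.
have ht : covers x j t by apply: covers_le (levelP x t) _; rewrite /j !leq_max leqnn orbT.
have hst : covers x j (s + t) by apply: covers_le (levelP x (s + t)) _; rewrite leq_max leqnn orbT.
rewrite (one_paramE hs) (one_paramE ht) (one_paramE hst) /scaled.
have h1 := covers_arg hs; have h2 := covers_arg ht.
rewrite -expgMn; last first.
  by rewrite /commute !line_add// addrC.
by rewrite line_add// mulrDl.
Qed.

Lemma one_param0 x : one_param x 0 = 1%g.
Proof. by rewrite one_param_small scale0r ?normr0 ?(ex0 L)// ltW. Qed.

Lemma one_param_has_diff x : has_diff (c1 \o one_param x) (0 : R) (fun s => s *: x).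
Proof.
move=> e e0; pose K := C * `|x| * `|x|.
have m0 : 0 < `|x| + 1 by rewrite ltr_wpDl.
have K0 : 0 < K + 1 by rewrite ltr_wpDl// !mulr_ge0// ltW.
exists (Num.min (r / (`|x| + 1)) (e / (K + 1))) => [|h]; first by rewrite lt_min !divr_gt0.
rewrite lt_min !ltr_pdivlMr// => /andP[hr he].
have hx : `|h *: x| <= r.
  by rewrite normrZ (le_trans _ (ltW hr))// ler_wpM2l// lerDl.
rewrite add0r /= one_param0 one_param_small//.
have := ex_chart_sub L hx; rewrite /chart_phi => H; apply: le_trans H _.
rewrite normrZ (_ : C * _ * _ = K * `|h| * `|h|); last by rewrite /K; ring.
rewrite ler_wpM2r// mulrC (le_trans _ (ltW he))// ler_wpM2l// lerDl//.
Qed.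

Lemma one_param_cvg0 x : one_param x s @[s --> (0 : R)] --> (1%g : G).
Proof.
move=> A nA; have /nearN [e e0 He] : \forall u \near (0 : V), A (ex u) by exact: (ex_cvg0 L Cr nA).
suff : \forall s \near (0 : R), A (one_param x s) by [].
have m0 : 0 < `|x| + 1 by rewrite ltr_wpDl.
apply/nearN; exists (Num.min r e / (`|x| + 1)) => [|s]; first by rewrite divr_gt0// lt_min r_gt0.
rewrite subr0 ltr_pdivlMr// => h.
have : `|s *: x| < Num.min r e.
  by rewrite normrZ (le_lt_trans _ h)// ler_wpM2l// lerDl.
rewrite lt_min => /andP[h1 h2]; rewrite one_param_small ?ltW//.
by apply: He; rewrite subr0.
Qed.

Lemma one_paramP x : one_param_subgroup (one_param x) x.
Proof.
split; [exact: one_paramD| |exact/is_derive_has_diff/one_param_has_diff].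
move=> t; have E s : one_param x s = (one_param x t * one_param x (s - t))%g.
  by rewrite -one_paramD addrC subrK.
have h0 : (fun s : R => s - t) s @[s --> t] --> (0 : R).
  by rewrite -[X in _ --> X](subrr t); apply: cvgB; [exact: cvg_id|exact: cvg_cst].
have h1 : one_param x (s - t) @[s --> t] --> (1%g : G).
  exact: cvg_comp h0 (@one_param_cvg0 x).
have h2 : (one_param x t, one_param x (s - t)) @[s --> t] --> (one_param x t, 1%g : G).
  by apply: cvg_pair => //; exact: cvg_cst.
have h3 := cvg_comp _ _ h2 (@lie_mul_continuous _ _ G (one_param x t, 1%g)).
rewrite /= mulg1 in h3.
have EE : one_param x = (fun p : G * G => (p.1 * p.2)%g) \o
    (fun s => (one_param x t, one_param x (s - t))) by apply/funext => s; exact: E.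
by rewrite /continuous_at {1}EE.
Qed.

(** Near 0, Log (c s) doubles exactly and has derivative x, hence equals s x; c 1 is then a power of
    c (2^-k) with k large. *)
Lemma one_param_subgroup_unique (c : R -> G) (x : V) : one_param_subgroup c x ->
  `|x| <= r / 4 -> c 1 = ex x.
Proof.
move=> [cD cc /is_derive_has_diff cd] xr.
have c0 : c 0 = 1%g.
  by have := cD 0 0; rewrite addr0 => /(congr1 (fun g => (g * (c 0)^-1)%g)); rewrite mulgV mulgK.
have r40 : 0 < r / 4 by rewrite divr_gt0.
have /= nL := log_near L r40.
have := cc 0; rewrite /continuous_at c0 => /(_ _ nL) nc.
have /nearN [s0 s00 Hs] : \forall s \near (0 : R), `|Log (c s)| < r / 4 /\ ex (Log (c s)) = c s by exact: nc.
have small s : 0 < s -> s < s0 -> `|Log (c s)| < r / 4 /\ ex (Log (c s)) = c s.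
  by move=> sp ss; apply: Hs; rewrite subr0 gtr0_norm.
have key s : 0 < s -> s <= s0 / 2 -> Log (c s) = s *: x.
  move=> sp ss; apply: (@doubling_linear R _ (fun s => Log (c s)) (s0 / 2) x) => //.
    move=> t t0 tt; have [h1 h2] := small t t0 ltac:(lra).
    have [h3 h4] := small (t + t) ltac:(lra) ltac:(lra).
    apply: (ex_inj L); [lra|by rewrite norm2; lra|].
    by rewrite (ex_double L) ?h4 ?h2 ?cD//; lra.
  move=> e e0.
  have [d d0 Hd] := cd (Num.min 1 (e / 2)) ltac:(by rewrite lt_min ltr01 divr_gt0).
  have lo := @little_oX R 1 (C * (2 * (`|x| + 1)) * (2 * (`|x| + 1))).
  have [d' d'0 Hd'] := lo (e / 2) ltac:(by rewrite divr_gt0).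
  exists (Num.min d (Num.min s0 d')) => [|t t0]; first by rewrite !lt_min d0 s00.
  rewrite !lt_min => /and3P[td ts td'].
  have [h1 h2] := small t t0 ts.
  have := Hd t; rewrite (gtr0_norm t0) => /(_ td); rewrite add0r /= c0 => h3.
  have h3' : `|chart_phi (c t) - t *: x| <= e / 2 * t.
    by apply: le_trans h3 _; rewrite ler_wpM2r ?(ltW t0)// ge_min lexx orbT.
  have h3'' : `|chart_phi (c t) - t *: x| <= t.
    by apply: le_trans h3 _; rewrite ler_piMl ?(ltW t0)// ge_min lexx.
  have lr : `|Log (c t)| <= r by have := r_gt0; lra.
  have h4 := ex_chart_sub L lr; rewrite h2 in h4.
  (* The quadratic error is at most 1/16 of [|Log (c t)|] and is absorbed on the left. *)
  have h5 : `|Log (c t)| <= 2 * `|chart_phi (c t)|.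
    have := norm_le_sub (Log (c t)) (chart_phi (c t)); rewrite [`|Log (c t) - _|]distrC.
    have : C * `|Log (c t)| * `|Log (c t)| <= 1 / 16 * `|Log (c t)|.
      by rewrite ler_wpM2r// (C_small L Cr).
    by have := normr_ge0 (Log (c t)); lra.
  have h6 : `|chart_phi (c t)| <= t * (`|x| + 1).
    have := norm_le_sub (chart_phi (c t)) (t *: x); rewrite normrZ (gtr0_norm t0); lra.
  have h7 : C * `|Log (c t)| * `|Log (c t)| <= C * (2 * (`|x| + 1)) * (2 * (`|x| + 1)) * t ^+ 2.
    rewrite -mulrA (_ : _ * t ^+ 2 = C * ((2 * (t * (`|x| + 1))) * (2 * (t * (`|x| + 1))))); last by ring.
    by rewrite ler_pM2l//; apply: ler_pM => //; lra.
  have := Hd' t t0 td'; rewrite expr1 => h8.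
  rewrite (_ : _ - _ = (chart_phi (c t) - t *: x) - (chart_phi (c t) - Log (c t))); last by rowring.
  by apply: le_trans (ler_normB _ _) _; lra.
have [k hk] := two_pow_unbounded 1 (b := s0 / 2) ltac:(by rewrite divr_gt0).
pose s : R := (2 ^+ k)^-1.
have s_gt0 : 0 < s by rewrite invr_gt0 exprn_gt0.
have s1 : s <= s0 / 2 by rewrite -[s]mulr1 ler_pdivrMl ?exprn_gt0.
have cpow m : c (2 ^+ m * s) = (c s ^+ (2 ^ m)%N)%g.
  elim: m => [|m IH]; first by rewrite expr0 mul1r expn0 expg1.
  rewrite exprS expnS mulnC expgnA -IH expg2 -cD; congr c.
  by rewrite -mulrA mulrDl !mul1r.
have -> : 1 = 2 ^+ k * s by rewrite mulfV// gt_eqF// exprn_gt0.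
rewrite cpow.
have [_ <-] := small s s_gt0 ltac:(lra).
rewrite (key s s_gt0 s1).
have E : scaled x k 1 = (ex (s *: x) ^+ (2 ^ k)%N)%g by rewrite /scaled div1r.
rewrite -E (@scaled_le x 0 k 1)//; last by rewrite /covers scale1r expr0 mul1r; have := r_gt0; lra.
by rewrite /scaled expr0 divr1 expn0 expg1 scale1r.
Qed.

(** [one_paramP] ensures that [xget] returns a one-parameter subgroup instead of its default, and
    uniqueness applies to whichever one it returns. *)
Lemma lie_exp_ex (x : V) : `|x| <= r / 4 -> lie_exp G x = ex x.
Proof.
move=> xr; rewrite /lie_exp.
apply: (one_param_subgroup_unique _ xr).
exact: (xgetPex (fun=> 1%g) (ex_intro [set c | one_param_subgroup c x] _ (one_paramP x))).
Qed.

End OneParameterSubgroups.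

(** * The Lie bracket as the second-order term of the multiplication *)

Section Bracket.
Variables (R : realType) (n : nat) (G : lieGroupType R n).
Local Notation V := 'rV[R]_n.
Local Notation c1 := (chart1 G).
Local Notation p0 := (chart1 G 1%g).

(** Near the unit the left-invariant field at u is the partial derivative of the multiplication in
    the second variable at (u, p0); differentiating in u gives the mixed second derivative. *)
Lemma left_field_bilin (z w : V) :
  'd (left_field G w) p0 z = bilin (@chart_mul _ _ G) p0 z w.
Proof.
have nd := mul_dom_near G.
have E : \forall u \near p0, 'd (@chart_mul _ _ G) (u, p0) (0, w) = left_field G w u.
  have /nearN [d d0 H] := nd; apply/nearN; exists d => // u ud.
  have dm : mul_dom G (u, p0).
    by apply: H; rewrite norm_pair_lt /= subrr normr0 d0 andbT.
  have dF := chart_mul_diff dm.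
  have [K K0 HK] := framed_bounded ('d (@chart_mul _ _ G) (u, p0)) (framed_prod (framed_row R n) (framed_row R n)).
  have lin : linear (fun h : V => 'd (@chart_mul _ _ G) (u, p0) (0, h)).
    move=> a x y; rewrite (_ : (0, a *: x + y) = a *: (0, x) + (0, y)) ?linearP//.
    by apply: injective_projections => /=; rewrite ?scaler0 ?addr0.
  have [|_ dE] := has_diff_linear (K := K) lin _ (has_diff_partial2 dF).
    by move=> h; apply: le_trans (HK _) _; rewrite ler_pM2l// norm_pair_le normr0 normr_ge0 lexx.
  by rewrite /left_field -(congr1 (fun f => f w) dE).
have ddF h : differentiable (fun w => 'd (@chart_mul _ _ G) w h) (p0, p0).
  by apply: chart_mul_diff2; exact: nbhs_singleton nd.
have H := has_diff_near E (partial_diff ddF w).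
have [K K0 HK] := framed_bounded ('d (fun p => 'd (@chart_mul _ _ G) p (0, w)) (p0, p0)) (framed_prod (framed_row R n) (framed_row R n)).
have lin : linear (fun z : V => bilin (@chart_mul _ _ G) p0 z w).
  have gen (M : {linear (V * V)%type -> V}) : linear (fun z : V => M (z, 0)).
    move=> a x y; rewrite (_ : (a *: x + y, 0) = a *: (x, 0) + (y, 0)) ?linearP//.
    by apply: injective_projections => /=; rewrite ?scaler0 ?addr0.
  exact: (gen ('d (fun p => 'd (@chart_mul _ _ G) p (0, w)) (p0, p0))).
have [|_ dE] := has_diff_linear (K := K) lin _ H.
  by move=> h; apply: le_trans (HK _) _; rewrite ler_pM2l// norm_pair_le normr0 normr_ge0 lexx.
by rewrite dE.
Qed.

Lemma lie_bracketE (z w : V) : lie_bracket G z w =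
  bilin (@chart_mul _ _ G) p0 z w - bilin (@chart_mul _ _ G) p0 w z.
Proof. by congr (_ - _); exact: left_field_bilin. Qed.

Lemma lie_bracketC (z w : V) : lie_bracket G z w = - lie_bracket G w z.
Proof. by rewrite !lie_bracketE opprB. Qed.

End Bracket.


Section AdaptedLogs.
Variables (R : realType) (n : nat) (G : lieGroupType R n).
Local Notation V := 'rV[R]_n.
Local Notation c1 := (chart1 G).
Local Notation p0 := (chart1 G 1%g).

(** Bookkeeping for [Ad_bracket]: X is the common chart value of exp a exp b and exp A exp a,
    compared with the products Fab and Fba of the uncorrected arguments. Each bracketed group is a
    remainder estimated separately. *)
Lemma bracket_combination (p a b Ea Eb EA A X Fab Fba B1 B2 : V) :
  A - b - (B1 - B2) = (Fab - p - a - b - B1) - (Fba - p - b - a - B2)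
    + (X - Fab - (Ea - a) - (Eb - b)) - (X - Fba - (EA - b) - (Ea - a))
    - (EA - Eb - (A - b)).
Proof. by rowring. Qed.

(** Expand both sides of exp a exp b = exp A exp a in the chart, with a = h z, b = h w and A = Ad
    (exp a) b. By [mul_taylor] the difference of the second-order terms is [a, b]. The three
    summands of K are the cubic errors of passing to a and b in the two products and from A - b to
    its chart value. *)
Lemma Ad_bracket (ex : V -> G) (Log : G -> V) (r C : R) (L : local_log ex Log r C) :
  C * r <= 1 / 16 ->
  (forall z w, `|z| <= r -> `|w| <= r ->
    (ex z * ex w * (ex z)^-1)%g = ex (Ad (ex z) w) /\ `|Ad (ex z) w| <= 4 * `|w|) ->
  forall z w, little_o 1 (fun h => `|Ad (ex (h *: z)) w - w - h *: lie_bracket G z w|).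
Proof.
move=> Cr AdL z w.
have r0 := log_r_gt0 L; have C0 := log_C_gt0 L.
have nd := mul_dom_near G.
have dF : \forall w \near (p0, p0), differentiable (@chart_mul _ _ G) w.
  by move: nd; apply: filterS; exact: chart_mul_diff.
have ddF h : differentiable (fun w => 'd (@chart_mul _ _ G) w h) (p0, p0).
  by apply: chart_mul_diff2; exact: nbhs_singleton nd.
have [r1 [C1 [r10 C10 HF]]] := mul_strict dF ddF (chart_mul_left G) (chart_mul_right G).
have T z' w' := mul_taylor dF ddF (chart_mul_left G) (chart_mul_right G) z' w'.
set F := @chart_mul _ _ G in HF T.
pose m := 8 * (`|z| + `|w|) + 1.
have m0 : 0 < m by rewrite ltr_wpDl// mulr_ge0// addr_ge0.
pose K := C1 * (2 * C) + C1 * (18 * C) + C * (16 * C).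
(* Linearity in w trades the claim at order 1 for one at order 2 about h w, where both arguments
   shrink together. *)
suff main : little_o 2 (fun h => `|Ad (ex (h *: z)) (h *: w) - h *: w - (h * h) *: lie_bracket G z w|).
  move=> e /main [d d0 Hd]; exists d => // h h0 hd; rewrite expr1.
  have := Hd h h0 hd; rewrite AdZ -scalerA -!scalerBr normrZ gtr0_norm// expr2.
  by rewrite mulrCA ler_pM2l.
pose tau z' w' h := `|F (p0 + h *: z', p0 + h *: w') - p0 - h *: z' - h *: w' -
   (h * h) *: bilin F p0 z' w'|.
have lt z' w' : little_o 2 (tau z' w').
  move=> e /(T z' w') [d d0 Hd]; exists d => // h h0 hd; rewrite expr2.
  by apply: Hd; rewrite gtr0_norm.
pose s0 := Num.min (r / 4) r1 / m.
have s00 : 0 < s0 by rewrite divr_gt0// lt_min r10 divr_gt0.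
apply: (@little_o_le _ _ _ (fun h => tau z w h + tau w z h + (K * (m * m * m)) * h ^+ 3) s0 s00); last first.
  by apply: little_oD; [exact: little_oD|exact: little_oX].
move=> h h0; rewrite ltr_pdivlMr// lt_min => /andP[hr hr1].
set rho := h * m in hr hr1.
have rho0 : 0 < rho by rewrite mulr_gt0.
have rr : rho <= r by lra.
have nz := normr_ge0 z; have nw := normr_ge0 w.
have scl (k : R) (x : V) : k * `|x| <= m -> k * `|h *: x| <= rho.
  by move=> kx; rewrite normrZ gtr0_norm// mulrCA ler_pM2l.
have a8 : 8 * `|h *: z| <= rho by apply: scl; rewrite /m; lra.
have b8 : 8 * `|h *: w| <= rho by apply: scl; rewrite /m; lra.
have [a1 b1] : `|h *: z| <= rho /\ `|h *: w| <= rho.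
  by have := normr_ge0 (h *: z); have := normr_ge0 (h *: w); lra.
have ar : 4 * `|h *: z| <= r by have := normr_ge0 (h *: z); lra.
set a := h *: z in a8 a1 ar *; set b := h *: w in b8 b1 *.
have [EC Ale] := AdL a b (le_trans a1 rr) (le_trans b1 rr).
set A := Ad (ex a) b in EC Ale *.
have A1 : `|A| <= rho by have := normr_ge0 b; lra.
have A1r := le_trans A1 rr; have a1r := le_trans a1 rr; have b1r := le_trans b1 rr.
pose E x := chart_phi (ex x).
have Ele x : `|x| <= r -> `|E x| <= 2 * `|x| := @ex_chart_le _ _ _ _ _ _ _ L Cr x.
have Ea : `|E a| <= rho by have := Ele _ a1r; have := normr_ge0 a; lra.
have Eb : `|E b| <= rho by have := Ele _ b1r; have := normr_ge0 b; lra.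
have EA : `|E A| <= rho by have := Ele _ A1r; have := normr_ge0 b; lra.
have sq x : `|x| <= rho -> `|E x - x| <= C * (rho * rho).
  move=> xr; apply: le_trans (ex_chart_sub L (le_trans xr rr)) _.
  by rewrite -mulrA ler_pM2l//; apply: ler_pM.
have FE x y : `|x| <= r -> `|y| <= r -> F (p0 + E x, p0 + E y) = c1 (ex x * ex y)%g.
  by move=> xr yr; rewrite /F /chart_mul /= -/(chart_psi _ _) -/(chart_psi G (E y)) -!(ex_psi L).
have FF : F (p0 + E a, p0 + E b) = F (p0 + E A, p0 + E a).
  by rewrite !FE// -(Ad_conj AdL).
have h1 := HF rho (E a) (E b) a b hr1 Ea Eb a1 b1.
have h2 := HF rho (E A) (E a) b a hr1 EA Ea b1 a1.
have h3 := (ex_chart L).2 rho A b rr A1 b1; rewrite scale1r /= -/(E _) -/(E b) in h3.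
have Ab : `|A - b| <= 16 * C * (rho * rho).
  apply: le_trans (Ad_sub L AdL b ar) _.
  rewrite -mulrA; apply: ler_wpM2l; first by rewrite mulr_ge0// ltW.
  exact: ler_pM.
have sa := sq _ a1; have sb := sq _ b1; have sA := sq _ A1.
have rr2 : 0 <= rho * rho by rewrite mulr_ge0// ltW.
have C1rho0 : 0 <= C1 * rho by rewrite mulr_ge0// ltW.
have Crho0 : 0 <= C * rho by rewrite mulr_ge0// ltW.
have EAb : `|E A - b| <= 17 * C * (rho * rho).
  rewrite (_ : E A - b = (E A - A) + (A - b)); last by rowring.
  apply: le_trans (ler_normD _ _) _.
  rewrite (_ : 17 * C * _ = C * (rho * rho) + 16 * C * (rho * rho)); last by ring.
  exact: lerD.
have k1 : C1 * rho * (`|E a - a| + `|E b - b|) <= C1 * (2 * C) * (rho * (rho * rho)).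
  rewrite (_ : C1 * (2 * C) * _ = C1 * rho * (C * (rho * rho) + C * (rho * rho))); last by ring.
  by apply: ler_wpM2l => //; exact: lerD.
have k2 : C1 * rho * (`|E A - b| + `|E a - a|) <= C1 * (18 * C) * (rho * (rho * rho)).
  rewrite (_ : C1 * (18 * C) * _ = C1 * rho * (17 * C * (rho * rho) + C * (rho * rho))); last by ring.
  by apply: ler_wpM2l => //; exact: lerD.
have k3 : C * rho * `|A - b| <= C * (16 * C) * (rho * (rho * rho)).
  rewrite (_ : C * (16 * C) * _ = C * rho * (16 * C * (rho * rho))); last by ring.
  by apply: ler_wpM2l.
have -> : K * (m * m * m) * h ^+ 3 = K * (rho * (rho * rho)) by rewrite /rho; ring.
rewrite lie_bracketE scalerBr.
rewrite (bracket_combination p0 a b (E a) (E b) (E A) A (F (p0 + E a, p0 + E b))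
  (F (p0 + a, p0 + b)) (F (p0 + b, p0 + a))).
rewrite {2}FF; apply: le_trans (ler_normB _ _) _.
apply: le_trans (lerD (ler_normB _ _) (lexx _)) _.
apply: le_trans (lerD (lerD (ler_normD _ _) (lexx _)) (lexx _)) _.
apply: le_trans (lerD (lerD (lerD (ler_normB _ _) (lexx _)) (lexx _)) (lexx _)) _.
rewrite -/(tau z w h) -/(tau w z h).
set X := rho * (rho * rho) in k1 k2 k3 *.
have -> : K * X = C1 * (2 * C) * X + C1 * (18 * C) * X + C * (16 * C) * X.
  by rewrite /K (mulrDl _ _ X) (mulrDl _ _ X).
have h1' := le_trans h1 k1; have h2' := le_trans h2 k2; have h3' := le_trans h3 k3.
rewrite (addrA _ _ (C * (16 * C) * X)) (addrA _ (C1 * (2 * C) * X)).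
apply: lerD h3'; apply: lerD h2'; apply: lerD h1'; exact: lexx.
Qed.

(** All local identities on one common radius, together with the identification of [ex] with the
    exponential map. *)
Record adapted_log (ex : V -> G) (Log : G -> V) (r C : R) : Prop := AdaptedLog {
  al_log : local_log ex Log r C;
  al_small : C * r <= 1 / 16;
  al_line : forall (z : V) (s t : R), `|s *: z| <= r -> `|t *: z| <= r ->
    (ex (s *: z) * ex (t *: z))%g = ex ((s + t) *: z);
  al_opp : forall z, `|z| <= r -> ex (- z) = (ex z)^-1%g;
  al_Ad : forall z w, `|z| <= r -> `|w| <= r ->
    (ex z * ex w * (ex z)^-1)%g = ex (Ad (ex z) w);
  al_Ad_sub : forall z w, `|z| <= r -> `|Ad (ex z) w - w| <= 16 * C * `|z| * `|w|;
  al_Ad_self : forall z, `|z| <= r -> Ad (ex z) z = z;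
  al_bracket : forall z w,
    little_o 1 (fun h => `|Ad (ex (h *: z)) w - w - h *: lie_bracket G z w|);
  al_exp : forall x, `|x| <= r -> lie_exp G x = ex x }.

Lemma exists_adapted_log : exists ex Log r C, adapted_log ex Log r C.
Proof.
have [ex [Log [r0 [C L0]]]] := exists_local_log G.
have r00 := log_r_gt0 L0; have C0 := log_C_gt0 L0.
have [r1 [r10 r1r0 Cr1]] : exists r1 : R, [/\ 0 < r1, r1 <= r0 & C * r1 <= 1 / 16].
  exists (Num.min r0 ((16 * C)^-1)); split.
  - by rewrite lt_min r00 invr_gt0 mulr_gt0.
  - by rewrite ge_min lexx.
  - apply: (@le_trans _ _ (C * (16 * C)^-1)); first by rewrite ler_pM2l// ge_min lexx orbT.
    by rewrite invfM mulrCA mulfV ?gt_eqF// mulr1 div1r.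
have L1 := local_log_shrink L0 r10 r1r0.
have [r2 [r20 r2r1] AdL] := Ad_log L1 Cr1.
have L2 := local_log_shrink L1 r20 r2r1.
have Cr2 : C * r2 <= 1 / 16 by apply: le_trans Cr1; rewrite ler_pM2l.
(* The factor 8 is the one required by [ex_line_add], the factor 4 below the one in [lie_exp_ex]. *)
have r30 : 0 < r2 / 8 by rewrite divr_gt0.
have r3r2 : r2 / 8 <= r2 by lra.
have L3 := local_log_shrink L2 r30 r3r2.
have Cr3 : C * (r2 / 8) <= 1 / 16 by apply: le_trans Cr2; rewrite ler_pM2l.
have line (z : V) (s t : R) : `|s *: z| <= r2 / 8 -> `|t *: z| <= r2 / 8 ->
    (ex (s *: z) * ex (t *: z))%g = ex ((s + t) *: z).
  by move=> sz tz; apply: (ex_line_add L2 Cr2 AdL); lra.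
have r40 : 0 < r2 / 8 / 4 by rewrite divr_gt0.
have r4r3 : r2 / 8 / 4 <= r2 / 8 by lra.
have L4 := local_log_shrink L3 r40 r4r3.
have Cr4 : C * (r2 / 8 / 4) <= 1 / 16 by apply: le_trans Cr3; rewrite ler_pM2l.
exists ex, Log, (r2 / 8 / 4), C; split => //.
- by move=> z s t sz tz; apply: line; exact: le_trans r4r3.
- by move=> z zr; apply: (ex_opp L2 Cr2 AdL); lra.
- by move=> z w zr wr; have [] := AdL z w ltac:(lra) ltac:(lra).
- by move=> z w zr; apply: (Ad_sub L2 AdL); lra.
- by move=> z zr; apply: (Ad_self L2 AdL); lra.
- exact: Ad_bracket L2 Cr2 AdL.
- by move=> x xr; apply: (lie_exp_ex L3 Cr3 line).
Qed.

End AdaptedLogs.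

(** * Expansion of the product in logarithmic coordinates *)

(* The part of the structure of the group near 1, read in the coordinates Log,
   that the metric asymptotics need: A z = Ad (exp z) and
   M a b = log (exp a * exp b). *)
Record log_calculus (R : realType) (n : nat) (A br M : 'rV[R]_n -> 'rV[R]_n -> 'rV[R]_n)
    (r C : R) : Prop := LogCalculus {
  lc_r_gt0 : 0 < r;
  lc_C_gt0 : 0 < C;
  lc_small : C * r <= 1 / 16;
  lc_linear : forall z, linear (A z);
  lc_Ad_sub : forall z w, `|z| <= r -> `|A z w - w| <= 16 * C * `|z| * `|w|;
  lc_Ad_self : forall z, `|z| <= r -> A z z = z;
  lc_Ad_double : forall z w, 2 * `|z| <= r -> A (z + z) w = A z (A z w);
  lc_brC : forall z w, br z w = - br w z;
  lc_br : forall z w, little_o 1 (fun h => `|A (h *: z) w - w - h *: br z w|);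
  lc_mul0 : forall a, `|a| <= r -> M a 0 = a;
  lc_mulN : forall a, `|a| <= r -> M (- a) a = 0;
  lc_mul_self : forall a, `|a| <= r / 2 -> M a a = a + a;
  lc_strict : forall rho a b a' b',
    rho <= r -> `|a| <= rho -> `|b| <= rho -> `|a'| <= rho -> `|b'| <= rho ->
    `|M a b - M a' b' - (a - a') - (b - b')| <= C * rho * (`|a - a'| + `|b - b'|);
  lc_doublel : forall a b, `|a| <= r / 64 -> `|b| <= r / 64 ->
    M (a + a) (b + b) = M (A a (M a b)) (M a b);
  lc_doubler : forall a b, `|a| <= r / 64 -> `|b| <= r / 64 ->
    M (a + a) (b + b) = M (M a b) (A (- b) (M a b));
  lc_double_sym : forall a b, `|a| <= r / 64 -> `|b| <= r / 64 ->
    A (a + a) (M (- (a + a + (a + a))) (b + b)) =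
    M (A (- a) (A a (M (- (a + a)) b))) (A a (A a (M (- (a + a)) b))) }.

Section AdaptedCalculus.
Variables (R : realType) (n : nat) (G : lieGroupType R n).
Local Notation V := 'rV[R]_n.
Variables (ex : V -> G) (Log : G -> V) (r C : R).
Hypothesis AL : adapted_log ex Log r C.
Local Notation M a b := (Log (ex a * ex b)%g).
Local Notation A z := (Ad (ex z)).

Let L : local_log ex Log r C := al_log AL.
Let r_gt0 : 0 < r := log_r_gt0 L.
Let Cr : C * r <= 1 / 16 := al_small AL.

Lemma Ad_le2 z w : `|z| <= r -> `|A z w| <= 2 * `|w|.
Proof.
move=> zr; have := al_Ad_sub AL w zr; have := norm_le_sub (A z w) w.
have := ler_wpM2r (normr_ge0 w) (C_small L Cr zr); lra.
Qed.

Lemma Ad_le_twice z w (s t : R) : `|z| <= r -> `|w| <= s -> 2 * s <= t -> `|A z w| <= t.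
Proof. by move=> zr ws; apply: le_trans; apply: le_trans (Ad_le2 w zr) _; rewrite ler_pM2l. Qed.

Lemma Ad_double z w : 2 * `|z| <= r -> A (z + z) w = A z (A z w).
Proof.
move=> zr; have nz := normr_ge0 z; have r0 := r_gt0.
have [->|w0] := eqVneq w 0; first by rewrite -(scale0r 0) !AdZ !scale0r.
have r40 : 0 < r / 4 by rewrite divr_gt0.
have r22 : 2 * (r / 4) <= r / 2 by lra.
have r21 : 2 * (r / 2) <= r by lra.
have r2r : r / 2 <= r by lra.
have r4r : r / 4 <= r by lra.
have zr1 : `|z| <= r by lra.
have zzr : `|z + z| <= r by rewrite norm2.
have [a a0 [u ur ->]] := scale_to w0 r40; rewrite !AdZ; congr (_ *: _).
have ur4 : `|u| <= r / 4 by rewrite ur.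
have Au := Ad_le_twice zr1 ur4 r22.
have AAu := Ad_le_twice zr1 Au r21.
have A2u := le_trans (Ad_le_twice zzr ur4 r22) r2r.
have ur1 := le_trans ur4 r4r.
have Au1 := le_trans Au r2r.
apply: (ex_inj L A2u AAu).
by rewrite -(al_Ad AL zzr ur1) -(al_Ad AL zr1 Au1) -(al_Ad AL zr1 ur1) (ex_double L zr1) invgM !mulgA.
Qed.

Lemma mul_self z : `|z| <= r / 2 -> M z z = z + z.
Proof. by move=> zr; have r0 := r_gt0; rewrite -(ex_double L) ?(exK L) ?norm2//; lra. Qed.

Lemma adapted_log_calculus :
  log_calculus (fun z => A z) (lie_bracket G) (fun a b => M a b) r C.
Proof.
have r0 := r_gt0.
have Mle a b (s : R) : s <= r -> `|a| <= s -> `|b| <= s -> `|M a b| <= 4 * s.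
  by move=> sr ar br; have := log_mul_le L Cr sr ar br; lra.
split => //.
- exact: log_C_gt0 L.
- by move=> z; exact: linearP.
- exact: al_Ad_sub AL.
- exact: al_Ad_self AL.
- exact: Ad_double.
- by move=> z w; exact: lie_bracketC.
- exact: al_bracket AL.
- by move=> a ar; exact: log_mul0 L _ ar.
- by move=> a ar; rewrite (al_opp AL ar) mulVg (log1 L).
- exact: mul_self.
- exact: log_strict L.
- move=> a b ar br.
  have e1 : 4 * (r / 64) <= r by lra.
  have e2 : r / 64 <= r by lra.
  have ar' := le_trans ar e2; have br' := le_trans br e2.
  have Mr := le_trans (Mle a b _ e2 ar br) e1.
  rewrite (ex_double L ar') (ex_double L br') -(al_Ad AL ar' Mr) (log_mulK L ar' br').
  by congr Log; rewrite !mulgA mulgVK.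
- move=> a b ar br.
  have e1 : 4 * (r / 64) <= r by lra.
  have e2 : r / 64 <= r by lra.
  have ar' := le_trans ar e2; have br' := le_trans br e2.
  have br2 : `|- b| <= r by rewrite normrN.
  have Mr := le_trans (Mle a b _ e2 ar br) e1.
  rewrite (ex_double L ar') (ex_double L br') -(al_Ad AL br2 Mr) (log_mulK L ar' br').
  by congr Log; rewrite (al_opp AL br') invgK !mulgA mulgK.
- move=> a b ar br; have na := normr_ge0 a; have nb := normr_ge0 b.
  have e1 : 2 * (4 * (r / 32)) <= r / 4 by lra.
  have e2 : r / 4 <= r by lra.
  have e3 : 2 * (r / 4) <= r by lra.
  have e4 : 2 * (4 * (r / 16)) <= r by lra.
  have e5 : 4 * (r / 32) <= r by lra.
  have e6 : 4 * (r / 16) <= r by lra.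
  have e7 : r / 32 <= r by lra.
  have e8 : r / 16 <= r by lra.
  have ar' : `|a| <= r by lra.
  have br' : `|b| <= r by lra.
  have br32 : `|b| <= r / 32 by lra.
  have na' : `|- a| <= r by rewrite normrN.
  have aa : `|a + a| <= r / 32 by rewrite norm2; lra.
  have bb : `|b + b| <= r / 16 by rewrite norm2; lra.
  have aa4 : `|a + a + (a + a)| <= r / 16 by rewrite norm2; lra.
  have aar := le_trans aa e7; have aa4r := le_trans aa4 e8; have bbr := le_trans bb e8.
  have aan : `|- (a + a)| <= r / 32 by rewrite normrN.
  have aa4n : `|- (a + a + (a + a))| <= r / 16 by rewrite normrN.
  have aanr := le_trans aan e7; have aa4nr := le_trans aa4n e8.
  have M1 := Mle (- (a + a)) b _ e7 aan br32.
  have M2 := Mle _ _ _ e8 aa4n bb.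
  have M1r := le_trans M1 e5; have M2r := le_trans M2 e6.
  (* Here exp Z = exp (- a) exp b exp (- a). The claim says that exp (- 2 a) exp (2 b) exp (- 2 a)
     is the product of the conjugates of exp Z by exp (- a) and by exp a. *)
  set Z := A a (M (- (a + a)) b).
  have Zle : `|Z| <= r / 4 by exact: Ad_le_twice ar' M1 e1.
  have Zr := le_trans Zle e2.
  have eZ : ex Z = ((ex a)^-1 * ex b * (ex a)^-1)%g.
    rewrite -(al_Ad AL ar' M1r) (log_mulK L aanr br') (al_opp AL aar) (ex_double L ar').
    by rewrite invgM !mulgA mulgV mul1g.
  clearbody Z.
  have Z1 := Ad_le_twice na' Zle e3; have Z2 := Ad_le_twice ar' Zle e3.
  have A2M := Ad_le_twice aar M2 e4.
  move: (exK L A2M) (al_Ad AL aar M2r) (al_Ad AL na' Zr) (al_Ad AL ar' Zr).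
  move: (A (a + a) _) (A (- a) Z) (A a Z) => T1 T2 T3 E1.
  rewrite (log_mulK L aa4nr bbr) eZ (al_opp AL aa4r) (al_opp AL ar') invgK.
  rewrite (ex_double L aar) (ex_double L ar') (ex_double L br') => E2 E3 E4.
  rewrite -[LHS]E1 -E2 -E3 -E4; congr Log.
  rewrite !invgM !mulgA.
  by rewrite mulgVK !mulgK ?mulgVK ?mulgV ?mul1g.
Qed.

End AdaptedCalculus.


(** * Expansions of the adjoint action and of the product *)

Section AdjointExpansion.
Variables (R : realType) (n : nat).
Local Notation V := 'rV[R]_n.
Variables (A br M : V -> V -> V) (r C : R).
Hypothesis L : log_calculus A br M r C.

Let r_gt0 : 0 < r := lc_r_gt0 L.
Let C_gt0 : 0 < C := lc_C_gt0 L.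
Let Cr : C * r <= 1 / 16 := lc_small L.
Local Notation k0 := (16 * C).
Let k0_ge0 : 0 <= k0. Proof. by rewrite mulr_ge0// ltW. Qed.
Let C_rho (rho : R) : rho <= r -> C * rho <= 1 / 16.
Proof. by move=> rr; apply: le_trans Cr; rewrite ler_pM2l. Qed.

Lemma lc_AdZ z a w : A z (a *: w) = a *: A z w.
Proof.
have h u : A z (a *: w + u) = a *: A z w + A z u := lc_linear L z a w u.
have h0 : A z 0 = 0.
  by have := lc_linear L z 1 0 0; rewrite !scale1r addr0 -[LHS]addr0 => /addrI <-.
by rewrite -[a *: w]addr0 h h0 addr0.
Qed.

Lemma lc_AdD z w w' : A z (w + w') = A z w + A z w'.
Proof. by have := lc_linear L z 1 w w'; rewrite !scale1r. Qed.

Lemma lc_AdB z w w' : A z (w - w') = A z w - A z w'.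
Proof. by rewrite lc_AdD -scaleN1r lc_AdZ scaleN1r. Qed.

Lemma lc_mul_sub rho a b : rho <= r -> `|a| <= rho -> `|b| <= rho ->
  `|M a b - a - b| <= C * rho * `|b|.
Proof.
move=> rr ar br'; have rho0 := le_trans (normr_ge0 _) ar.
have z0 : `|0 : V| <= rho by rewrite normr0.
have := lc_strict L rr ar br' ar z0; rewrite (lc_mul0 L); last exact: le_trans rr.
by rewrite !subr0 !subrr normr0 add0r subr0.
Qed.

Lemma lc_mul_lip rho a b a' b' :
  rho <= r -> `|a| <= rho -> `|b| <= rho -> `|a'| <= rho -> `|b'| <= rho ->
  `|M a b - M a' b'| <= 2 * (`|a - a'| + `|b - b'|).
Proof.
move=> rr ar br' ar' br''; have := lc_strict L rr ar br' ar' br''.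
have h1 := C_rho rr.
have s0 : 0 <= `|a - a'| + `|b - b'| by rewrite addr_ge0.
have := ler_wpM2r s0 h1.
have := norm_le_sub (M a b - M a' b') ((a - a') + (b - b')).
have := ler_normD (a - a') (b - b').
rewrite (_ : _ - ((a - a') + (b - b')) = M a b - M a' b' - (a - a') - (b - b')); last by rowring.
lra.
Qed.

Lemma lc_mul_le rho a b : rho <= r -> `|a| <= rho -> `|b| <= rho -> `|M a b| <= 4 * rho.
Proof.
move=> rr ar br'; have rho0 := le_trans (normr_ge0 _) ar.
have z0 : `|0 : V| <= rho by rewrite normr0.
have := lc_mul_lip rr ar br' z0 z0; rewrite (lc_mul0 L) ?subr0//; first lra.
exact: le_trans rr.
Qed.

Lemma lc_Ad_le2 z w : `|z| <= r -> `|A z w| <= 2 * `|w|.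
Proof.
move=> zr; have := lc_Ad_sub L w zr; have := norm_le_sub (A z w) w.
have := ler_wpM2r (normr_ge0 w) (C_rho zr); lra.
Qed.

Lemma little_o1_cst (c : R) : little_o 1 (fun s => c * s) -> c <= 0.
Proof.
move=> H; apply/ler_addgt0Pr => e e0; rewrite add0r; have [d d0 Hd] := H e e0.
have d20 : 0 < d / 2 by rewrite divr_gt0.
have := Hd (d / 2) d20 ltac:(lra); rewrite expr1 ler_pM2r//.
Qed.

(** Linearity of the bracket in its second argument is inherited from A through this uniqueness of
    the first-order term; antisymmetry then gives the first argument. *)
Lemma bracket_unique z w u :
  little_o 1 (fun h => `|A (h *: z) w - w - h *: u|) -> br z w = u.
Proof.
move=> H; apply/eqP; rewrite -subr_eq0 -normr_eq0 eq_le normr_ge0 andbT.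
apply: little_o1_cst.
apply: little_o_le (ltr01 : 0 < 1 :> R) _ (little_oD (lc_br L z w) H) => s s0 _.
rewrite mulrC -[X in X * _](gtr0_norm s0) -normrZ scalerBr.
rewrite (_ : s *: br z w - s *: u = (A (s *: z) w - w - s *: u) - (A (s *: z) w - w - s *: br z w)); last by rowring.
by rewrite [leRHS]addrC; apply: ler_normB.
Qed.

Lemma bracketZr z (a : R) w : br z (a *: w) = a *: br z w.
Proof.
apply: bracket_unique.
apply: little_o_le (ltr01 : 0 < 1 :> R) _ (little_oZ (normr_ge0 a) (lc_br L z w)) => s s0 _.
rewrite -normrZ le_eqVlt; apply/orP; left; apply/eqP; congr `|_|.
by rewrite lc_AdZ !scalerBr !scalerA [s * a]mulrC.
Qed.

Lemma bracketDr z w w' : br z (w + w') = br z w + br z w'.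
Proof.
apply: bracket_unique.
apply: little_o_le (ltr01 : 0 < 1 :> R) _ (little_oD (lc_br L z w) (lc_br L z w')) => s s0 _.
rewrite (_ : _ - _ - _ = (A (s *: z) w - w - s *: br z w) + (A (s *: z) w' - w' - s *: br z w')).
  exact: ler_normD.
by rewrite lc_AdD; rowring.
Qed.

Lemma bracketNr z w : br z (- w) = - br z w.
Proof. by rewrite -scaleN1r bracketZr scaleN1r. Qed.

Lemma bracketBr z w w' : br z (w - w') = br z w - br z w'.
Proof. by rewrite bracketDr bracketNr. Qed.

Lemma bracketZl (a : R) z w : br (a *: z) w = a *: br z w.
Proof. by rewrite (lc_brC L (_ *: _)) bracketZr (lc_brC L w) scalerN opprK. Qed.

Lemma bracketDl z z' w : br (z + z') w = br z w + br z' w.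
Proof. by rewrite (lc_brC L (_ + _)) bracketDr (lc_brC L z) (lc_brC L z') opprD. Qed.

Lemma bracketBl z z' w : br (z - z') w = br z w - br z' w.
Proof. by rewrite (lc_brC L (_ - _)) bracketBr (lc_brC L z) (lc_brC L z') opprB opprK addrC. Qed.

Lemma bracket_le z w : `|br z w| <= k0 * `|z| * `|w|.
Proof.
rewrite -subr_le0; apply: little_o1_cst.
have m0 : 0 < `|z| + 1 by rewrite ltr_wpDl.
apply: (little_o_le (s0 := r / (`|z| + 1)) _ _ (lc_br L z w)); first by rewrite divr_gt0.
move=> s s0; rewrite ltr_pdivlMr// => sr.
have szr : `|s *: z| <= r.
  by rewrite normrZ gtr0_norm// (le_trans _ (ltW sr))// ler_pM2l// lerDl.
have := lc_Ad_sub L w szr; rewrite normrZ gtr0_norm// => h.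
have := norm_le_sub (s *: br z w) (A (s *: z) w - w).
by rewrite [`|s *: br z w - _|]distrC normrZ gtr0_norm//; lra.
Qed.

(** For f s = A (s z) w - w - s [z, w] the defect f (2 s) - 2 f s is (A (s z) - 1)^2 w, of second
    order in s. *)
Lemma Ad_first z w : `|z| <= r -> `|A z w - w - br z w| <= k0 ^+ 2 * `|z| ^+ 2 * `|w|.
Proof.
move=> zr; pose f (s : R) := A (s *: z) w - w - s *: br z w.
have := @halving_bound R _ f 1 (k0 ^+ 2 * `|z| ^+ 2 * `|w|) 0 _ _ _ 1 ltr01 (lexx 1).
rewrite /f !scale1r expr1n mulr1; apply.
- by rewrite !(exprn_ge0, mulr_ge0) ?(ltW C_gt0).
- move=> s s0 s1.
  have sz : `|s *: z| = s * `|z| by rewrite normrZ gtr0_norm.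
  have szr : 2 * `|s *: z| <= r.
    by rewrite sz; have := normr_ge0 z; have := r_gt0; nra.
  have szr1 : `|s *: z| <= r by have := normr_ge0 (s *: z); lra.
  have -> : A ((s + s) *: z) w = A (s *: z) (A (s *: z) w).
    by rewrite scalerDl (lc_Ad_double L).
  rewrite (_ : _ - _ - _ = A (s *: z) (A (s *: z) w - w) - (A (s *: z) w - w)); last first.
    by rewrite lc_AdB; rowring.
  have h1 := lc_Ad_sub L (A (s *: z) w - w) szr1.
  have h2 := lc_Ad_sub L w szr1.
  apply: le_trans h1 _.
  apply: (@le_trans _ _ (k0 * `|s *: z| * (k0 * `|s *: z| * `|w|))).
    by apply: ler_wpM2l => //; rewrite mulr_ge0.
  by rewrite sz le_eqVlt; apply/orP; left; apply/eqP; ring.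
- by move=> e /(lc_br L z w) [d d0 H]; exists d.
Qed.

(** With u = A (s z) w - w the defect is (A (s z) - 1) u - s^2 [z, [z, w]]. Applying [Ad_first] to u
    and to w bounds it by two equal cubic terms, hence the 2. *)
Lemma Ad_second z w : `|z| <= r ->
  `|A z w - w - br z w - 2^-1 *: br z (br z w)| <= 2 * k0 ^+ 3 * `|z| ^+ 3 * `|w|.
Proof.
move=> zr; pose f (s : R) := A (s *: z) w - w - s *: br z w - (s ^+ 2 / 2) *: br z (br z w).
have := @halving_bound R _ f 1 (2 * k0 ^+ 3 * `|z| ^+ 3 * `|w|) 1 _ _ _ 1 ltr01 (lexx 1).
rewrite /f !scale1r !expr1n mulr1 div1r; apply.
- by rewrite !(exprn_ge0, mulr_ge0) ?(ltW C_gt0).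
- move=> s s0 s1.
  have sz : `|s *: z| = s * `|z| by rewrite normrZ gtr0_norm.
  have szr : 2 * `|s *: z| <= r.
    by rewrite sz; have := normr_ge0 z; have := r_gt0; nra.
  have szr1 : `|s *: z| <= r by have := normr_ge0 (s *: z); lra.
  have -> : A ((s + s) *: z) w = A (s *: z) (A (s *: z) w).
    by rewrite scalerDl (lc_Ad_double L).
  set u := A (s *: z) w - w.
  pose e1 := u - br (s *: z) w.
  have e1le : `|e1| <= k0 ^+ 2 * `|s *: z| ^+ 2 * `|w| by exact: Ad_first.
  have e2le := Ad_first u szr1.
  have ule : `|u| <= k0 * `|s *: z| * `|w| := lc_Ad_sub L w szr1.
  have e3le := bracket_le (s *: z) e1.
  rewrite (_ : _ - _ - _ = (A (s *: z) u - u - br (s *: z) u) + br (s *: z) e1); last first.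
    have -> : br (s *: z) e1 = br (s *: z) u - (s * s) *: br z (br z w).
      by rewrite bracketBr !bracketZl bracketZr scalerA.
    rewrite [in RHS]/u lc_AdB -/u /u !expr2; rowlin.
  apply: le_trans (ler_normD _ _) _.
  have -> : 2 * k0 ^+ 3 * `|z| ^+ 3 * `|w| * s ^+ 3 =
     k0 ^+ 2 * `|s *: z| ^+ 2 * (k0 * `|s *: z| * `|w|) + k0 * `|s *: z| * (k0 ^+ 2 * `|s *: z| ^+ 2 * `|w|).
    by rewrite sz; ring.
  apply: lerD.
    by apply: le_trans e2le _; apply: ler_wpM2l => //; rewrite mulr_ge0// exprn_ge0.
  by apply: le_trans e3le _; apply: ler_wpM2l => //; rewrite mulr_ge0.
- suff : little_o 1 (fun s => `|f s|).
    by move=> H e /H [d d0 Hd]; exists d => // s s0 sd; have := Hd s s0 sd; rewrite expr1.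
  apply: (@little_o_le _ _ _ (fun s => `|A (s *: z) w - w - s *: br z w| +
     (`|br z (br z w)| / 2) * s ^+ 2) 1 ltr01).
    move=> s s0 _; apply: le_trans (ler_normB _ _) _; apply: lerD => //.
    by rewrite normrZ ger0_norm ?divr_ge0 ?exprn_ge0 ?(ltW s0)//; lra.
  by apply: little_oD; [exact: lc_br L z w|exact: little_oX].
Qed.

(** The bracket term is [p, q] / 2. As M p p = 2 p is exact, all errors are measured from the case q
    = p and carry a factor |q - p|. The recursion is exp (2 s p) exp (2 s q) = exp (s p) g exp (- s
    p) g with g = exp (s p) exp (s q). *)
Lemma baker_campbell_hausdorff2 rho p q : rho <= r / 32 -> `|p| <= rho -> `|q| <= rho ->
  `|M p q - (p + q) - 2^-1 *: br p (q - p)| <=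
    (2 * k0 ^+ 2 + k0 * C + 16 * C * k0) * rho ^+ 2 * `|q - p|.
Proof.
move=> rr pr qr; have r0 := r_gt0.
have rho0 : 0 <= rho := le_trans (normr_ge0 _) pr.
set k := q - p.
set K := (_ + _ + _) * rho ^+ 2 * `|k|.
have nk := normr_ge0 k.
have C0 := C_gt0; have k00 := k0_ge0.
have K0 : 0 <= K.
  by rewrite /K !mulr_ge0 ?exprn_ge0 ?addr_ge0 ?mulr_ge0 ?exprn_ge0 ?(ltW C_gt0).
pose B (s : R) := M (s *: p) (s *: q).
pose f (s : R) := B s - s *: (p + q) - (s ^+ 2 / 2) *: br p k.
have := @halving_bound R _ f 1 K 1 K0 _ _ 1 ltr01 (lexx 1).
rewrite /f /B !scale1r !expr1n mulr1 div1r; apply.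
- move=> s s0 s1.
  pose sig := s * rho.
  have sigr : sig <= r / 64 by rewrite /sig; nra.
  have sig0 : 0 <= sig by rewrite mulr_ge0// ltW.
  have sp : `|s *: p| <= sig by rewrite normrZ gtr0_norm// ler_pM2l.
  have sq : `|s *: q| <= sig by rewrite normrZ gtr0_norm// ler_pM2l.
  have sk : `|s *: k| = s * `|k| by rewrite normrZ gtr0_norm.
  have sr : sig <= r by lra.
  have sr2 : sig <= r / 2 by lra.
  have spr := le_trans sp sr; have sqr := le_trans sq sr.
  have Ble : `|B s| <= 4 * sig by have := lc_mul_le sr sp sq; rewrite -/(B s); lra.
  have Br : `|B s| <= r by lra.
  have Bp : `|B s - (s *: p + s *: p)| <= 2 * `|s *: k|.
    have := lc_mul_lip sr sp sq sp sp; rewrite (lc_mul_self L (le_trans sp sr2)) -/(B s).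
    by rewrite subrr normr0 add0r -scalerBr.
  have Bp' : `|B s - (s *: p + s *: p) - s *: k| <= C * sig * `|s *: k|.
    have := lc_strict L sr sp sq sp sp; rewrite (lc_mul_self L (le_trans sp sr2)) -/(B s).
    by rewrite subrr normr0 add0r subr0 -scalerBr.
  (* Since A (s p) fixes s p, B s may be replaced here by its deviation from 2 s p, which is of the
     size of s (q - p). *)
  pose d := A (s *: p) (B s) - B s.
  have dE : d = A (s *: p) (B s - (s *: p + s *: p)) - (B s - (s *: p + s *: p)).
    by rewrite lc_AdB lc_AdD (lc_Ad_self L spr) /d; rowring.
  have dle : `|d| <= k0 * sig * (2 * `|s *: k|).
    rewrite dE; apply: le_trans (lc_Ad_sub L _ spr) _.
    by apply: ler_pM => //; [rewrite mulr_ge0|exact: ler_wpM2l].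
  have dle2 : `|d - br (s *: p) (s *: k)| <= k0 ^+ 2 * sig ^+ 2 * (2 * `|s *: k|) + k0 * sig * (C * sig * `|s *: k|).
    rewrite (_ : d - _ = (d - br (s *: p) (B s - (s *: p + s *: p))) + br (s *: p) (B s - (s *: p + s *: p) - s *: k)).
      apply: le_trans (ler_normD _ _) _; apply: lerD.
        rewrite dE; apply: le_trans (Ad_first _ spr) _.
        apply: ler_pM => //; first by rewrite mulr_ge0// exprn_ge0.
        apply: ler_wpM2l; first by rewrite exprn_ge0.
        by rewrite lerXn2r ?nnegrE.
      apply: le_trans (bracket_le _ _) _.
      by apply: ler_pM => //; [rewrite mulr_ge0|exact: ler_wpM2l].
    by rewrite (bracketBr _ (_ - _)); rowring.
  have E : B (s + s) = M (A (s *: p) (B s)) (B s).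
    by rewrite /B !scalerDl (lc_doublel L) ?(le_trans sp) ?(le_trans sq).
  have AB : `|A (s *: p) (B s)| <= 8 * sig by have := lc_Ad_le2 (B s) spr; lra.
  have s8r : 8 * sig <= r by lra.
  have B8 : `|B s| <= 8 * sig by lra.
  have h := lc_strict L s8r AB B8 B8 B8.
  have B2 : `|B s| <= r / 2 by lra.
  rewrite -E (lc_mul_self L B2) subrr normr0 addr0 subr0 -/d in h.
  rewrite (_ : _ - _ - _ = (B (s + s) - (B s + B s) - d) + (d - br (s *: p) (s *: k))); last first.
    by rewrite bracketZl bracketZr /f !expr2 -/(B s) -/(B (s + s)); rowlin.
  apply: le_trans (ler_normD _ _) _.
  have h' : C * (8 * sig) * `|d| <= C * (8 * sig) * (k0 * sig * (2 * `|s *: k|)).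
    by apply: ler_wpM2l => //; rewrite !mulr_ge0// ltW.
  apply: le_trans (lerD (le_trans h h') dle2) _.
  by rewrite sk /K /sig le_eqVlt; apply/orP; left; apply/eqP; ring.
- move=> e e0.
  have lo := @little_oX R 1 (C * rho * rho + `|br p k| / 2).
  have [d d0 Hd] := lo e e0.
  exists (Num.min 1 d) => [|s s0]; first by rewrite lt_min ltr01.
  rewrite lt_min => /andP[s1 sd]; have := Hd s s0 sd; rewrite expr1; apply: le_trans.
  apply: le_trans (ler_normB _ _) _; rewrite mulrDl; apply: lerD.
    have sp : `|s *: p| <= s * rho by rewrite normrZ gtr0_norm// ler_pM2l.
    have sq : `|s *: q| <= s * rho by rewrite normrZ gtr0_norm// ler_pM2l.
    have sr : s * rho <= r by nra.
    have := lc_mul_sub sr sp sq; rewrite scalerDr opprD addrA => h.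
    apply: le_trans h _; apply: (@le_trans _ _ (C * (s * rho) * (s * rho))).
      by apply: ler_wpM2l => //; rewrite !mulr_ge0// ltW.
    by rewrite le_eqVlt; apply/orP; left; apply/eqP; ring.
  by rewrite normrZ ger0_norm ?divr_ge0 ?exprn_ge0 ?(ltW s0)//; lra.
Qed.

End AdjointExpansion.


Lemma linear_bounded_by_norm (R : realType) (n : nat) (N : 'rV[R]_n -> R) : finsler_norm N ->
  exists2 c : R, 0 < c & forall phi : {scalar 'rV[R]_n}, (forall x, phi x <= N x) ->
    forall x, `|phi x| <= c * `|x|.
Proof.
move=> FN; have [c c0 Nc] := finsler_upper FN; exists c => // phi le x.
rewrite ler_norml; apply/andP; split; last exact: le_trans (le x) (Nc x).
by have := le_trans (le (- x)) (Nc (- x)); rewrite linearN normrN; lra.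
Qed.

(** * Invariance of norming functionals *)

Section NormingInvariance.
Variables (R : realType) (n : nat).
Local Notation V := 'rV[R]_n.
Variables (A br M : V -> V -> V) (r C : R).
Hypothesis L : log_calculus A br M r C.
Variable N : V -> R.
Hypothesis finsler_N : finsler_norm N.
Hypothesis invN : forall z w, N (A z w) = N w.

Let r_gt0 : 0 < r := lc_r_gt0 L.
Let C_gt0 : 0 < C := lc_C_gt0 L.
Let C_rho (rho : R) : rho <= r -> C * rho <= 1 / 16.
Proof. by move=> rr; apply: le_trans (lc_small L); rewrite ler_pM2l. Qed.

Section Functional.
Variables (p : V) (phi : {scalar V}).
Hypothesis phi_le : forall x, phi x <= N x.
Hypothesis phi_p : phi p = N p.

(** For s > 0, phi (A (s w) p) <= N p = phi p, so the derivative phi [w, p] is at most 0; the same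
    for - w gives equality. *)
Lemma norming_bracket w : phi (br w p) = 0.
Proof.
have [c c0 phi_c] := linear_bounded_by_norm finsler_N.
have le0 w' : phi (br w' p) <= 0.
  apply: little_o1_cst; apply: (little_o_le (ltr01 : 0 < 1 :> R) _
    (little_oZ (ltW c0) (lc_br L w' p))) => s s0 _.
  have h1 := phi_le (A (s *: w') p); rewrite invN -phi_p in h1.
  have h2 := phi_c phi phi_le (A (s *: w') p - p - s *: br w' p).
  rewrite !linearB linearZ /= in h2.
  have := ler_norm (- (phi (A (s *: w') p) - phi p - s * phi (br w' p))); rewrite normrN; lra.
apply/eqP; rewrite eq_le le0 /=.
by have := le0 (- w); rewrite -scaleN1r (bracketZl L) linearZ /=; lra.
Qed.

(** [norming_bracket] kills the first-order term, so the deviation is quadratic in t p. Writing A (t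
    p) as the square of A (t p / 2) doubles the number of errors and quarters each, a gain of 1/2
    per step, recorded as 3/4. Vectors are measured by N because A preserves it. *)
Lemma norming_adjoint (t : R) w : `|t *: p| <= r -> phi (A (t *: p) w) = phi w.
Proof.
have [c c0 phi_c] := linear_bounded_by_norm finsler_N.
have [c' c'0 lo] := finsler_lower finsler_N.
pose B := c * ((16 * C) ^+ 2 * c').
have B0 : 0 <= B by rewrite !(exprn_ge0, mulr_ge0) ?ltW// mulr_gt0.
have H k : forall t w, `|t *: p| <= r ->
    `|phi (A (t *: p) w) - phi w| <= B * `|t *: p| ^+ 2 * (3 / 4) ^+ k * N w.
  elim: k => [|k IH] u x ur.
    have -> : phi (A (u *: p) x) - phi x = phi (A (u *: p) x - x - br (u *: p) x).
      rewrite !linearB /= (lc_brC L) (bracketZr L) ?linearN ?linearZ /=.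
      by rewrite norming_bracket !oppr0 scaler0 addr0.
    apply: le_trans (phi_c _ phi_le _) _.
    apply: le_trans (ler_wpM2l (ltW c0) (Ad_first L x ur)) _.
    have -> : B * `|u *: p| ^+ 2 * (3 / 4) ^+ 0 * N x = c * ((16 * C) ^+ 2 * `|u *: p| ^+ 2 * (c' * N x)).
      by rewrite expr0 /B; ring.
    apply: ler_wpM2l; first exact: ltW.
    by apply: ler_wpM2l => //; rewrite mulr_ge0 ?exprn_ge0// mulr_ge0// ltW.
  have uE : u *: p = (u / 2) *: p + (u / 2) *: p by rewrite -scalerDl; congr (_ *: _); lra.
  have un : `|u *: p| = 2 * `|(u / 2) *: p| by rewrite {1}uE norm2.
  have u2 : 2 * `|(u / 2) *: p| <= r by rewrite -un.
  have u2r : `|(u / 2) *: p| <= r by have := normr_ge0 ((u / 2) *: p); lra.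
  rewrite uE.
  rewrite norm2 (lc_Ad_double L)//.
  have h1 := IH _ (A ((u / 2) *: p) x) u2r; have h2 := IH _ x u2r; rewrite invN in h1.
  have := ler_normD (phi (A ((u / 2) *: p) (A ((u / 2) *: p) x)) - phi (A ((u / 2) *: p) x))
    (phi (A ((u / 2) *: p) x) - phi x); rewrite addrA subrK => h3.
  apply: le_trans h3 _; apply: le_trans (lerD h1 h2) _.
  set T := B * _ * _ * _.
  have T0 : 0 <= T.
    apply: mulr_ge0; last exact: finsler_ge0.
    by apply: mulr_ge0; [apply: mulr_ge0 => //; exact: exprn_ge0|rewrite exprn_ge0 ?divr_ge0].
  have -> : B * (2 * `|(u / 2) *: p|) ^+ 2 * (3 / 4) ^+ k.+1 * N x = 3 * T.
    by rewrite /T [(3 / 4) ^+ k.+1]exprS; field.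
  lra.
move=> tr; apply/eqP; rewrite -subr_eq0 -normr_eq0 eq_le normr_ge0 andbT.
apply: (@le0_geometric _ _ (B * `|t *: p| ^+ 2 * N w)) => k.
by rewrite mulrAC; exact: H.
Qed.

End Functional.

(* A functional norming p is invariant under the adjoint action of the line
   through p, so the deviation of M (- z) p from p - z is only seen by it to
   second order in the difference p - z. *)
Lemma finsler_log_triangle : exists2 K : R, 0 < K &
  forall z p, `|z| <= r / 64 -> `|p| <= r / 64 ->
    N p <= N z + N (M (- z) p) + K * `|p - z| ^+ 2.
Proof.
have [c c0 phi_c] := linear_bounded_by_norm finsler_N.
have cC0 := mulr_gt0 c0 C_gt0.
exists (8 * (c * C)) => [|z p zr pr]; first by rewrite mulr_gt0.
have [phi [le pp _]] := subgradient finsler_N p 0.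
pose Q s := M (s *: - z) (s *: p).
pose f s := phi (Q s) - s * phi (p - z).
pose K := 8 * (c * C) * `|p - z| ^+ 2.
have K0 : 0 <= K by rewrite !mulr_ge0 ?exprn_ge0// ltW.
have rho s : 0 < s -> s <= 1 -> [/\ `|s *: - z| <= s * (r / 64), `|s *: p| <= s * (r / 64),
    s * (r / 64) <= r / 64 & `|s *: - z - s *: - p| = s * `|p - z|].
  move=> s0 s1; split; rewrite ?(normrZ, normrN) ?gtr0_norm ?ler_pM2l//.
    by rewrite ler_piMl// divr_ge0// ltW.
  rewrite -scalerBr normrZ gtr0_norm//; congr (_ * `|_|); by rewrite opprK addrC.
have r64 : r / 64 <= r by have := r_gt0; lra.
have M0 s : 0 < s -> s <= 1 -> M (s *: - p) (s *: p) = 0.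
  move=> s0 s1; rewrite scalerN (lc_mulN L)//; have [_ h1 h2 _] := rho s s0 s1.
  by apply: le_trans h1 _; apply: le_trans h2 _.
have small s : 0 < s -> s <= 1 -> `|s *: - p| <= s * (r / 64).
  by move=> s0 s1; have [_ h _ _] := rho s s0 s1; rewrite scalerN normrN.
suff main : `|f 1| <= K * 1 ^+ 2.
  rewrite expr1n mulr1 /f /Q !scale1r mul1r in main.
  have := le z; have := le (M (- z) p); have := ler_norm (- (phi (M (- z) p) - phi (p - z))).
  rewrite normrN -/K => h1 h2 h3; have h4 : phi (p - z) = N p - phi z by rewrite linearB pp.
  lra.
apply: (@halving_bound R _ f 1 K 0 K0 _ _ 1 ltr01 (lexx 1)) => [s s0 s12|e e0].
  have s1 : s <= 1 by lra.
  have [h1 h2 h3 h4] := rho s s0 s1; have h5 := small s s0 s1; have M0s := M0 s s0 s1.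
  have sr := le_trans h3 r64.
  have spr : `|s *: p| <= r by rewrite (le_trans h2)// (le_trans h3).
  have spr' : `|(- s) *: p| <= r by rewrite scaleNr normrN.
  have Qle : `|Q s| <= 2 * (s * `|p - z|).
    by have := lc_mul_lip L sr h1 h2 h5 h2; rewrite M0s !subr0 subrr normr0 addr0 h4.
  have Q4 : `|Q s| <= 4 * (s * (r / 64)) := lc_mul_le L sr h1 h2.
  pose A' := A ((- s) *: p) (Q s).
  (* Here the invariance enters: phi does not see the conjugation by exp (- s p), so the defect of f
     is phi of the second-order remainder of M (Q s) A'. With |Q s| <= 2 s |p - z| this gives the
     constant 8 c C. *)
  have E : Q (s + s) = M (Q s) A'.
    rewrite /Q !scalerDl (lc_doubler L) ?(le_trans h1)// ?(le_trans h2)//.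
    by rewrite -/(Q s) -scaleNr.
  have phiA : phi A' = phi (Q s) := norming_adjoint le pp (Q s) spr'.
  have A1 : `|A' - Q s| <= `|Q s|.
    apply: le_trans (lc_Ad_sub L _ spr') _; have := ler_wpM2r (normr_ge0 (Q s)) (C_rho spr'); lra.
  have A2 : `|A'| <= 2 * `|Q s| by have := norm_le_sub A' (Q s); lra.
  have Q2 : `|Q s| <= 2 * `|Q s| by have := normr_ge0 (Q s); lra.
  have Q2r : 2 * `|Q s| <= r by lra.
  have Qr2 : `|Q s| <= r / 2 by lra.
  have h := lc_strict L Q2r Q2 A2 Q2 Q2.
  rewrite (lc_mul_self L Qr2) subrr normr0 add0r subr0 in h.
  have -> : f (s + s) - f s - f s = phi (M (Q s) A' - (Q s + Q s) - (A' - Q s)).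
    by rewrite /f E !linearB !linearD /= phiA; ring.
  apply: le_trans (phi_c _ le _) _.
  apply: (@le_trans _ _ (c * (C * (2 * `|Q s|) * `|Q s|))).
    apply: ler_wpM2l; first exact: ltW.
    by apply: le_trans h _; apply: ler_wpM2l => //; rewrite mulr_ge0 ?(ltW C_gt0)// mulr_ge0.
  apply: (@le_trans _ _ (c * (C * (2 * (2 * (s * `|p - z|)) * (2 * (s * `|p - z|)))))).
    rewrite ler_pM2l// -!(mulrA C) ler_pM2l//.
    by apply: ler_pM => //; rewrite ?ler_pM2l// mulr_ge0.
  by rewrite /K le_eqVlt; apply/orP; left; apply/eqP; ring.
have [d d0 Hd] := @little_oX R 1 (c * (C * (r / 64) * `|p - z|)) e e0.
exists (Num.min 1 d) => [|s s0]; first by rewrite lt_min ltr01.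
rewrite lt_min => /andP[s1 sd]; have := Hd s s0 sd; rewrite expr1; apply: le_trans.
have [h1 h2 h3 h4] := rho s s0 (ltW s1); have h5 := small s s0 (ltW s1).
have h := lc_strict L (le_trans h3 r64) h1 h2 h5 h2.
rewrite (M0 s s0 (ltW s1)) subrr normr0 addr0 !subr0 h4 in h.
have -> : f s = phi (Q s - (s *: - z - s *: - p)).
  have -> : s *: - z - s *: - p = s *: (p - z) by rewrite -scalerBr opprK addrC.
  by rewrite linearB linearZ.
apply: le_trans (phi_c _ le _) _; apply: le_trans (ler_wpM2l (ltW c0) h) _.
by rewrite le_eqVlt; apply/orP; left; apply/eqP; ring.
Qed.

End NormingInvariance.


(** * Orders of magnitude at 0+ *)

Section BigO.
Variable R : realType.

Lemma near_right0P (P : R -> Prop) :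
  (\forall s \near 0^'+, P s) <-> exists2 d : R, 0 < d & forall s, 0 < s -> s < d -> P s.
Proof.
split=> [/nearN [d d0 H]|[d d0 H]].
  by exists d => // s s0 sd; apply: H => //; rewrite subr0 gtr0_norm.
suff : \forall s \near (0 : R), 0 < s -> P s by [].
apply/nearN; exists d => // s; rewrite subr0 => sd s0.
by apply: H => //; rewrite gtr0_norm in sd.
Qed.

Definition bigO (W : normedModType R) (k : nat) (f : R -> W) : Prop :=
  exists K : R, \forall s \near 0^'+, `|f s| <= K * s ^+ k.

Lemma right0_gt0 : \forall s \near (0 : R)^'+, 0 < s.
Proof. by apply/near_right0P; exists 1. Qed.

Section Rules.
Variables W W' W'' : normedModType R.
Implicit Types f g : R -> W.

Lemma bigO_near k f g : (\forall s \near 0^'+, f s = g s) -> bigO k f -> bigO k g.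
Proof. by move=> fg [K HK]; exists K; apply: filterS2 fg HK => s ->. Qed.

Lemma bigO_eq k f g : (forall s, g s = f s) -> bigO k f -> bigO k g.
Proof. by move=> fg; apply: bigO_near; apply: filterS right0_gt0. Qed.

Lemma bigOD k f g : bigO k f -> bigO k g -> bigO k (fun s => f s + g s).
Proof.
move=> [K HK] [K' HK']; exists (K + K'); apply: filterS2 HK HK' => s h1 h2.
by rewrite mulrDl; apply: le_trans (ler_normD _ _) (lerD h1 h2).
Qed.

Lemma bigON k f : bigO k f -> bigO k (fun s => - f s).
Proof. by move=> [K HK]; exists K; apply: filterS HK => s; rewrite normrN. Qed.

Lemma bigOB k f g : bigO k f -> bigO k g -> bigO k (fun s => f s - g s).
Proof. by move=> Hf /bigON; exact: bigOD. Qed.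

Lemma bigOZ k (a : R) f : bigO k f -> bigO k (fun s => a *: f s).
Proof.
move=> [K HK]; exists (`|a| * K); apply: filterS HK => s h.
by rewrite normrZ -mulrA ler_wpM2l.
Qed.

Lemma bigO_weaken k k' f : (k <= k')%N -> bigO k' f -> bigO k f.
Proof.
move=> kk [K /near_right0P [d d0 H]]; exists `|K|; apply/near_right0P.
exists (Num.min d 1) => [|s s0]; first by rewrite lt_min d0 ltr01.
rewrite lt_min => /andP[sd s1]; apply: le_trans (H s s0 sd) _.
apply: (@le_trans _ _ (`|K| * s ^+ k')).
  by apply: ler_wpM2r; [rewrite exprn_ge0// ltW|exact: ler_norm].
by apply: ler_wpM2l => //; apply: ler_wiXn2l => //; exact: ltW.
Qed.

Lemma bigO_small k f (e : R) : 0 < e -> bigO k.+1 f -> \forall s \near 0^'+, `|f s| <= e.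
Proof.
move=> e0 /(@bigO_weaken 1 k.+1) [//|K /near_right0P [d d0 H]].
have K1 : 0 < `|K| + 1 by rewrite ltr_wpDl.
apply/near_right0P; exists (Num.min d (e / (`|K| + 1))) => [|s s0].
  by rewrite lt_min d0 divr_gt0.
rewrite lt_min ltr_pdivlMr// => /andP[sd se]; apply: le_trans (H s s0 sd) _.
have := ler_wpM2r (ltW s0) (ler_norm K); rewrite expr1; nra.
Qed.

Lemma bigO_bound i m j (B : R) (f : R -> W) (g : R -> W') (h : R -> W'') : 0 <= B ->
  (\forall s \near 0^'+, `|h s| <= B * `|f s| ^+ m * `|g s|) ->
  bigO i f -> bigO j g -> bigO (i * m + j) h.
Proof.
move=> B0 Hh [K HK] [K' HK']; exists (B * K ^+ m * K').
apply: filterS3 Hh HK HK' => s h1 h2 h3; apply: le_trans h1 _.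
rewrite exprD exprM (_ : _ * _ * _ * _ = B * (K * s ^+ i) ^+ m * (K' * s ^+ j)).
  apply: ler_pM => //; first by rewrite mulr_ge0// exprn_ge0.
  apply: ler_wpM2l => //; apply: lerXn2r => //; rewrite nnegrE//.
  exact: le_trans (normr_ge0 _) h2.
by rewrite exprMn; ring.
Qed.

Lemma bigO_line (w : W) : bigO 1 (fun s => s *: w).
Proof.
exists `|w|; apply: filterS right0_gt0 => s s0.
by rewrite normrZ gtr0_norm// mulrC expr1.
Qed.

End Rules.
End BigO.

(** * Expansion of the symmetrized product *)

Section LogExpansion.
Variables (R : realType) (n : nat).
Local Notation V := 'rV[R]_n.
Variables (A br M : V -> V -> V) (r C : R).
Hypothesis L : log_calculus A br M r C.
Implicit Types p q a w : R -> V.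

Let r_gt0 : 0 < r := lc_r_gt0 L.
Let C_gt0 : 0 < C := lc_C_gt0 L.
Let k0_ge0 : 0 <= 16 * C. Proof. by rewrite mulr_ge0// ltW. Qed.

Lemma bigO_bracket i j p q : bigO i p -> bigO j q -> bigO (i + j) (fun s => br (p s) (q s)).
Proof.
move=> Hp Hq; rewrite -(muln1 i); apply: (bigO_bound k0_ge0 _ Hp Hq).
by apply: filterS (right0_gt0 R) => s _; rewrite expr1; exact: bracket_le L _ _.
Qed.

Lemma bigO_Ad i j a w : bigO i.+1 a -> bigO j w ->
  bigO (i.+1 + j) (fun s => A (a s) (w s) - w s).
Proof.
move=> Ha Hw; rewrite -(muln1 i.+1); apply: (bigO_bound k0_ge0 _ Ha Hw).
apply: filterS (bigO_small r_gt0 Ha) => s sr; rewrite expr1; exact: (lc_Ad_sub L (w s) sr).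
Qed.

Lemma bigO_Ad1 i j a w : bigO i.+1 a -> bigO j w ->
  bigO (i.+1 * 2 + j) (fun s => A (a s) (w s) - w s - br (a s) (w s)).
Proof.
move=> Ha Hw; apply: (bigO_bound (exprn_ge0 2 k0_ge0) _ Ha Hw).
apply: filterS (bigO_small r_gt0 Ha) => s sr; exact: (Ad_first L (w s) sr).
Qed.

Lemma bigO_Ad2 i j a w : bigO i.+1 a -> bigO j w ->
  bigO (i.+1 * 3 + j) (fun s => A (a s) (w s) - w s - br (a s) (w s)
    - 2^-1 *: br (a s) (br (a s) (w s))).
Proof.
move=> Ha Hw; apply: (@bigO_bound _ _ _ _ _ _ _ (2 * (16 * C) ^+ 3) _ _ _ _ _ Ha Hw).
  by rewrite mulr_ge0// exprn_ge0.
apply: filterS (bigO_small r_gt0 Ha) => s sr; exact: (Ad_second L (w s) sr).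
Qed.

Lemma bigO_rho p q (e : R) : 0 < e -> bigO 1 p -> bigO 1 q -> exists2 K : R, 0 <= K &
  \forall s \near 0^'+, [/\ `|p s| <= K * s, `|q s| <= K * s & K * s <= e].
Proof.
move=> e0 [K HK] [K' HK']; pose B := `|K| + `|K'|.
have B0 : 0 <= B by rewrite addr_ge0.
exists B => //; have := bigO_small e0 (bigO_line B) => /= sm.
have H : \forall s \near 0^'+, [/\ 0 < s, `|p s| <= K * s ^+ 1 & `|q s| <= K' * s ^+ 1].
  by apply: filterS3 (right0_gt0 R) HK HK'.
apply: filterS2 sm H => s se [s0 h1 h2]; rewrite !expr1 in h1 h2.
have k1 : K * s <= B * s.
  by apply: ler_wpM2r; [exact: ltW|rewrite (le_trans (ler_norm K))// lerDl].
have k2 : K' * s <= B * s.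
  by apply: ler_wpM2r; [exact: ltW|rewrite (le_trans (ler_norm K'))// lerDr].
split; [exact: le_trans k1|exact: le_trans k2|].
by rewrite mulrC; apply: le_trans (ler_norm _) se.
Qed.

Lemma bigO_mul p q : bigO 1 p -> bigO 1 q -> bigO 2 (fun s => M (p s) (q s) - p s - q s).
Proof.
move=> Hp Hq; have [K K0 H] := bigO_rho r_gt0 Hp Hq.
exists (C * K * K); apply: filterS2 H (right0_gt0 R) => s [h1 h2 h3] s0.
apply: le_trans (lc_mul_sub L h3 h1 h2) _.
rewrite (_ : C * K * K * s ^+ 2 = C * (K * s) * (K * s)); last by ring.
by apply: ler_wpM2l => //; rewrite !mulr_ge0// ltW.
Qed.

Lemma bigO_bch j p q : bigO 1 p -> bigO 1 q -> bigO j (fun s => q s - p s) ->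
  bigO (2 + j) (fun s => M (p s) (q s) - (p s + q s) - 2^-1 *: br (p s) (q s - p s)).
Proof.
have e0 : 0 < r / 32 by rewrite divr_gt0.
move=> Hp Hq [D HD]; have [K K0 H] := bigO_rho e0 Hp Hq.
set B := 2 * (16 * C) ^+ 2 + 16 * C * C + 16 * C * (16 * C).
have B0 : 0 <= B by rewrite !addr_ge0 ?mulr_ge0 ?exprn_ge0// ?mulr_ge0// ltW.
exists (B * K ^+ 2 * D).
apply: filterS3 H HD (right0_gt0 R) => s [h1 h2 h3] hD s0.
apply: le_trans (baker_campbell_hausdorff2 L h3 h1 h2) _; rewrite -/B.
rewrite (_ : B * K ^+ 2 * D * _ = B * (K * s) ^+ 2 * (D * s ^+ j)).
  by apply: ler_wpM2l => //; rewrite mulr_ge0 ?exprn_ge0// mulr_ge0// ltW.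
by rewrite exprD exprMn; ring.
Qed.

Section Symmetrized.
Variables h y : V.
Let v := y - (h + h).
Let a (s : R) := s *: h.
(** This is log (exp (- s h) exp (s y) exp (- s h)), a conjugate of log (exp (- 2 s h) exp (s y)).
    Its symmetry is what removes the term of order s^2. *)
Let Z (s : R) := A (a s) (M (- (a s + a s)) (s *: y)).
Let T := br h (br h v) + br v (br h v).

Lemma sym_log_first : bigO 2 (fun s => Z s - s *: v).
Proof.
have aO : bigO 1 a by exact: bigO_line.
have bO : bigO 1 (fun s => s *: y) by exact: bigO_line.
have a2O : bigO 1 (fun s => - (a s + a s)) by apply: bigON; exact: bigOD.
have mO := bigO_mul a2O bO.
have m1 : bigO 1 (fun s => M (- (a s + a s)) (s *: y)).
  apply: bigO_eq (bigOD (bigOD (bigO_weaken _ mO) a2O) bO) => // s; by rowring.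
apply: bigO_eq (bigOD (bigO_Ad aO m1) mO) => s.
by rewrite /Z /v /a; rowring.
Qed.

(** Z (2 s) is the logarithm of exp p exp q, where p and q are the conjugates of Z s by exp (- s h)
    and exp (s h). In p + q the first-order brackets cancel and leave 2 Z + [a, [a, Z]], while
    [p, q - p] / 2 is [Z, [a, Z]] to this order; putting s v for Z gives s^3 T. *)
Lemma sym_log_double : bigO 4 (fun s => Z (s + s) - (Z s + Z s) - s ^+ 3 *: T).
Proof.
have aO : bigO 1 a by exact: bigO_line.
have aN : bigO 1 (fun s => - a s) by exact: bigON.
have E1 := sym_log_first.
have ZO : bigO 1 Z.
  by apply: bigO_eq (bigOD (bigO_weaken _ E1) (bigO_line v)) => // s; rewrite subrK.
pose p s := A (- a s) (Z s); pose q s := A (a s) (Z s).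
have p2 : bigO 2 (fun s => p s - Z s) by exact: bigO_Ad aN ZO.
have q2 : bigO 2 (fun s => q s - Z s) by exact: bigO_Ad aO ZO.
have p1 : bigO 1 p.
  by apply: bigO_eq (bigOD (bigO_weaken _ p2) ZO) => // s; rewrite subrK.
have q1 : bigO 1 q.
  by apply: bigO_eq (bigOD (bigO_weaken _ q2) ZO) => // s; rewrite subrK.
have brN s u : br (- a s) u = - br (a s) u by rewrite -scaleN1r (bracketZl L) scaleN1r.
have p3 := bigO_Ad1 aN ZO; have q3 := bigO_Ad1 aO ZO.
have p4 := bigO_Ad2 aN ZO; have q4 := bigO_Ad2 aO ZO.
have qp2 : bigO 2 (fun s => q s - p s).
  by apply: bigO_eq (bigOB q2 p2) => s; rowring.
have qp3 : bigO 3 (fun s => q s - p s - 2 *: br (a s) (Z s)).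
  apply: bigO_eq (bigOB q3 p3) => s; rewrite -/(p s) -/(q s).
  by rewrite brN; rowring.
have aZ : bigO 2 (fun s => br (a s) (Z s)) by exact: bigO_bracket aO ZO.
have aE : bigO 3 (fun s => br (a s) (Z s - s *: v)) by exact: bigO_bracket aO E1.
have m4 := bigO_bch p1 q1 qp2.
have t1 : bigO 4 (fun s => 2^-1 *: br (p s - Z s) (q s - p s)).
  by apply: bigOZ; exact: bigO_bracket p2 qp2.
have t2 : bigO 4 (fun s => 2^-1 *: br (Z s) (q s - p s - 2 *: br (a s) (Z s))).
  by apply: bigOZ; exact: bigO_bracket ZO qp3.
have t3 : bigO 4 (fun s => br (a s) (br (a s) (Z s - s *: v))) by exact: bigO_bracket aO aE.
have t4 : bigO 4 (fun s => br (Z s - s *: v) (br (a s) (Z s))) by exact: bigO_bracket E1 aZ.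
have t5 : bigO 4 (fun s => br (s *: v) (br (a s) (Z s - s *: v))).
  exact: bigO_bracket (bigO_line v) aE.
have e0 : 0 < r / 64 by rewrite divr_gt0.
have dbl : \forall s \near 0^'+, M (p s) (q s) = Z (s + s).
  apply: filterS2 (bigO_small e0 aO) (bigO_small e0 (bigO_line y)) => s ar yr.
  rewrite /Z /a !scalerDl -/(a s) (lc_double_sym L)//.
(* Here m4 is the Baker-Campbell-Hausdorff remainder and p4, q4 those of the two conjugations; t1
   and t2 replace p and q - p by Z and 2 [a, Z], and t3, t4, t5 replace Z by s v. *)
apply: bigO_near (bigOD m4 (bigOD (bigOD p4 q4) (bigOD (bigOD t1 t2) (bigOD t3 (bigOD t4 t5))))).
apply: filterS dbl => s ->; rewrite -/(p s) -/(q s).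
rewrite !brN (bracketNr L) !opprK.
have -> : br (p s - Z s) (q s - p s) = br (p s) (q s - p s) - br (Z s) (q s) + br (Z s) (p s).
  by rewrite (bracketBl L) [br (Z s) (_ - _)](bracketBr L) opprB addrCA addrC -addrA [in RHS]addrC; rowring.
have -> : br (Z s) (q s - p s - 2 *: br (a s) (Z s)) =
   br (Z s) (q s) - br (Z s) (p s) - 2 *: br (Z s) (br (a s) (Z s)).
  by rewrite !(bracketBr L) (bracketZr L).
have -> : br (a s) (Z s - s *: v) = br (a s) (Z s) - (s * s) *: br h v.
  by rewrite (bracketBr L) {2}/a (bracketZl L) (bracketZr L) scalerA.
have -> : br (a s) (br (a s) (Z s) - (s * s) *: br h v) =
   br (a s) (br (a s) (Z s)) - s ^+ 3 *: br h (br h v).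
  rewrite (bracketBr L) [br (a s) (_ *: _)](bracketZr L) [br (a s) (br h v)](bracketZl L) scalerA.
  by congr (_ - _ *: _); rewrite -mulrA.
have -> : br (s *: v) (br (a s) (Z s) - (s * s) *: br h v) =
   br (s *: v) (br (a s) (Z s)) - s ^+ 3 *: br v (br h v).
  rewrite (bracketBr L) [br _ (_ *: br h v)](bracketZr L) [br _ (br h v)](bracketZl L) scalerA.
  by congr (_ - _ *: _); rewrite -mulrA.
have -> : br (Z s - s *: v) (br (a s) (Z s)) =
   br (Z s) (br (a s) (Z s)) - br (s *: v) (br (a s) (Z s)) by rewrite (bracketBl L).
rewrite /T.
move: (Z (s + s)) (Z s) (p s) (q s) => Z2 Z1 P Q.
move: (br P _) (br Z1 Q) (br Z1 P) (br Z1 (br _ _)) (br (s *: v) _) => x1 x2 x3 x4 x5.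
move: (br (a s) (br _ _)) => x6; move: (br (a s) _) (br h (br _ _)) (br v _) => x7 x8 x9.
by rowlin.
Qed.

(** The 6 comes from (2 s)^3 - 2 s^3 = 6 s^3; the corrected defect is O(s^4), the case k = 2 of
    [halving_bound]. *)
Lemma sym_log_expansion : bigO 4 (fun s => Z s - s *: v - (s ^+ 3 / 6) *: T).
Proof.
have [K /near_right0P [d d0 H]] := sym_log_double.
pose f s := Z s - s *: v - (s ^+ 3 / 6) *: T.
exists `|K|; apply/near_right0P; exists d => // s s0 sd.
apply: (@halving_bound R _ f d `|K| 2) => //; last exact: ltW.
  move=> t t0 td; have td' : t < d by lra.
  rewrite (_ : f (t + t) - f t - f t = Z (t + t) - (Z t + Z t) - t ^+ 3 *: T).
    apply: le_trans (H t t0 td') _; apply: ler_wpM2r; first by rewrite exprn_ge0// ltW.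
    exact: ler_norm.
  rewrite /f; move: (Z _) (Z t) T v => Z2 Z1 T1 v1; rowlin.
have fO : bigO 2 f.
  apply: bigOB sym_log_first _; apply: bigO_weaken (_ : 2 <= 3)%N _ => //.
  exists (`|T| / 6); apply: filterS (right0_gt0 R) => t t0.
  rewrite normrZ ger0_norm; last by rewrite divr_ge0// exprn_ge0// ltW.
  by rewrite le_eqVlt; apply/orP; left; apply/eqP; ring.
move=> e e0; case: fO => K' /near_right0P [d' d'0 H'].
have [d2 d20 H2] := @little_oX R 1 K' e e0.
exists (Num.min d' d2) => [|t t0]; first by rewrite lt_min d'0.
rewrite lt_min => /andP[td td2]; apply: le_trans (H' t t0 td) _.
by have := H2 t t0 td2; rewrite expr1.
Qed.

End Symmetrized.

Variable N : V -> R.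
Hypothesis finsler_N : finsler_norm N.
Hypothesis invN : forall z w : V, N (A z w) = N w.

(* Conjugating by exp (s^2 w) with w = [x, v] / 12 removes the term
   s^3 [v, [x, v]] / 12 of the expansion. *)
Lemma finsler_log_expansion x y :
  bigO 4 (fun s => N (M (- (s *: x)) (s *: y)) -
    N (s *: (y - x) + (s ^+ 3 / 24) *: br x (br x (y - x)))).
Proof.
have [c c0 Nlip] := finsler_lipschitz finsler_N.
pose h := 2^-1 *: x.
have hh : h + h = x by rewrite -scalerDl -div1r -splitr scale1r.
clearbody h; set v := y - x.
pose Z (s : R) := A (s *: h) (M (- (s *: h + s *: h)) (s *: y)).
pose w := 6^-1 *: br h v.
pose u (s : R) := s ^+ 2 *: w.
have := sym_log_expansion h y; have := sym_log_first h y.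
rewrite hh -/v -/Z => Z2 Z4; clearbody v.
have uO : bigO 2 u.
  exists `|w|; apply: filterS (right0_gt0 R) => s s0.
  by rewrite normrZ ger0_norm ?exprn_ge0 1?mulrC// ltW.
have ZO : bigO 1 Z.
  by apply: bigO_eq (bigOD (bigO_weaken _ Z2) (bigO_line v)) => // s; rewrite subrK.
have u4 := bigO_weaken (_ : 4 <= 5)%N (bigO_Ad1 uO ZO).
have b4 : bigO 4 (fun s => br (u s) (Z s - s *: v)) by exact: bigO_bracket uO Z2.
have [K HK] := bigOD (bigOD (u4 isT) Z4) b4.
exists (c * K); apply: filterS HK => s hs.
have -> : N (M (- (s *: x)) (s *: y)) = N (A (u s) (Z s)).
  by rewrite !invN -scalerDr hh.
apply: le_trans (Nlip _ _) _; rewrite -mulrA ler_pM2l//.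
apply: le_trans hs; rewrite le_eqVlt; apply/orP; left; apply/eqP; congr `|_|.
(* With x = 2 h this turns the coefficient 1/6 of [h, [h, v]] into 1/24 for [x, [x, v]]. *)
have -> : br x (br x v) = 4 *: br h (br h v).
  by rewrite -hh !(bracketDl L) (bracketDr L); rowring.
rewrite -/(Z s).
have -> : br (u s) (Z s - s *: v) = br (u s) (Z s) + (s ^+ 3 / 6) *: br v (br h v).
  rewrite (bracketBr L) [br (u s) (s *: v)](bracketZr L) /u /w !(bracketZl L).
  rewrite (lc_brC L (br h v) v).
  by move: (br _ (Z s)) (br v _) => t1 t2; rowlin.
move: (Z s) => z; move: (A (u s) z) (br (u s) z) (br h (br h v)) (br v (br h v)) => x1 x2 x3 x4.
by rowlin.
Qed.

Lemma dir_deriv_bracket x v : dir_deriv N v (br x (br x v)) <= 0.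
Proof.
have [c c0 phi_c] := linear_bounded_by_norm finsler_N.
have [phi [le pv <-]] := subgradient finsler_N v (br x (br x v)).
have p0 : phi (br x v) = 0 := norming_bracket L finsler_N invN le pv x.
have vO : bigO 0 (fun _ => v).
  by exists `|v|; apply: filterS (right0_gt0 R) => s _; rewrite expr0 mulr1.
have [K /near_right0P [d d0 H]] := bigO_Ad2 (bigO_line x) vO.
apply: little_o1_cst; apply: little_o_le d0 _ (@little_oX R 1 (2 * c * K)) => s s0 sd.
have := le_trans (phi_c phi le _) (ler_wpM2l (ltW c0) (H s s0 sd)).
have := le (A (s *: x) v); rewrite invN -pv => h1 h2.
change (1 * 3 + 0)%N with 3%N in h2; rewrite -normrN in h2; have := le_trans (ler_norm _) h2.
rewrite (bracketZl L) !(bracketZl L) (bracketZr L) scalerA !linearB !linearZ /= p0 => h3.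
rewrite -(ler_pM2l s0); set q := phi (br x _) in h3 *.
have -> : s * (2 * c * K * s ^+ 2) = 2 * (c * (K * s ^+ 3)) by ring.
have -> : s * (q * s) = 2 * (2^-1 * (s * s * q)) by field.
rewrite !opprK scaler0 addr0 in h3.
have {}h3 : - phi (A (s *: x) v) + phi v + 2^-1 * (s * s * q) <= c * (K * s ^+ 3) := h3.
by rewrite ler_pM2l//; lra.
Qed.
End LogExpansion.

(** * Lengths of paths *)

Section Curves.
Variables (R : realType) (n : nat).
Local Notation V := 'rV[R]_n.
Local Notation mu := (@lebesgue_measure R).

Lemma abs_continuous_dominated (W W' : normedModType R) a b (f : R -> W) (w : R -> W') (K : R) :
  (forall s t, a <= s -> s <= t -> t <= b -> `|f t - f s| <= K * `|w t - w s|) ->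
  abs_continuous a b w -> abs_continuous a b f.
Proof.
move=> fw acw e e0; have K1 : 0 < `|K| + 1 by rewrite ltr_wpDl.
have [d d0 H] := acw _ (divr_gt0 e0 K1); exists d => // k s t st dis sd.
have := H k s t st dis sd; rewrite ltr_pdivlMr// mulrC => h; apply: le_lt_trans h.
rewrite mulr_sumr; apply: ler_sum => i _; have [si sti ti] := st i.
apply: le_trans (fw _ _ si sti ti) _; apply: ler_wpM2r => //.
by apply: le_trans (ler_norm K) _; rewrite lerDl.
Qed.

Lemma abs_continuous_lipschitz (W : normedModType R) a b (f : R -> W) (K : R) :
  (forall s t, a <= s -> s <= t -> t <= b -> `|f t - f s| <= K * (t - s)) ->
  abs_continuous a b f.
Proof.
move=> fL; apply: (@abs_continuous_dominated _ R^o a b f (fun t => t : R^o) K).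
  by move=> s t sa st tb; rewrite [`|t - s|]ger0_norm ?subr_ge0//; exact: fL.
move=> e e0; exists e => // k s t st _; apply: le_lt_trans.
by apply: ler_sum => i _; have [_ ? _] := st i; rewrite [leLHS]ger0_norm ?subr_ge0.
Qed.

Lemma has_diff_row (g : R -> V) (t : R) (v : V) :
  (forall i, has_diff (fun s => g s 0 i) t (fun s => s *: v 0 i)) ->
  has_diff g t (fun s => s *: v).
Proof.
move=> H e e0.
have near0 i : \forall h \near (0 : R), `|g (t + h) 0 i - g t 0 i - h *: v 0 i| <= e * `|h|.
  by apply/nearN; have [d d0 Hd] := H i e e0; exists d => // h; rewrite subr0; exact: Hd.
have [d d0 Hd] := (nearN _ _).1 (@filter_forall _ _ _ (nbhs (0 : R)) _ near0).
exists d => // h hd; apply: row_norm_le.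
  by rewrite mulr_ge0// ltW.
by move=> i; rewrite !mxE; apply: Hd; rewrite subr0.
Qed.

Lemma abs_continuous_row_has_diff a b (w : R -> V) : a < b -> abs_continuous a b w ->
  {ae mu, forall t, a < t < b -> exists v, has_diff w t (fun s => s *: v)}.
Proof.
move=> ab acw.
have aei i : {ae mu, forall t, a < t < b -> derivable (fun s => w s 0 i) t 1}.
  apply: abs_continuous_derivable => //.
  apply: (@abs_continuous_dominated _ _ a b _ w 1) acw => s t _ _ _.
  by rewrite mul1r; apply: le_trans (coord_le_norm _ i); rewrite !mxE.
have : {ae mu, forall t, forall i, a < t < b -> derivable (fun s => w s 0 i) t 1}.
  by apply: (@filter_forall _ _ _ _ (ae_filter_ringOfSetsType mu)) => i; exact: aei.
apply: filterS; first exact: (ae_filter_ringOfSetsType mu).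
move=> t H tab; exists (\row_i 'D_1 (fun s => w s 0 i) t).
apply: has_diff_row => i; rewrite mxE; apply/is_derive_has_diff.
exact: derivableP (H i tab).
Qed.

(** Real induction: the supremum of the points reached from a is itself reached and cannot lie below
    b. Since P need only be transitive, it may express propagation in one direction. *)
Lemma chain_local (P : R -> R -> Prop) a b : a <= b ->
  (forall t1 t2 t3, a <= t1 -> t1 <= t2 -> t2 <= t3 -> t3 <= b ->
    P t1 t2 -> P t2 t3 -> P t1 t3) ->
  (forall t, a <= t -> t <= b -> exists2 e : R, 0 < e & forall t1 t2,
    a <= t1 -> t1 <= t2 -> t2 <= b -> t - e < t1 -> t2 < t + e -> P t1 t2) ->
  P a b.
Proof.
move=> ab tr loc; pose S := [set t | [/\ a <= t, t <= b & P a t]].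
have Sa : S a.
  have [e e0 H] := loc a (lexx a) ab; split => //.
  by apply: H => //; lra.
have bS : has_sup S by split; [exists a|exists b => t []].
have am : a <= sup S by apply: ub_le_sup => //; case: bS.
have mb : sup S <= b by apply: sup_le_ub; [exists a|move=> t []].
have [e e0 H] := loc _ am mb.
have [s [as_ sb Pas] sm] := sup_adherent e0 bS.
have sm' : s <= sup S by apply: ub_le_sup => //; case: bS.
have Pm : P a (sup S) by apply: tr Pas _ => //; apply: H => //; lra.
have [->//|bm] := eqVneq b (sup S).
have mb' : sup S < b by rewrite lt_neqAle eq_sym bm.
have St : S (Num.min b (sup S + e / 2)).
  have [h1 h2] : sup S <= Num.min b (sup S + e / 2) /\ Num.min b (sup S + e / 2) <= b.
    by rewrite ge_min lexx le_min mb; split => //; lra.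
  split => //; first exact: le_trans h1.
  apply: tr Pm _ => //; apply: H => //; first lra.
  by rewrite gt_min; apply/orP; right; lra.
have : Num.min b (sup S + e / 2) <= sup S by apply: ub_le_sup => //; case: bS.
by rewrite ge_min leNgt mb' /= => h; lra.
Qed.

Lemma Rintegral_itv_split (f : R -> R) a b c : a <= b -> b <= c ->
  mu.-integrable `[a, c] (EFin \o f) ->
  \int[mu]_(t in `[a, c]) f t = \int[mu]_(t in `[a, b]) f t + \int[mu]_(t in `[b, c]) f t.
Proof.
move=> ab bc fi.
have := Rintegral_itvB fi (_ : (BLeft a <= BRight b)%O) (_ : (BRight b <= BRight c)%O).
rewrite !bnd_simp => /(_ ab bc); rewrite Rintegral_itv_obnd_cbnd => [<-|].
  by rewrite addrC subrK.
by apply: integrableS fi => //; apply: subset_itv; rewrite bnd_simp.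
Qed.

End Curves.


(** * Translating a path between charts *)

Section LeftTranslation.
Variables (R : realType) (n : nat) (G : lieGroupType R n).
Local Notation V := 'rV[R]_n.

Lemma has_diff_differentiable_comp (U W : normedModType R) (F : U -> W) (c : R -> U) (t : R) (v : U) :
  framed U -> differentiable F (c t) -> has_diff c t (fun s => s *: v) ->
  exists v', has_diff (F \o c) t (fun s => s *: v').
Proof.
move=> fU dF dc; have [K K0 HK] := framed_bounded ('d F (c t)) fU.
exists ('d F (c t) v).
rewrite (_ : (fun s : R => _) = 'd F (c t) \o (fun s => s *: v)); last first.
  by apply/funext => s /=; rewrite linearZ.
apply: (@has_diff_comp _ _ _ _ _ _ _ _ _ K `|v|) (differentiable_has_diff dF) dc _ _.
  by move=> a b; rewrite -linearB.
by move=> h; rewrite normrZ mulrC.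
Qed.

Lemma has_diff_pair (W W' : normedModType R) (w : W) (c : R -> W') (t : R) (v : W') :
  has_diff c t (fun s => s *: v) -> has_diff (fun s => (w, c s)) t (fun s => s *: (0 : W, v)).
Proof.
move=> H e e0; have [d d0 Hd] := H e e0; exists d => // h hd.
rewrite prod_normE /= ge_max scaler0 subrr subr0 normr0 Hd// andbT.
by rewrite mulr_ge0// ltW.
Qed.

Section Fixed.
Variables (g h : G).
Let c1 : chart R n G := chart_at g.
Let c2 : chart R n G := chart_at h.
Let c : chart R n G := chart_at (g * h)%g.
Let F (w : V * V) : V := c (chart_inv c1 w.1 * chart_inv c2 w.2)%g.
Let dom : set (V * V) := [set w | [/\ chart_cod c1 w.1, chart_cod c2 w.2 &
  chart_dom c (chart_inv c1 w.1 * chart_inv c2 w.2)%g]].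

Lemma chart_inv_near (k : G) (A : set G) : nbhs k A ->
  \forall u \near (chart_at k : chart R n G) k, A (chart_inv (chart_at k : chart R n G) u).
Proof.
move=> nA; have dk : chart_dom (chart_at k : chart R n G) k by exact: chart_at_dom.
apply: (chart_inv_continuous (c := chart_at k : chart R n G)); first by exists k.
by rewrite chart_funK.
Qed.

Lemma chart_cod_near (k : G) :
  \forall u \near (chart_at k : chart R n G) k, chart_cod (chart_at k : chart R n G) u.
Proof.
apply: open_nbhs_nbhs; split; first exact: chart_cod_open.
by exists k => //; exact: chart_at_dom.
Qed.

Lemma mul_dom_near_at : \forall w \near (c1 g, c2 h), dom w.
Proof.
have nd : nbhs (g * h)%g (chart_dom c).
  apply: open_nbhs_nbhs; split; first exact: chart_dom_open.
  exact: chart_at_dom.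
have [[A B] /= [nA nB] AB] := @lie_mul_continuous _ _ G (g, h) _ nd.
exists ([set u | A (chart_inv c1 u) /\ chart_cod c1 u], [set u | B (chart_inv c2 u) /\ chart_cod c2 u]).
  split; apply: filterI; [exact: chart_inv_near|exact: chart_cod_near|
    exact: chart_inv_near|exact: chart_cod_near].
move=> [u w] /= [[Au cu] [Bw cw]]; split => //.
by apply: (AB (chart_inv c1 u, chart_inv c2 w)).
Qed.

Lemma chart_near (k : G) (e : R) : 0 < e -> \forall g' \near k,
  chart_dom (chart_at k : chart R n G) g' /\
  `|(chart_at k : chart R n G) g' - (chart_at k : chart R n G) k| < e.
Proof.
move=> e0; apply: filterI.
  by apply: open_nbhs_nbhs; split; [exact: chart_dom_open|exact: chart_at_dom].
have := @chart_continuous _ _ _ (chart_at k : chart R n G) k (chart_at_dom k).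
move=> /cvgrPdist_lt /(_ e e0); apply: filterS => g'; by rewrite distrC.
Qed.

Lemma left_translation : exists (d K : R) (A : set G), [/\ 0 < d, 0 < K, nbhs g A &
  forall g' u, A g' -> `|u - c2 h| < d ->
    [/\ chart_cod c2 u, chart_dom c (g' * chart_inv c2 u)%g,
      forall u', `|u' - c2 h| < d ->
        `|c (g' * chart_inv c2 u)%g - c (g' * chart_inv c2 u')%g| <= K * `|u - u'| &
      forall (al : R -> V) (t : R) v, al t = u -> has_diff al t (fun s => s *: v) ->
        exists v', has_diff (fun s => c (g' * chart_inv c2 (al s))%g) t (fun s => s *: v')]].
Proof.
have smooth : smooth_on dom F by exact: lie_mul_smooth.
have dF w : dom w -> differentiable F w by have [H _] := smooth 1; exact: H.
have nd := mul_dom_near_at.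
have dFn : \forall w \near (c1 g, c2 h), differentiable F w by apply: filterS nd.
have ddF k : differentiable (fun w => 'd F w k) (c1 g, c2 h).
  by have [_ H] := smooth 2; have [H' _] := H k; apply: H'; exact: nbhs_singleton nd.
have fr := framed_prod (framed_row R n) (framed_row R n).
have [r [C [r0 C0 S]]] := strict_estimate fr dFn ddF.
have [K K0 HK] := framed_bounded ('d F (c1 g, c2 h)) fr.
have /nearN [r1 r10 Hr1] := nd.
have [d [d0 dr dr1]] : exists d : R, [/\ 0 < d, d <= r & d <= r1].
  by exists (Num.min r r1); rewrite lt_min r0 r10 !ge_min !lexx orbT.
exists d, (K + C * r), [set g' | chart_dom c1 g' /\ `|c1 g' - c1 g| < d]; split => //.
- by rewrite addr_gt0// mulr_gt0.
- exact: (chart_near g d0).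
move=> g' u [dg' gd].
have near2 w : `|w - c2 h| < d -> `|(c1 g', w) - (c1 g, c2 h)| < d.
  by move=> wd; rewrite (_ : _ - _ = (c1 g' - c1 g, w - c2 h))// norm_pair_lt gd wd.
have FE w : F (c1 g', w) = c (g' * chart_inv c2 w)%g by rewrite /F /= chart_funK.
move=> ud; have [_ cu du] := Hr1 _ (lt_le_trans (near2 u ud) dr1).
split => //.
- by rewrite /= chart_funK in du.
- move=> u' ud'; rewrite -!FE.
  have := S (c1 g', u) (c1 g', u') (lt_le_trans (near2 u ud) dr) (lt_le_trans (near2 u' ud') dr).
  have := HK ((c1 g', u) - (c1 g', u')).
  have -> : `|(c1 g', u) - (c1 g', u')| = `|u - u'|.
    by rewrite prod_normE/= subrr normr0 max_r.
  set m := Num.max _ _; have mr : m <= r.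
    by rewrite /m ge_max !ltW ?(lt_le_trans (near2 _ _) dr).
  have := norm_le_sub (F (c1 g', u) - F (c1 g', u')) ('d F (c1 g, c2 h) ((c1 g', u) - (c1 g', u'))).
  have : C * m * `|u - u'| <= C * r * `|u - u'| by rewrite ler_wpM2r// ler_pM2l.
  rewrite mulrDl; lra.
- move=> al t v alt dal.
  have dw : differentiable F (c1 g', al t).
    by rewrite alt; apply: dF; apply: Hr1; exact: lt_le_trans (near2 u ud) dr1.
  have [v' Hv'] := has_diff_differentiable_comp (c := fun s => (c1 g', al s)) fr dw (has_diff_pair (c1 g') dal).
  by exists v'; apply: has_diff_near Hv'; apply: filterE => s /=; rewrite FE.
Qed.

End Fixed.
End LeftTranslation.


Lemma abs_continuous_uniform (R : realType) (W : normedModType R) (a b : R) (f : R -> W) :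
  abs_continuous a b f -> forall e : R, 0 < e -> exists2 d : R, 0 < d &
    forall s t, a <= s -> s <= b -> a <= t -> t <= b -> `|t - s| < d -> `|f t - f s| < e.
Proof.
move=> acf e /acf [d d0 H]; exists d => // s t.
wlog st : s t / s <= t => [hwlog|] sa sb ta tb.
  have [st|ts] := leP s t; first exact: hwlog.
  by rewrite distrC [`|f t - _|]distrC; apply: hwlog => //; exact: ltW.
rewrite ger0_norm ?subr_ge0// => tsd.
have := H 1 (fun _ => s) (fun _ => t) _ _; rewrite !big_ord1; apply => //.
by move=> i j _ _ _; rewrite !ord1.
Qed.

Lemma between_near (R : realType) (a b s t : R) :
  `|s - t| < Num.min (t - a) (b - t) -> a < s /\ s < b.
Proof. by rewrite lt_min !ltr_norml => /andP[/andP[? ?] /andP[? ?]]; split; lra. Qed.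

Lemma clip_lt (R : realType) (a b t e : R) : a < b -> a <= t -> t <= b -> 0 < e ->
  Num.max a (t - e) < Num.min b (t + e).
Proof.
by move=> *; rewrite gt_max !lt_min; apply/andP; split; apply/andP; split; lra.
Qed.

Section PathLogs.
Variables (R : realType) (n : nat) (G : lieGroupType R n).
Local Notation V := 'rV[R]_n.
Local Notation c1 := (chart1 G).
Local Notation p0 := (chart1 G 1%g).
Local Notation mu := (@lebesgue_measure R).
Variables (ex : V -> G) (Log : G -> V) (r C : R).
Hypothesis AL : adapted_log ex Log r C.
Variable N : V -> R.
Hypothesis finsler_N : finsler_norm N.
Hypothesis invariant_N : Ad_invariant G N.

Local Notation M a b := (Log (ex a * ex b)%g).
Let L : local_log ex Log r C := al_log AL.
Let LC := adapted_log_calculus AL.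
Let r_gt0 : 0 < r := log_r_gt0 L.
Let C_gt0 : 0 < C := log_C_gt0 L.
Let Cr : C * r <= 1 / 16 := al_small AL.

Lemma log_le_chart (a b : V) : `|a| <= r -> `|b| <= r -> `|a - b| <= 2 * `|c1 (ex a) - c1 (ex b)|.
Proof.
move=> ar br; have [_ H] := ex_chart L; have := H r a b (lexx r) ar br.
rewrite /= /chart_phi opprB addrA subrK scale1r => h.
have h2 : `|c1 (ex a) - c1 (ex b) - (a - b)| <= 1 / 16 * `|a - b|.
  by apply: le_trans h _; exact: ler_wpM2r.
have := norm_le_sub (a - b) (c1 (ex a) - c1 (ex b)); rewrite [`|a - b - _|]distrC.
have := normr_ge0 (c1 (ex a) - c1 (ex b)); lra.
Qed.

(** Absolute continuity is stated in the chart at alpha t0, whereas the speed at t uses the chart at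
    1 after translation by (alpha t)^-1, which varies with t. [left_translation] around the inverse
    of alpha t0 covers these translations on one interval, so they all inherit differentiability at
    the same points t. *)
Lemma path_local_log a b (alpha : R -> G) t0 eta : a < b -> 0 < eta -> eta <= r ->
  abs_continuous_path a b alpha -> a <= t0 -> t0 <= b ->
  exists (e : R) (W : R -> V), [/\ 0 < e,
    forall s, Num.max a (t0 - e) <= s -> s <= Num.min b (t0 + e) ->
      `|W s| <= eta /\ alpha s = (alpha t0 * ex (W s))%g,
    abs_continuous (Num.max a (t0 - e)) (Num.min b (t0 + e)) W &
    {ae mu, forall t, Num.max a (t0 - e) < t < Num.min b (t0 + e) ->
      exists v, has_diff (fun s => c1 ((alpha t)^-1 * alpha s)%g) t (fun s => s *: v)}].
Proof.
move=> ab eta0 etar [_ ACP] at0 tb0; set g0 := alpha t0.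
have t0ab : t0 \in `[a, b] by rewrite in_itv /= at0 tb0.
have [e1 e10] := ACP t0 t0ab; set c2 : chart R n G := chart_at g0.
set a1 := Num.max a (t0 - e1); set b1 := Num.min b (t0 + e1) => -[dom ac].
have [d [K [A [d0 K0 nA tr]]]] := left_translation g0^-1%g g0.
rewrite mulVg -/c1 -/c2 in tr.
have good : \forall k \near g0, [/\ `|Log (g0^-1 * k)%g| < eta,
    ex (Log (g0^-1 * k)%g) = (g0^-1 * k)%g & forall u, `|u - c2 g0| < d ->
    forall (al : R -> V) (t : R) v, al t = u -> has_diff al t (fun s => s *: v) ->
        exists v', has_diff (fun s => c1 (k^-1 * chart_inv c2 (al s))%g) t (fun s => s *: v')].
  have n1 : \forall k \near g0, `|Log (g0^-1 * k)%g| < eta /\ ex (Log (g0^-1 * k)%g) = (g0^-1 * k)%g.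
    have h : (g0^-1 * k)%g @[k --> g0] --> (1%g : G).
      rewrite -(mulVg g0).
      have := @lie_mul_continuous _ _ G (g0^-1%g, g0).
      move=> h X nX; have [[B D] /= [nB nD] BD] := h X nX.
      apply: filterS nD => k Dk; apply: (BD (g0^-1%g, k)); split => //=; exact: nbhs_singleton nB.
    by have := log_near L eta0; exact: h.
  have n2 : \forall k \near g0, forall u, `|u - c2 g0| < d ->
    forall (al : R -> V) (t : R) v, al t = u -> has_diff al t (fun s => s *: v) ->
        exists v', has_diff (fun s => c1 (k^-1 * chart_inv c2 (al s))%g) t (fun s => s *: v').
    have : \forall k \near g0, A k^-1%g by exact: (@lie_inv_continuous _ _ G g0 _ nA).
    by apply: filterS => k Ak u ud; have [_ _ _] := tr _ u Ak ud.
  by apply: filterS2 n1 n2 => k [h1 h2] h3; split.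
have /nearN [d1 d10 good'] := chart_inv_near good.
have [d2 [d20 d2d d2d1]] : exists d2 : R, [/\ 0 < d2, d2 <= d & d2 <= d1].
  by exists (Num.min d d1); rewrite lt_min d0 d10 !ge_min !lexx orbT.
have [e2 e20 unif] := abs_continuous_uniform ac d20.
have [e [e0 ee1 ee2]] : exists e : R, [/\ 0 < e, e <= e1 & e < e2].
  exists (Num.min e1 (e2 / 2)); rewrite lt_min e10 ge_min lexx gt_min; split => //.
    by rewrite divr_gt0.
  by apply/orP; right; lra.
set a' := Num.max a (t0 - e); set b' := Num.min b (t0 + e).
have aa : a1 <= a' by rewrite /a1 /a' ge_max !le_max lexx /=; apply/orP; right; lra.
have bb : b' <= b1 by rewrite /b1 /b' le_min !ge_min lexx /=; apply/orP; right; lra.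
have [ta bt] : a' <= t0 /\ t0 <= b' by rewrite /a' /b' ge_max le_min at0 tb0; split; lra.
have a'b' : a' < b' := clip_lt ab at0 tb0 e0.
have near_s s : a' <= s -> s <= b' -> [/\ chart_dom c2 (alpha s), `|c2 (alpha s) - c2 g0| < d2 &
    chart_inv c2 (c2 (alpha s)) = alpha s].
  move=> as_ sb; have ds : chart_dom c2 (alpha s).
    by apply: dom; rewrite in_itv/= (le_trans aa as_) (le_trans sb bb).
  split; [by []| |by rewrite chart_funK].
  have h1 : a1 <= t0 := le_trans aa ta.
  have h2 : t0 <= b1 := le_trans bt bb.
  apply: (unif t0 s h1 h2 (le_trans aa as_) (le_trans sb bb)).
  have h3 : t0 - e <= s by apply: le_trans as_; rewrite /a' le_max lexx orbT.
  have h4 : s <= t0 + e by apply: le_trans sb _; rewrite /b' ge_min lexx orbT.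
  by rewrite ltr_norml; apply/andP; split; lra.
have goods s : a' <= s -> s <= b' -> [/\ `|Log (g0^-1 * alpha s)%g| < eta,
    ex (Log (g0^-1 * alpha s)%g) = (g0^-1 * alpha s)%g & forall u, `|u - c2 g0| < d ->
    forall (al : R -> V) (t : R) v, al t = u -> has_diff al t (fun s => s *: v) ->
        exists v', has_diff (fun s' => c1 ((alpha s)^-1 * chart_inv c2 (al s'))%g) t (fun s => s *: v')].
  move=> as_ sb; have [_ nd' E] := near_s s as_ sb.
  by have := good' _ (lt_le_trans nd' d2d1); rewrite E.
exists e, (fun s => Log (g0^-1 * alpha s)%g); split => //.
- move=> s as_ sb; have [h1 h2 _] := goods s as_ sb; split; first exact: ltW.
  by rewrite h2 mulVKg.
- apply: (@abs_continuous_dominated _ _ _ _ _ _ (c2 \o alpha) (2 * K)) (abs_continuousS aa bb ac).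
  move=> s t as_ st tb.
  have sb := le_trans st tb; have at_ := le_trans as_ st.
  have [ws es _] := goods s as_ sb; have [wt et _] := goods t at_ tb.
  have [_ ds Es] := near_s s as_ sb; have [_ dt Et] := near_s t at_ tb.
  apply: le_trans (log_le_chart (le_trans (ltW wt) etar) (le_trans (ltW ws) etar)) _.
  rewrite es et -mulrA ler_pM2l//=.
  have [_ _ H _] := tr _ _ (nbhs_singleton nA) (lt_le_trans dt d2d).
  by have := H _ (lt_le_trans ds d2d); rewrite Es Et.
- have := abs_continuous_row_has_diff a'b' (abs_continuousS aa bb ac).
  apply: filterS; first exact: (ae_filter_ringOfSetsType mu).
  move=> t /= H tab; have [v Hv] := H tab; case/andP: tab => at_ tb.
  have [_ _ good3] := goods t (ltW at_) (ltW tb).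
  have [_ dt Et] := near_s t (ltW at_) (ltW tb).
  have [v' Hv'] := good3 _ (lt_le_trans dt d2d) _ t v erefl Hv.
  exists v'; apply: has_diff_near Hv'.
  apply/nearN; exists (Num.min (t - a') (b' - t)) => [|s].
    by rewrite lt_min !subr_gt0 at_.
  move=> /between_near[s1 s2].
  by have [_ _ ->] := near_s s (ltW s1) (ltW s2).
Qed.

End PathLogs.


(** * Lower bound for the length of a path *)

Section PathLength.
Variables (R : realType) (n : nat) (G : lieGroupType R n).
Local Notation V := 'rV[R]_n.
Local Notation c1 := (chart1 G).
Local Notation p0 := (chart1 G 1%g).
Local Notation mu := (@lebesgue_measure R).
Variables (ex : V -> G) (Log : G -> V) (r C : R).
Hypothesis AL : adapted_log ex Log r C.
Variable N : V -> R.
Hypothesis finsler_N : finsler_norm N.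
Hypothesis invariant_N : Ad_invariant G N.

Local Notation M a b := (Log (ex a * ex b)%g).
Let L : local_log ex Log r C := al_log AL.
Let LC := adapted_log_calculus AL.
Let r_gt0 : 0 < r := log_r_gt0 L.
Let C_gt0 : 0 < C := log_C_gt0 L.

Let mul_le (rho : R) (a b : V) : rho <= r -> `|a| <= rho -> `|b| <= rho -> `|M a b| <= 4 * rho.
Proof. by move=> h1 h2 h3; exact: (lc_mul_le LC h1 h2 h3). Qed.

Let mul_lip (rho : R) (a b a' b' : V) :
  rho <= r -> `|a| <= rho -> `|b| <= rho -> `|a'| <= rho -> `|b'| <= rho ->
  `|M a b - M a' b'| <= 2 * (`|a - a'| + `|b - b'|).
Proof. by move=> h1 h2 h3 h4 h5; exact: (lc_mul_lip LC h1 h2 h3 h4 h5). Qed.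

Let triangle : exists2 K : R, 0 < K & forall z p : V, `|z| <= r / 64 -> `|p| <= r / 64 ->
  N p <= N z + N (M (- z) p) + K * `|p - z| ^+ 2.
Proof. by apply: (finsler_log_triangle LC finsler_N) => z w; exact: invariant_N. Qed.

Lemma speed_has_diff (alpha : R -> G) (t : R) (v : V) :
  has_diff (fun s => c1 ((alpha t)^-1 * alpha s)%g) t (fun s => s *: v) ->
  speed N alpha t = N v.
Proof. by move=> /is_derive_has_diff H; rewrite /speed derive1E derive_val. Qed.

(** With q s = log ((alpha t)^-1 alpha s), which is (s - t) v + o(s - t), the triangle inequality
    gives N (p s) - N (p t) <= N (q s) + K |p s - p t|^2, and the last term is O((s - t)^2), so it
    does not reach the derivative. *)
Lemma derive_le_speed (alpha : R -> G) (p : R -> V) (g : G) (t e0 : R) (v : V) : 0 < e0 ->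
  (forall s, `|s - t| < e0 -> `|p s| <= r / 64 /\ alpha s = (g * ex (p s))%g) ->
  has_diff (fun s => c1 ((alpha t)^-1 * alpha s)%g) t (fun s => s *: v) ->
  derivable (N \o p) t 1 -> derive1 (N \o p) t <= speed N alpha t.
Proof.
move=> e00 Hp Hv df; rewrite (speed_has_diff Hv).
have /is_derive_has_diff := derivableP df; rewrite -derive1E; set f' := derive1 _ t => Hf.
have [c c0 Nc] := finsler_upper finsler_N.
have [K K0 HK] := triangle.
have r64 : r / 64 <= r by have := r_gt0; lra.
have r64' : 4 * (r / 64) <= r by have := r_gt0; lra.
have r64'' : r / 64 <= 4 * (r / 64) by have := r_gt0; lra.
have tt : `|t - t| < e0 by rewrite subrr normr0.
have [pt Et] := Hp t tt.
have ptr := le_trans pt r64.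
have npt : `|- p t| <= r / 64 by rewrite normrN.
pose q s := M (- p t) (p s).
pose D s := `|c1 ((alpha t)^-1 * alpha s)%g - p0 - (s - t) *: v|.
have step s : t < s -> s - t < e0 -> D s <= s - t ->
    N (p s) - N (p t) <= (s - t) * N v + c * D s + (c * C + 4 * K) * (4 * (1 + `|v|) ^+ 2) * (s - t) ^+ 2.
  move=> ts se Ds; have st0 : 0 < s - t by rewrite subr_gt0.
  have [ps Es] := Hp s (ltac:(by rewrite gtr0_norm)).
  have psr := le_trans ps r64.
  have nptr := le_trans npt r64.
  have qr4 : `|q s| <= 4 * (r / 64) := mul_le r64 npt ps.
  have qr := le_trans qr4 r64'.
  have qX : ex (q s) = ((ex (p t))^-1 * ex (p s))%g by rewrite (log_mulK L nptr psr) (al_opp AL ptr).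
  have qE : ex (q s) = ((alpha t)^-1 * alpha s)%g.
    by rewrite Et Es invgM !mulgA mulgVK.
  have pE : p s = M (p t) (q s) by rewrite qX mulVKg (exK L psr).
  have z4 : `|0 : V| <= 4 * (r / 64) by rewrite normr0 (le_trans _ qr4).
  have pq : `|p s - p t| <= 2 * `|q s|.
    rewrite pE -[X in _ - X](log_mul0 L ptr).
    have := mul_lip r64' (le_trans pt r64'') qr4 (le_trans pt r64'') z4.
    by rewrite subrr normr0 add0r subr0.
  have q2 : `|q s| <= 2 * (D s + (s - t) * `|v|).
    have z0 : `|0 : V| <= r by rewrite normr0 ltW.
    have := log_le_chart AL qr z0; rewrite subr0 (ex0 L) qE => h; apply: le_trans h _.
    rewrite ler_pM2l//; have := norm_le_sub (c1 ((alpha t)^-1 * alpha s)%g - p0) ((s - t) *: v).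
    have nz : `|(s - t) *: v| = (s - t) * `|v| by rewrite normrZ gtr0_norm.
    by rewrite nz -/(D s) [X in _ <= X -> _]addrC.
  have qd : `|q s - (s - t) *: v| <= D s + C * `|q s| ^+ 2.
    have := ex_chart_sub L qr; rewrite /chart_phi qE -mulrA -expr2 => h.
    rewrite (_ : q s - _ = (c1 ((alpha t)^-1 * alpha s)%g - p0 - (s - t) *: v) -
      (c1 ((alpha t)^-1 * alpha s)%g - p0 - q s)); last by rowring.
    by apply: le_trans (ler_normB _ _) (lerD _ h).
  have Nq : N (q s) <= (s - t) * N v + c * (D s + C * `|q s| ^+ 2).
    rewrite -(finslerZ finsler_N _ (ltW st0)) -[q s in leLHS](subrKC ((s - t) *: v)).
    apply: le_trans (finslerD finsler_N _ _) _; rewrite lerD2l.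
    by apply: le_trans (Nc _) _; rewrite ler_pM2l.
  have inc := HK (p t) (p s) pt ps.
  have pq2 : `|p s - p t| ^+ 2 <= 4 * `|q s| ^+ 2.
    have := lerXn2r 2 (_ : `|p s - p t| \in Num.nneg) (_ : 2 * `|q s| \in Num.nneg) pq.
    by rewrite exprMn !nnegrE normr_ge0 mulr_ge0// => /(_ isT isT); lra.
  have qq : `|q s| ^+ 2 <= 4 * (1 + `|v|) ^+ 2 * (s - t) ^+ 2.
    have q3 : `|q s| <= 2 * ((1 + `|v|) * (s - t)).
      by apply: le_trans q2 _; rewrite ler_pM2l//; lra.
    have b0 : 0 <= 2 * ((1 + `|v|) * (s - t)) := le_trans (normr_ge0 _) q3.
    have := lerXn2r 2 (_ : `|q s| \in Num.nneg) (_ : 2 * ((1 + `|v|) * (s - t)) \in Num.nneg) q3.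
    rewrite !nnegrE normr_ge0 b0 => /(_ isT isT); rewrite !exprMn => h.
    by apply: le_trans h _; rewrite le_eqVlt; apply/orP; left; apply/eqP; ring.
  have k1 : K * `|p s - p t| ^+ 2 <= K * (4 * `|q s| ^+ 2) by rewrite ler_pM2l.
  have k2 : (c * C + 4 * K) * `|q s| ^+ 2 <= (c * C + 4 * K) * (4 * (1 + `|v|) ^+ 2 * (s - t) ^+ 2).
    by apply: ler_wpM2l => //; rewrite addr_ge0// mulr_ge0// ltW.
  rewrite -/(q s) in inc.
  move: inc Nq k1 k2; rewrite mulrDl mulrDr -!mulrA; move: (`|q s| ^+ 2) => Q2.
  by move: (`|p s - p t| ^+ 2) => P2; lra.
have Dlo : little_o 1 (fun h => D (t + h)).
  move=> e e_gt0; have [d d0 Hd] := Hv e e_gt0; exists d => // h h0 hd.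
  have := Hd h; rewrite gtr0_norm// => /(_ hd); rewrite mulVg expr1.
  by rewrite /D [t + h - t]addrC addKr.
have [d1 d10 HD] := Dlo 1 ltr01.
rewrite -subr_le0; apply: little_o1_cst.
set B := (c * C + 4 * K) * _ in step.
apply: (@little_o_le _ _ _ (fun h => `|(N \o p) (t + h) - (N \o p) t - h *: f'| + c * D (t + h) + B * h ^+ 2) (Num.min e0 d1)).
- by rewrite lt_min e00.
- move=> h h0; rewrite lt_min => /andP[he hd].
  have th : t + h - t = h by rewrite addrC addKr.
  have := step (t + h); rewrite th ltrDl => /(_ h0 he).
  have := HD h h0 hd; rewrite expr1 mul1r => /[swap] /[apply] s1.
  have := ler_norm (- ((N \o p) (t + h) - (N \o p) t - h *: f')); rewrite normrN /= => s2.
  have s3 : h *: f' = h * f' by [].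
  rewrite s3 in s2 *; rewrite mulrBl; lra.
- apply: little_oD; last exact: little_oX.
  apply: little_oD; last by apply: little_oZ => //; exact: ltW.
  move=> e e_gt0; have [d d0 Hd] := Hf e e_gt0; exists d => // h h0 hd.
  by have := Hd h; rewrite gtr0_norm// => /(_ hd); rewrite expr1.
Qed.

Lemma speed_ge0 (alpha : R -> G) t : 0 <= speed N alpha t.
Proof. exact: finsler_ge0. Qed.

Lemma local_step (a b : R) (alpha : R -> G) (t0 : R) : a < b -> rectifiable N a b alpha ->
  a <= t0 -> t0 <= b -> exists2 e : R, 0 < e & forall t1 t2,
    a <= t1 -> t1 <= t2 -> t2 <= b -> t0 - e < t1 -> t2 < t0 + e ->
    forall g u, `|u| <= r / 16 / 64 -> alpha t1 = (g * ex u)%g ->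
    exists2 u', alpha t2 = (g * ex u')%g &
      N u' <= N u + \int[mu]_(t in `[t1, t2]) speed N alpha t.
Proof.
(* Each product multiplies the radius by at most 4: from r / 1024 for W and u to r / 256 for z and r
   / 64 for p, the radius demanded by [triangle]. *)
have e0 : 0 < r / 16 / 64 by rewrite !divr_gt0.
have r1024 : r / 16 / 64 <= r by have := r_gt0; lra.
have r256 : 4 * (r / 16 / 64) <= r / 256 by lra.
have r256r : r / 256 <= r by have := r_gt0; lra.
have r64 : 4 * (r / 256) <= r / 64 by lra.
have r1 : r / 16 / 64 <= r / 256 by have := r_gt0; lra.
have [c c0 Nlip] := finsler_lipschitz finsler_N.
move=> ab [acp int] at0 tb0.
have [e [W [e_gt0 HW acW aeW]]] := path_local_log AL ab e0 r1024 acp at0 tb0.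
set a' := Num.max a _ in HW acW aeW; set b' := Num.min b _ in HW acW aeW.
exists e => // t1 t2 at1 t12 tb2 et1 et2 g u ur Eu.
have a1 : a' <= t1 by rewrite /a' ge_max at1 ltW.
have b2 : t2 <= b' by rewrite /b' le_min tb2 ltW.
have [W1 E1] := HW t1 a1 (le_trans t12 b2).
have nW1 : `|- W t1| <= r / 16 / 64 by rewrite normrN.
(* W is centred at alpha t0 but u at g. So log (g^-1 alpha s) is assembled from u and the increment
   z s of the path from t1 to s. *)
pose z s := M (- W t1) (W s); pose p s := M u (z s).
have u256 := le_trans ur r1.
have main s : t1 <= s -> s <= t2 -> [/\ `|W s| <= r / 16 / 64, `|z s| <= r / 256,
    `|p s| <= r / 64 & alpha s = (g * ex (p s))%g].
  move=> s1 s2; have [Ws Es] := HW s (le_trans a1 s1) (le_trans s2 b2).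
  have zs : `|z s| <= r / 256 := le_trans (mul_le r1024 nW1 Ws) r256.
  have ps : `|p s| <= r / 64 := le_trans (mul_le r256r u256 zs) r64.
  split => //.
  rewrite (log_mulK L (le_trans ur r1024) (le_trans zs r256r)).
  rewrite (log_mulK L (le_trans nW1 r1024) (le_trans Ws r1024)).
  by rewrite (al_opp AL (le_trans W1 r1024)) !mulgA -Eu E1 mulgK -Es.
have plip s t : t1 <= s -> s <= t2 -> t1 <= t -> t <= t2 -> `|p t - p s| <= 4 * `|W t - W s|.
  move=> s1 s2 t1' t2'; have [Ws zs _ _] := main s s1 s2; have [Wt zt _ _] := main t t1' t2'.
  have h1 := mul_lip r256r u256 zt u256 zs; have h2 := mul_lip r1024 nW1 Wt nW1 Ws.
  rewrite -/(p t) -/(p s) subrr normr0 add0r in h1.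
  rewrite -/(z t) -/(z s) subrr normr0 add0r in h2; lra.
have acf : abs_continuous t1 t2 (N \o p).
  apply: (@abs_continuous_dominated _ _ _ _ _ _ W (c * 4)) (abs_continuousS a1 b2 acW).
  move=> s t s1 st t2'; apply: le_trans (Nlip _ _) _; rewrite -mulrA ler_pM2l//.
  by apply: plip => //; [exact: le_trans st t2'|exact: le_trans s1 st].
have i12 : mu.-integrable `[t1, t2] (EFin \o speed N alpha).
  apply: integrableS int => //; apply: subset_itv; rewrite bnd_simp//.
have ae12 : {ae mu, forall t, t1 < t < t2 -> derivable (N \o p) t 1 ->
    derive1 (N \o p) t <= speed N alpha t}.
  apply: filterS aeW; first exact: (ae_filter_ringOfSetsType mu).
  move=> t /= Hv /andP[t1t tt2] df.
  have [|v Hv'] := Hv.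
    by rewrite (le_lt_trans a1 t1t) (lt_le_trans tt2 b2).
  apply: (@derive_le_speed alpha p g t (Num.min (t - t1) (t2 - t)) v) => //.
    by rewrite lt_min !subr_gt0 t1t.
  move=> s /between_near[s1 s2].
  by have [] := main s (ltW s1) (ltW s2).
have [_ _ _ E2] := main t2 t12 (lexx t2).
exists (p t2) => //.
have pt1 : p t1 = u.
  rewrite /p /z (lc_mulN LC (le_trans W1 r1024)).
  exact: (log_mul0 L (le_trans ur r1024)).
have := abs_continuous_le_integral t12 acf i12 ae12; rewrite /= pt1; lra.
Qed.

(** A path shorter than N z cannot leave the ball where the coordinates work, because the length
    used so far bounds N of the logarithm. It can thus be followed up to b, where injectivity of
    [ex] identifies its logarithm with z, a contradiction. *)
Lemma path_length_ge (a b : R) (alpha : R -> G) (g : G) (z : V) (c : R) :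
  (forall x, `|x| <= c * N x) -> 0 < c -> a < b -> rectifiable N a b alpha ->
  alpha a = g -> alpha b = (g * ex z)%g -> `|z| <= r -> c * N z <= r / 16 / 64 ->
  N z <= path_length N a b alpha.
Proof.
move=> lo c0 ab rec Ea Eb zr cz; have [acp int] := rec.
rewrite leNgt; apply/negP => Lz.
pose I t1 t2 := \int[mu]_(t in `[t1, t2]) speed N alpha t.
have I0 t1 t2 : 0 <= I t1 t2 by apply: Rintegral_ge0 => x _; exact: speed_ge0.
have Isplit t1 t2 t3 : a <= t1 -> t1 <= t2 -> t2 <= t3 -> t3 <= b -> I t1 t3 = I t1 t2 + I t2 t3.
  move=> h1 h2 h3 h4; apply: Rintegral_itv_split => //.
  by apply: integrableS int => //; apply: subset_itv; rewrite bnd_simp.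
(* The budget c (N u + I t1 t2) bounds the whole excursion in advance; being passed on from one
   interval to the next, it makes P transitive. *)
pose P t1 t2 := forall u, c * (N u + I t1 t2) <= r / 16 / 64 -> alpha t1 = (g * ex u)%g ->
  exists2 u', alpha t2 = (g * ex u')%g & N u' <= N u + I t1 t2.
have Pab : P a b.
  apply: chain_local (ltW ab) _ _ => [t1 t2 t3 h1 h2 h3 h4 P12 P23 u cu Eu|t at0 tb0].
    have E := Isplit t1 t2 t3 h1 h2 h3 h4; rewrite E in cu *.
    have i23 := I0 t2 t3.
    have [|u' Eu' Nu'] := P12 u _ Eu.
      by apply: le_trans cu; rewrite ler_pM2l// addrA lerDl.
    have [|u'' Eu'' Nu''] := P23 u' _ Eu'.
      by apply: le_trans cu; rewrite ler_pM2l// addrA lerD2r.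
    by exists u'' => //; lra.
  have [e e0 H] := local_step ab rec at0 tb0; exists e => // t1 t2 h1 h2 h3 h4 h5 u cu Eu.
  have [|u' Eu' Nu'] := H t1 t2 h1 h2 h3 h4 h5 g u _ Eu; last by exists u'.
  apply: le_trans (lo u) (le_trans _ cu); rewrite ler_pM2l// lerDl; exact: I0.
have [||u' Eu' Nu'] := Pab 0.
- rewrite (finsler0 finsler_N) add0r; apply: le_trans cz; rewrite ler_pM2l//; exact: ltW.
- by rewrite (ex0 L) mulg1.
rewrite (finsler0 finsler_N) add0r in Nu'.
have u'r : `|u'| <= r.
  apply: le_trans (lo u') _; apply: (@le_trans _ _ (r / 16 / 64)); last by have := r_gt0; lra.
  apply: le_trans cz; rewrite ler_pM2l//; apply: le_trans Nu' _; exact: ltW.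
have zu : z = u'.
  by apply: (ex_inj L zr u'r); move: Eb; rewrite Eu' => /mulgI.
by move: Lz; rewrite /path_length -/(I a b) zu ltNge Nu'.
Qed.

End PathLength.


(** * The distance in logarithmic coordinates *)

Section LogDistance.
Variables (R : realType) (n : nat) (G : lieGroupType R n).
Local Notation V := 'rV[R]_n.
Local Notation c1 := (chart1 G).
Local Notation p0 := (chart1 G 1%g).
Local Notation mu := (@lebesgue_measure R).
Variables (ex : V -> G) (Log : G -> V) (r C : R).
Hypothesis AL : adapted_log ex Log r C.
Variable N : V -> R.
Hypothesis finsler_N : finsler_norm N.
Hypothesis invariant_N : Ad_invariant G N.
Let L : local_log ex Log r C := al_log AL.
Let r_gt0 : 0 < r := log_r_gt0 L.
Let C_gt0 : 0 < C := log_C_gt0 L.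
Let Cr : C * r <= 1 / 16 := al_small AL.

Section LogPath.
Variables (g : G) (z : V).
Hypothesis zr : `|z| <= r / 2.
Let alpha (t : R) : G := (g * ex (t *: z))%g.

(** The bound 2 leaves a margin around [0, 1]: the speed at an endpoint involves the path slightly
    beyond it. *)
Lemma scaled_le (s : R) : `|s| <= 2 -> `|s *: z| <= r.
Proof.
move=> s2; rewrite normrZ; apply: (@le_trans _ _ (2 * (r / 2))).
  by apply: ler_pM.
by rewrite mulrC divfK.
Qed.

Lemma log_path_increment (s t : R) : `|s| <= 2 -> `|t| <= 2 ->
  ((alpha t)^-1 * alpha s)%g = ex ((s - t) *: z).
Proof.
move=> s2 t2; have sr := scaled_le s2; have tr := scaled_le t2.
have ntr : `|(- t) *: z| <= r by rewrite scaleNr normrN.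
rewrite addrC -(al_line AL ntr sr) scaleNr (al_opp AL tr).
by rewrite /alpha invgM !mulgA mulgVK.
Qed.

Let near2 (s t : R) : 0 <= t -> t <= 1 -> `|s - t| <= 1 -> `|s| <= 2 /\ `|t| <= 2.
Proof.
move=> t0 t1; rewrite !ler_norml => /andP[h1 h2].
by split; apply/andP; split; lra.
Qed.

Lemma log_path_has_diff (t : R) : 0 <= t -> t <= 1 ->
  has_diff (fun s => c1 ((alpha t)^-1 * alpha s)%g) t (fun s => s *: z).
Proof.
move=> t0 t1 e e0; have K0 : 0 < C * (`|z| * `|z|) + 1 by rewrite ltr_wpDl// !mulr_ge0// ltW.
have [d [d0 d1 de]] : exists d : R, [/\ 0 < d, d <= 1 & (C * (`|z| * `|z|) + 1) * d <= e].
  exists (Num.min 1 (e / (C * (`|z| * `|z|) + 1))); split.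
  - by rewrite lt_min ltr01 divr_gt0.
  - by rewrite ge_min lexx.
  - by rewrite mulrC -ler_pdivlMr// ge_min lexx orbT.
exists d => // h hd; have h1 : `|t + h - t| <= 1 by rewrite addrC addKr ltW// (lt_le_trans hd).
have [th2 t2] := near2 t0 t1 h1.
have th : t + h - t = h by rewrite addrC addKr.
rewrite log_path_increment// th mulVg.
have hz : `|h *: z| <= r by apply: scaled_le; rewrite th in h1; lra.
have := ex_chart_sub L hz; rewrite /chart_phi => h2; apply: le_trans h2 _.
rewrite normrZ (_ : C * _ * _ = (C * (`|z| * `|z|) * `|h|) * `|h|); last by ring.
apply: ler_wpM2r => //; apply: le_trans de; have := normr_ge0 h.
have k0 : 0 <= C * (`|z| * `|z|) by rewrite !mulr_ge0// ltW.
move=> h0; apply: (@le_trans _ _ (C * (`|z| * `|z|) * d)).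
  by apply: ler_wpM2l => //; exact: ltW.
by rewrite ler_pM2r// lerDl.
Qed.

Lemma log_path_continuous (t : R) : 0 <= t -> t <= 1 -> alpha s @[s --> t] --> alpha t.
Proof.
move=> t0 t1 X nX.
have := @lie_mul_continuous _ _ G (alpha t, 1%g) X; rewrite /= mulg1 => /(_ nX).
move=> [[A B] /= [nA nB] AB].
have : \forall y \near (0 : V), B (ex y) by exact: (ex_cvg0 L Cr nB).
move=> /nearN [d d0 Hd].
have m0 : 0 < `|z| + 1 by rewrite ltr_wpDl.
suff : \forall s \near t, X (alpha s) by [].
apply/nearN; exists (Num.min 1 (d / (`|z| + 1))) => [|s].
  by rewrite lt_min ltr01 divr_gt0.
rewrite lt_min ltr_pdivlMr// => /andP[s1 sd].
have [s2 t2] := near2 t0 t1 (ltW s1).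
rewrite -(mulVKg (alpha t) (alpha s)) log_path_increment//.
apply: (AB (alpha t, ex ((s - t) *: z))); split => /=; first exact: nbhs_singleton nA.
apply: Hd; rewrite subr0 normrZ; apply: le_lt_trans sd.
by apply: ler_wpM2l => //; rewrite lerDl.
Qed.

Lemma log_path_abs_continuous : abs_continuous_path 0 1 alpha.
Proof.
split.
  apply: continuous_in_subspaceT => t; rewrite inE /= in_itv /= => /andP[t0 t1].
  exact: log_path_continuous.
move=> t; rewrite in_itv /= => /andP[t0 t1].
have [d [K [A [d0 K0 nA tr]]]] := left_translation (alpha t) (1%g : G).
rewrite mulg1 -/c1 in tr.
have m0 : 0 < 2 * (`|z| + 1) by rewrite mulr_gt0// ltr_wpDl.
have [e [e0 e1 ed]] : exists e : R, [/\ 0 < e, e <= 1 & e * (2 * (`|z| + 1)) < d].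
  exists (Num.min 1 (d / 2 / (2 * (`|z| + 1)))); split.
  - by rewrite lt_min ltr01 !divr_gt0.
  - by rewrite ge_min lexx.
  - rewrite -ltr_pdivlMr// gt_min; apply/orP; right.
    by rewrite ltr_pM2r ?invr_gt0//; lra.
exists e => //=; set c : chart R n G := chart_at (alpha t).
have near_s s : Num.max 0 (t - e) <= s -> s <= Num.min 1 (t + e) ->
    [/\ `|s| <= 2, alpha s = (alpha t * ex ((s - t) *: z))%g, `|(s - t) *: z| <= r,
      `|c1 (ex ((s - t) *: z)) - p0| < d &
      chart_inv c1 (c1 (ex ((s - t) *: z))) = ex ((s - t) *: z)].
  rewrite ge_max le_min => /andP[s0 s1] /andP[s2 s3].
  have se : `|s - t| <= e by rewrite ler_norml; apply/andP; split; lra.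
  have [sn tn] := near2 t0 t1 (le_trans se e1).
  have zr' : `|(s - t) *: z| <= r by apply: scaled_le; lra.
  split => //.
  - by rewrite -log_path_increment// mulVKg.
  - have := ex_chart_le L Cr zr'; rewrite /chart_phi normrZ => h; apply: le_lt_trans h _.
    apply: le_lt_trans ed; rewrite mulrCA; by apply: ler_pM => //; rewrite ?mulr_ge0// ler_pM2l// lerDl.
  - by rewrite chart_funK//; exact: ex_dom L _ zr'.
split.
  move=> s; rewrite in_itv /= => /andP[s0 s1]; have [_ Es _ sd sK] := near_s s s0 s1.
  by have [_ h _ _] := tr _ _ (nbhs_singleton nA) sd; rewrite Es; rewrite sK in h.
apply: (@abs_continuous_lipschitz _ _ _ _ _ (K * (2 * `|z|))) => s s' s0 ss' s1.
have [_ Es sr sd sK] := near_s s s0 (le_trans ss' s1).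
have [_ Es' sr' sd' sK'] := near_s s' (le_trans s0 ss') s1.
have [_ _ h _] := tr _ _ (nbhs_singleton nA) sd'.
have {h} := h _ sd; rewrite sK sK' -Es -Es' => h; apply: le_trans h _.
rewrite -mulrA ler_pM2l//.
have := near_linear_lip ler01 (ex_chart L) (lexx r) sr' sr.
rewrite /= /chart_phi opprB addrA subrK -scalerBl opprB addrA subrK normrZ.
rewrite (ger0_norm (_ : 0 <= s' - s)) ?subr_ge0// => h; apply: le_trans h _.
rewrite [(s' - s) * _]mulrC mulrA; apply: ler_wpM2r; first by rewrite subr_ge0.
by apply: ler_wpM2r => //; have := Cr; lra.
Qed.

Lemma log_path_speed (t : R) : t \in `[0, 1] -> speed N alpha t = N z.
Proof.
by rewrite in_itv /= => /andP[t0 t1]; apply: speed_has_diff; exact: log_path_has_diff.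
Qed.

Lemma log_path_rectifiable : rectifiable N 0 1 alpha.
Proof.
split; first exact: log_path_abs_continuous.
apply: (@eq_integrable _ _ _ mu _ _ (cst (N z)%:E)) => //.
  by move=> t; rewrite inE /= => t01; rewrite log_path_speed.
by apply: continuous_compact_integrable; [exact: segment_compact|exact: continuous_subspaceT (@cst_continuous _ _ _)].
Qed.

Lemma log_path_length : path_length N 0 1 alpha = N z.
Proof.
rewrite /path_length (@eq_Rintegral _ _ _ mu _ (fun _ => N z)); last first.
  by move=> t; rewrite inE /= => t01; rewrite log_path_speed.
have E := @lebesgue_measure_itv R `[0, 1]%R; rewrite /= lte_fin ltr01 in E.
by rewrite Rintegral_cst// [X in fine X]E /= subr0 mulr1.
Qed.

End LogPath.

Lemma finsler_dist_log : exists2 rho : R, 0 < rho & forall (g : G) (z : V), `|z| <= rho ->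
  finsler_dist N g (g * ex z)%g = N z.
Proof.
have [c c0 lo] := finsler_lower finsler_N.
have [c' c'0 up] := finsler_upper finsler_N.
have cc0 : 0 < c * c' by rewrite mulr_gt0.
(* The first bound keeps the straight path in the domain; the second gives c N z <= r / 1024, the
   condition of [path_length_ge]. *)
have [rho [rho0 rr rc]] : exists rho : R, [/\ 0 < rho, rho <= r / 2 & c * c' * rho <= r / 16 / 64].
  exists (Num.min (r / 2) (r / 16 / 64 / (c * c'))); split.
  - by rewrite lt_min !divr_gt0.
  - by rewrite ge_min lexx.
  - by rewrite mulrC -ler_pdivlMr// ge_min lexx orbT.
exists rho => // g z zr; have z2 := le_trans zr rr.
have zr' : `|z| <= r by apply: le_trans z2 _; have := r_gt0; lra.
have cz : c * N z <= r / 16 / 64.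
  apply: le_trans rc; rewrite -mulrA ler_pM2l//.
  by apply: le_trans (up z) _; rewrite ler_pM2l.
rewrite /finsler_dist; set S := [set _ | _].
have SN : S (N z).
  exists 0, 1, (fun t => (g * ex (t *: z))%g); split => //.
  - exact: log_path_rectifiable.
  - by rewrite scale0r (ex0 L) mulg1.
  - by rewrite scale1r.
  - by rewrite log_path_length.
have lb : lbound S (N z).
  move=> _ [a [b [alpha [ab rec Ea Eb ->]]]].
  exact: (path_length_ge AL finsler_N invariant_N lo c0 ab rec Ea Eb zr' cz).
apply/eqP; rewrite eq_le; apply/andP; split.
  by apply: ge_inf => //; exists (N z).
by apply: lb_le_inf => //; exists (N z).
Qed.

End LogDistance.

(** * Radial limits *)

Section RadialLimits.
Variables (R : realType) (D : R -> R) (a q : R).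
Hypothesis D_expansion : forall e : R, 0 < e ->
  \forall s \near 0^'+, `|D s - s * a - s ^+ 3 * (q / 24)| <= e * s ^+ 3.

Let F (s : R) := (s * a - D s) / s ^+ 3.

Let F_cvg : F s @[s --> 0^'+] --> - q / 24.
Proof.
apply/cvgrPdist_le => e e0; apply: filterS2 (right0_gt0 R) (D_expansion e0) => s s0 h.
have s3 : 0 < s ^+ 3 by rewrite exprn_gt0.
have -> : - q / 24 - F s = (D s - s * a - s ^+ 3 * (q / 24)) / s ^+ 3.
  by rewrite /F; field; rewrite gt_eqF.
by rewrite normrM normfV (gtr0_norm s3) ler_pdivrMr.
Qed.

Let id_cvg : s @[s --> (0 : R)^'+] --> (0 : R).
Proof. exact: cvg_at_right_filter cvg_id. Qed.

Let sqr_cvg : s ^+ 2 @[s --> (0 : R)^'+] --> (0 : R).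
Proof.
have h : (s * s) @[s --> (0 : R)^'+] --> (0 * 0 : R) by exact: (cvgM id_cvg id_cvg).
by rewrite mulr0 in h.
Qed.

Let sqr_right : s ^+ 2 @[s --> (0 : R)^'+] --> (0 : R)^'+.
Proof.
move=> P /near_right0P [d d0 H].
suff : \forall s \near (0 : R)^'+, P (s ^+ 2) by [].
apply/near_right0P; exists (Num.min 1 d) => [|s s0]; first by rewrite lt_min ltr01.
rewrite lt_min => /andP[s1 sd]; apply: H; first by rewrite exprn_gt0.
by apply: le_lt_trans sd; rewrite expr2 ler_piMl// ltW.
Qed.

(** The quotient is F s divided by D s / s, and D s / s = a - s^2 F s tends to a. *)
Lemma radial_quotient_cvg : a != 0 ->
  (r * a - D r) / (r ^+ 2 * D r) @[r --> 0^'+] --> - q / 24 / a.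
Proof.
move=> a0.
have H_cvg : a - s ^+ 2 * F s @[s --> 0^'+] --> a.
  have h : a - s ^+ 2 * F s @[s --> 0^'+] --> a - 0 * (- q / 24).
    by exact: (cvgB (cvg_cst a) (cvgM sqr_cvg F_cvg)).
  by rewrite mul0r subr0 in h.
have h : F s * (a - s ^+ 2 * F s)^-1 @[s --> 0^'+] --> - q / 24 / a.
  by exact: (cvgM F_cvg (cvgV a0 H_cvg)).
apply: cvg_trans h; apply: near_eq_cvg.
apply: filterS (right0_gt0 R) => s s0 /=; have sn0 : s != 0 by rewrite gt_eqF.
have -> : a - s ^+ 2 * F s = D s / s by rewrite /F; field.
by rewrite /F invf_div [in RHS]invfM; move: (D s)^-1 => i; field.
Qed.

(** The linear terms s^2 a cancel, and what remains is F s - s^2 F (s^2). *)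
Lemma radial_difference_cvg :
  (D (r ^+ 2) - r * D r) / r ^+ 4 @[r --> 0^'+] --> - q / 24.
Proof.
have F2_cvg : F (s ^+ 2) @[s --> 0^'+] --> - q / 24.
  by exact: (cvg_comp (fun s : R => s ^+ 2) F sqr_right F_cvg).
have h : F s - s ^+ 2 * F (s ^+ 2) @[s --> 0^'+] --> - q / 24 - 0 * (- q / 24).
  by exact: (cvgB F_cvg (cvgM sqr_cvg F2_cvg)).
rewrite mul0r subr0 in h; apply: cvg_trans h.
apply: near_eq_cvg; apply: filterS (right0_gt0 R) => s s0 /=.
have sn0 : s != 0 by rewrite gt_eqF.
by rewrite /F; field.
Qed.

End RadialLimits.

(** * Expansion of the distance between exponentials *)

Section RadialDistance.
Variables (R : realType) (n : nat) (G : lieGroupType R n).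
Local Notation V := 'rV[R]_n.
Variable N : V -> R.
Hypothesis finsler_N : finsler_norm N.
Hypothesis invariant_N : Ad_invariant G N.

(** N (s v + (s^3 / 24) X) is s N (v + t X) with t = s^2 / 24. The directional derivative bounds it
    below without error and above up to e t, and the O(s^4) of [finsler_log_expansion] fits into
    half of e s^3. *)
Lemma exp_dist_expansion (x y : V) (e : R) : 0 < e ->
  \forall s \near 0^'+, `|exp_dist G N (s *: x) (s *: y) - s * N (y - x) -
    s ^+ 3 * (dir_deriv N (y - x) (lie_bracket G x (lie_bracket G x (y - x))) / 24)|
    <= e * s ^+ 3.
Proof.
move=> e0; have [ex [Log [r [C AL]]]] := exists_adapted_log G.
have LC := adapted_log_calculus AL; have L := al_log AL.
have r0 := log_r_gt0 L.
have [rho rho0 dist] := finsler_dist_log AL finsler_N invariant_N.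
have inv z w : N (Ad (ex z) w) = N w by exact: invariant_N.
set v := y - x; set X := lie_bracket G x _; set q := dir_deriv N v X.
have [s0 [s00 s0r s0rho]] : exists s0 : R, [/\ 0 < s0, s0 <= r & 4 * s0 <= rho].
  exists (Num.min r (rho / 4)); split; first by rewrite lt_min r0 divr_gt0.
    by rewrite ge_min lexx.
  by rewrite mulrC -ler_pdivlMr// ge_min lexx orbT.
have E1 : \forall s \near 0^'+, exp_dist G N (s *: x) (s *: y) =
    N (Log (ex (- (s *: x)) * ex (s *: y))%g).
  apply: filterS2 (bigO_small s00 (bigO_line x)) (bigO_small s00 (bigO_line y)) => s xs ys.
  have xr := le_trans xs s0r; have yr := le_trans ys s0r.
  have nxs : `|- (s *: x)| <= s0 by rewrite normrN.
  have nxr := le_trans nxs s0r.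
  rewrite /exp_dist (al_exp AL xr) (al_exp AL yr).
  have zr := le_trans (lc_mul_le LC s0r nxs ys) s0rho.
  by rewrite -(dist (ex (s *: x)) _ zr) (log_mulK L nxr yr) (al_opp AL xr) mulVKg.
have [K E2] := finsler_log_expansion LC finsler_N inv x y.
have e20 : 0 < e / 2 by rewrite divr_gt0.
have [d d0 Hd] := dir_deriv_adherent finsler_N v X e0.
have sK : \forall s \near (0 : R)^'+, K * s <= e / 2.
  have := bigO_small e20 (bigO_line (K : R^o)); apply: filterS => s.
  by apply: le_trans; rewrite mulrC; exact: ler_norm.
have sd : \forall s \near (0 : R)^'+, s ^+ 2 / 24 <= d.
  have d1 : 0 < Num.min 1 d by rewrite lt_min ltr01.
  apply/near_right0P; exists (Num.min 1 d) => // s s_gt0; rewrite lt_min => /andP[s1 sd].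
  have : s ^+ 2 <= s by rewrite expr2 ler_piMl// ltW.
  have := exprn_ge0 2 (ltW s_gt0); lra.
apply: filterS3 (filterI E1 E2) (filterI sK sd) (right0_gt0 R) => s [-> h2] [hK hd] s_gt0.
have t0 : 0 < s ^+ 2 / 24 by rewrite divr_gt0// exprn_gt0.
have lo := dir_deriv_le finsler_N v X t0.
have up := Hd _ t0 hd.
have E : N (s *: v + (s ^+ 3 / 24) *: X) = s * N (v + (s ^+ 2 / 24) *: X).
  rewrite -(finslerZ finsler_N _ (ltW s_gt0)); congr N.
  by rewrite [RHS]scalerDr scalerA; congr (_ + _ *: _); ring.
rewrite -/v -/X E in h2.
have lo' : 0 <= s * N (v + (s ^+ 2 / 24) *: X) - s * N v - s ^+ 3 * (q / 24).
  rewrite (_ : _ - _ - _ = s * (N (v + (s ^+ 2 / 24) *: X) - (N v + s ^+ 2 / 24 * q))); last by field.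
  by rewrite mulr_ge0 ?subr_ge0// ltW.
have up' : s * N (v + (s ^+ 2 / 24) *: X) - s * N v - s ^+ 3 * (q / 24) <= e / 24 * s ^+ 3.
  rewrite (_ : _ - _ - _ = s * (N (v + (s ^+ 2 / 24) *: X) - (N v + s ^+ 2 / 24 * q))); last by field.
  rewrite (_ : e / 24 * s ^+ 3 = s * (s ^+ 2 / 24 * e)); last by field.
  by rewrite ler_pM2l//; rewrite -/q mulrDr in up; lra.
have s3 : 0 < s ^+ 3 by rewrite exprn_gt0.
have h4 : K * s ^+ 4 <= e / 2 * s ^+ 3 by rewrite exprS mulrA ler_pM2r.
have es : 0 <= e * s ^+ 3 by rewrite mulr_ge0// ltW.
move: h2 lo' up'; rewrite ler_norml => /andP[h2 h2'] lo' up'.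
move: h4; move: (K * s ^+ 4) (s ^+ 3) => k4 c3 in h2 h2' lo' up' es *.
rewrite ler_norml => h4; apply/andP; split; lra.
Qed.

End RadialDistance.

Unset Implicit Arguments.

Theorem theoremB (R : realType) (n : nat) (G : lieGroupType R n)
    (N : 'rV[R]_n -> R)
    (connected_G : connected [set: G])
    (finsler_N : finsler_norm N)
    (invariant_N : Ad_invariant G N)
    (x y : 'rV[R]_n) :
  let v := y - x in
  let d := exp_dist G N in
  let Q (r : R) :=
    (d (r ^+ 2 *: x) (r ^+ 2 *: y) - r * d (r *: x) (r *: y)) / r ^+ 4 in
  let A : set R := [set phi (lie_bracket G x (lie_bracket G x v)) |
                     phi in norming N v] in
  (x <> y -> cvg (S_quotient G N x y r @[r --> 0^'+])) /\
  cvg (Q r @[r --> 0^'+]) /\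
  S_curv G N x y = 6 * N v * lim (Q r @[r --> 0^'+]) /\
  ((0 < n)%N -> is_max A (sup A)) /\
  S_curv G N x y = - (N v / 4) * sup A /\
  0 <= S_curv G N x y.
Proof.
move=> v d Q A.
have Dexp := exp_dist_expansion finsler_N invariant_N x y.
have bracket_le0 : dir_deriv N v (lie_bracket G x (lie_bracket G x v)) <= 0.
  have [ex [Log [r [C AL]]]] := exists_adapted_log G.
  by apply: (dir_deriv_bracket (adapted_log_calculus AL) finsler_N) => z w; exact: invariant_N.
have bracket0 : lie_bracket G x 0 = 0.
  have [ex [Log [r [C AL]]]] := exists_adapted_log G.
  by rewrite -[X in lie_bracket G x X](scale0r 0) (bracketZr (adapted_log_calculus AL)) scale0r.
rewrite -/v in Dexp; set q := dir_deriv N v _ in Dexp bracket_le0.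
have Qcvg : Q r @[r --> 0^'+] --> - q / 24 := radial_difference_cvg Dexp.
have limQ : lim (Q r @[r --> 0^'+]) = - q / 24 by exact: (cvg_lim (@Rhausdorff R) Qcvg).
have Nv0 : 0 <= N v by exact: finsler_ge0.
split; first last; [split; first by apply/cvg_ex; exists (- q / 24)|].
  (* For x = y both N v and [x, [x, v]] are 0, so each side vanishes; the maximum is that of the set
     {0}, which is inhabited once a functional of dual norm 1 exists. *)
  have [xy|/eqP xy] := eqVneq x y.
    have v0 : v = 0 by rewrite /v xy subrr.
    have Nv : N v = 0 by rewrite v0 finsler0.
    have S0 : S_curv G N x y = 0 by rewrite /S_curv xy eqxx.
    rewrite S0 Nv mulr0 !mul0r oppr0 mul0r; split=> //; split=> // n0.
    rewrite /A v0 !bracket0.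
    have [phi np] := norming0 finsler_N n0.
    have A0 : is_max [set phi 0 | phi in norming N 0] (0 : R).
      split; first by exists phi => //; rewrite linear0.
      by move=> _ [psi _ <-]; rewrite linear0.
    by rewrite (is_max_sup A0).
  have v0 : v != 0 by rewrite /v subr_eq0 eq_sym; apply/eqP.
  have Nv : 0 < N v by exact: finsler_gt0.
  have maxA : is_max A q by exact: norming_max.
  have Sq := radial_quotient_cvg Dexp (lt0r_neq0 Nv).
  have limS : lim (S_quotient G N x y r @[r --> 0^'+]) = - q / 24 / N v.
    exact: (cvg_lim (@Rhausdorff R) Sq).
  have SE : S_curv G N x y = - (N v / 4) * q.
    rewrite /S_curv (negbTE (introN eqP xy)) -/v.
    by rewrite limS; field; rewrite gt_eqF.
  rewrite SE limQ (is_max_sup maxA); split; [by field|split=> //; split=> //].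
  by rewrite mulNr -mulrN mulr_ge0 ?divr_ge0 ?oppr_ge0.
move=> xy; have v0 : v != 0 by rewrite /v subr_eq0 eq_sym; apply/eqP.
have Nv : 0 < N v by exact: finsler_gt0.
apply/cvg_ex; exists (- q / 24 / N v).
exact: (radial_quotient_cvg Dexp (lt0r_neq0 Nv)).
Qed.
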